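(* Let $S$ be a preordered semiring with a power universal element $u\in S$. Suppose that for some $d\in\mathbb{N}$ there is a surjective homomorphism $\|\cdot\|:S\to\mathbb{R}_{>0}^d\cup\{0\}$ with trivial kernel and such that for all $a,b\in S$, \[ a\le b\ \Longrightarrow\ \|a\|=\|b\|\ \Longrightarrow\ a\sim b. \] Let $x,y\in S$ be nonzero with $\|x\|=\|y\|$. Then the following are equivalent: \begin{enumerate} \item[(a)] \begin{itemize} \item For every nondegenerate monotone homomorphism $\phi:S\to\mathbb{K}$ with trivial kernel and $\mathbb{K}\in\{\mathbb{R}_+,\mathbb{R}_+^{\mathrm{op}},\mathbb{TR}_+,\mathbb{TR}_+^{\mathrm{op}}\}$, $\phi(x)\le\phi(y)$ (in the order of $\mathbb{K}$). \item For every $i=1,\ldots,d$ and every monotone $\|\cdot\|_i$-derivation $D:S\to\mathbb{R}$ with $D(u)=1$, $D(x)\le D(y)$. \end{itemize} \item[(b)] For every $\varepsilon>0$, we have $x^n\le u^{\lfloor\varepsilon n\rfloor}y^n$ for all $n\gg 1$. \end{enumerate} Moreover, suppose that the inequalities in (a) are all strict. Then also the following hold: \begin{enumerate} \item[(c)] There is $k\in\mathbb{N}$ such that $u^kx^n\le u^ky^n$ for all $n\gg 1$. \item[(d)] If $y$ is power universal as well, then $x^n\le y^n$ for all $n\gg1$. \item[(e)] There is nonzero $a\in S$ such that $ax\le ay$. Moreover, there is $k\in\mathbb{N}$ such that $a:=u^k\sum_{j=0}^n x^jy^{n-j}$ for any $n\gg 1$ does the job. \end{enumerate} Finally, if $S$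 is also a semialgebra, then all of these statements also hold with only $\mathbb{R}_+$-linear derivations $D$ in (a).
   Context: All semirings are commutative with $0$ (absorbing) and $1$, and homomorphisms are semiring homomorphisms; $\mathbb{N}\ni 0$. ''For all $n\gg1$'' means for all sufficiently large $n\in\mathbb{N}$. A preorder is a reflexive transitive relation; $x<y$ means $x\le y$ and not $y\le x$; $\sim$ is the equivalence relation generated by $\le$. A preordered semiring is a semiring with a preorder such that addition by $a$ and multiplication by $a$ are monotone for every element $a$ (it is not required that $1\ge0$). A power universal element is a nonzero $u\in S$ with $1\le u$ and such that for all nonzero $x\le y$ in $S$ there is $k\in\mathbb{N}$ with $y\le xu^k$. $\mathbb{R}_{>0}^d\cup\{0\}$ is the semifield with componentwise operations, consisting of the vectors with all components strictly positive together with the zero element (for $d=0$ it is the Boolean semifield $\{0,1\}$ with $1+1=1$). The components of $\|\cdot\|$ are homomorphisms $\|\cdot\|_1,\ldots,\|\cdot\|_d:S\to\mathbb{R}_+$. $\mathbb{R}_+=[0,\infty)$ with the usual operations and order; $\mathbb{TR}_+=([0,\infty),\max,\cdot)$ (the tropical reals) with the usual order; $\mathrm{op}$ denotes the same semiring with reversed preorder. A homomorphism has trivial kernel if only $0$ is mapped to $0$. A homomorphism $\phi$ out of a preordered semiring is degenerate if $x\le y$ implies $\phi(x)=\phi(y)$, and nondegenerate otherwise. For a homomorphism $\phi:S\to\mathbb{R}_+$, a $\phi$-derivation is an additive map $D:S\to\mathbb{R}$ satisfying the Leibniz rule $D(xy)=\phi(x)D(y)+D(x)\phi(y)$ for all $x,y\in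 S$. A semialgebra is a semiring $S$ with a scalar multiplication $\mathbb{R}_+\times S\to S$ which is a commutative monoid homomorphism (for addition) in each argument and satisfies $1x=x$ and $(rx)(sy)=(rs)(xy)$. *)

(* Defs.v *)
From HB Require Import structures.
From Stdlib Require Export Relations.
From mathcomp Require Export all_boot all_order all_algebra.
From mathcomp Require Export interval_inference.
From mathcomp Require Export all_classical all_reals topology.
Set Implicit Arguments.
Unset Strict Implicit.
Unset Printing Implicit Defensive.
Import Order.TTheory GRing.Theory Num.Theory.
Local Open Scope classical_set_scope.
Local Open Scope ring_scope.

(* Unlike in MathComp's ordered rings, 0 <= 1 is not assumed. *)
Record preorderedSemiRing : Type := PreorderedSemiRing {
  carrier :> comPzSemiRingType ;
  sle : carrier -> carrier -> Prop ;
  sle_preorder : preorder carrier sle ;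
  sle_add : forall a x y, sle x y -> sle (a + x) (a + y) ;
  sle_mul : forall a x y, sle x y -> sle (a * x) (a * y)
}.
Arguments sle {_} _ _.

Declare Scope semiring_order_scope.
Delimit Scope semiring_order_scope with S.
Notation "x <= y" := (sle x y) : semiring_order_scope.
Definition slt (S : preorderedSemiRing) (x y : S) : Prop :=
  (x <= y)%S /\ ~ (y <= x)%S.
Notation "x < y" := (slt x y) : semiring_order_scope.

Section Opposite.
Variable S : preorderedSemiRing.

Fact op_preorder : preorder S (fun x y => (y <= x)%S).
Proof.
have [rf tr] := sle_preorder S.
by split=> [x|x y z xy yz]; [exact: rf | exact: tr yz xy].
Qed.

Definition opposite : preorderedSemiRing :=
  @PreorderedSemiRing S (fun x y => (y <= x)%S) op_preorder
    (fun a x y => @sle_add S a y x) (fun a x y => @sle_mul S a y x).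
End Opposite.

Definition nnreal (R : realType) : Type := {nonneg R}.

Section NNReal.
Variable R : realType.
Implicit Types a b c x y : nnreal R.

HB.instance Definition _ := Order.Total.on (nnreal R).

Definition nnreal_add a b : nnreal R := (a%:num + b%:num)%:nng.
Definition nnreal_mul a b : nnreal R := (a%:num * b%:num)%:nng.

Fact nnreal_addA : associative nnreal_add.
Proof. by move=> a b c; apply/val_inj; rewrite /= addrA. Qed.
Fact nnreal_addC : commutative nnreal_add.
Proof. by move=> a b; apply/val_inj; rewrite /= addrC. Qed.
Fact nnreal_add0 : left_id (0%:nng : nnreal R) nnreal_add.
Proof. by move=> a; apply/val_inj; rewrite /= add0r. Qed.
HB.instance Definition _ :=
  GRing.isNmodule.Build (nnreal R) nnreal_addA nnreal_addC nnreal_add0.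

Fact nnreal_mulA : associative nnreal_mul.
Proof. by move=> a b c; apply/val_inj; rewrite /= mulrA. Qed.
Fact nnreal_mulC : commutative nnreal_mul.
Proof. by move=> a b; apply/val_inj; rewrite /= mulrC. Qed.
Fact nnreal_mul1 : left_id (1%:nng : nnreal R) nnreal_mul.
Proof. by move=> a; apply/val_inj; rewrite /= mul1r. Qed.
Fact nnreal_mulDl : left_distributive nnreal_mul +%R.
Proof. by move=> a b c; apply/val_inj; rewrite /= mulrDl. Qed.
Fact nnreal_mul0 : left_zero (0 : nnreal R) nnreal_mul.
Proof. by move=> a; apply/val_inj; rewrite /= mul0r. Qed.
HB.instance Definition _ :=
  GRing.Nmodule_isComPzSemiRing.Build (nnreal R)
    nnreal_mulA nnreal_mulC nnreal_mul1 nnreal_mulDl nnreal_mul0.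

Fact nnreal_add_mono a x y : (x <= y)%O -> (a + x <= a + y)%O.
Proof. by rewrite -!num_le /= lerD2l. Qed.
Fact nnreal_mul_mono a x y : (x <= y)%O -> (a * x <= a * y)%O.
Proof. by rewrite -!num_le => xy; exact: ler_wpM2l. Qed.
Fact nnreal_preorder : preorder (nnreal R) (fun x y => (x <= y)%O).
Proof. by split=> [x|x y z]; [exact: lexx | exact: le_trans]. Qed.
Definition Rplus : preorderedSemiRing :=
  @PreorderedSemiRing (nnreal R) (fun x y => (x <= y)%O) nnreal_preorder
    nnreal_add_mono nnreal_mul_mono.
End NNReal.

Definition tropical (R : realType) : Type := {nonneg R}.

Section Tropical.
Variable R : realType.
Implicit Types a b c x y : tropical R.

HB.instance Definition _ := Order.Total.on (tropical R).

Definition tropical_add a b : tropical R := Order.max a b.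
Definition tropical_mul a b : tropical R := (a%:num * b%:num)%:nng.

Fact tropical_addA : associative tropical_add.
Proof. exact: maxA. Qed.
Fact tropical_addC : commutative tropical_add.
Proof. exact: maxC. Qed.
Fact tropical_add0 : left_id (0%:nng : tropical R) tropical_add.
Proof. by move=> a; apply/max_idPr; rewrite -num_le /=. Qed.
HB.instance Definition _ :=
  GRing.isNmodule.Build (tropical R)
    tropical_addA tropical_addC tropical_add0.

Fact tropical_mulA : associative tropical_mul.
Proof. by move=> a b c; apply/val_inj; rewrite /= mulrA. Qed.
Fact tropical_mulC : commutative tropical_mul.
Proof. by move=> a b; apply/val_inj; rewrite /= mulrC. Qed.
Fact tropical_mul1 : left_id (1%:nng : tropical R) tropical_mul.
Proof. by move=> a; apply/val_inj; rewrite /= mul1r. Qed.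
Fact tropical_le_mul a x y :
  (x <= y)%O -> (tropical_mul a x <= tropical_mul a y)%O.
Proof. by rewrite -!num_le => xy; exact: ler_wpM2l. Qed.
Fact tropical_mulDl : left_distributive tropical_mul +%R.
Proof.
move=> a b c; rewrite ![tropical_mul _ c]tropical_mulC.
case: (leP a b) => [ab|/ltW ba].
- by rewrite [a + b]max_r // [RHS]max_r //; exact: tropical_le_mul.
- by rewrite [a + b]max_l // [RHS]max_l //; exact: tropical_le_mul.
Qed.
Fact tropical_mul0 : left_zero (0 : tropical R) tropical_mul.
Proof. by move=> a; apply/val_inj; rewrite /= mul0r. Qed.
HB.instance Definition _ :=
  GRing.Nmodule_isComPzSemiRing.Build (tropical R)
    tropical_mulA tropical_mulC tropical_mul1 tropical_mulDl tropical_mul0.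

Fact tropical_add_mono a x y : (x <= y)%O -> (a + x <= a + y)%O.
Proof. by move=> xy; rewrite ge_max !le_max lexx xy orbT. Qed.
Fact tropical_preorder : preorder (tropical R) (fun x y => (x <= y)%O).
Proof. by split=> [x|x y z]; [exact: lexx | exact: le_trans]. Qed.
Definition TRplus : preorderedSemiRing :=
  @PreorderedSemiRing (tropical R) (fun x y => (x <= y)%O) tropical_preorder
    tropical_add_mono tropical_le_mul.
End Tropical.

(* The semifield R_{>0}^d U {0}. The zero is a separate point [None], so that
   for d = 0 it differs from the unique (empty) vector, as it should. *)
Definition posvec (R : realType) (d : nat) : Type :=
  option {ffun 'I_d -> {posnum R}}.

Section PosVec.
Variables (R : realType) (d : nat).
Implicit Types v w z : posvec R d.

HB.instance Definition _ := Choice.on (posvec R d).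

Definition posvec_add v w : posvec R d :=
  match v, w with
  | None, _ => w
  | _, None => v
  | Some f, Some g => Some [ffun i => ((f i)%:num + (g i)%:num)%:pos]
  end.
Definition posvec_mul v w : posvec R d :=
  match v, w with
  | Some f, Some g => Some [ffun i => ((f i)%:num * (g i)%:num)%:pos]
  | _, _ => None
  end.
Definition posvec_zero : posvec R d := None.
Definition posvec_one : posvec R d := Some [ffun=> 1%:pos].

Fact posvec_addA : associative posvec_add.
Proof.
move=> [f|] [g|] [h|] //=; congr Some; apply/ffunP => i.
by rewrite !ffunE; apply/val_inj; rewrite /= addrA.
Qed.
Fact posvec_addC : commutative posvec_add.
Proof.
move=> [f|] [g|] //=; congr Some; apply/ffunP => i.
by rewrite !ffunE; apply/val_inj; rewrite /= addrC.
Qed.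
Fact posvec_add0 : left_id posvec_zero posvec_add.
Proof. by []. Qed.
HB.instance Definition _ :=
  GRing.isNmodule.Build (posvec R d) posvec_addA posvec_addC posvec_add0.

Fact posvec_mulA : associative posvec_mul.
Proof.
move=> [f|] [g|] [h|] //=; congr Some; apply/ffunP => i.
by rewrite !ffunE; apply/val_inj; rewrite /= mulrA.
Qed.
Fact posvec_mulC : commutative posvec_mul.
Proof.
move=> [f|] [g|] //=; congr Some; apply/ffunP => i.
by rewrite !ffunE; apply/val_inj; rewrite /= mulrC.
Qed.
Fact posvec_mul1 : left_id posvec_one posvec_mul.
Proof.
move=> [f|] //=; congr Some; apply/ffunP => i.
by rewrite !ffunE; apply/val_inj; rewrite /= mul1r.
Qed.
Fact posvec_mulDl : left_distributive posvec_mul +%R.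
Proof.
move=> [f|] [g|] [h|] //=; congr Some; apply/ffunP => i.
by rewrite !ffunE; apply/val_inj; rewrite /= mulrDl.
Qed.
Fact posvec_mul0 : left_zero (0 : posvec R d) posvec_mul.
Proof. by []. Qed.
HB.instance Definition _ :=
  GRing.Nmodule_isComPzSemiRing.Build (posvec R d)
    posvec_mulA posvec_mulC posvec_mul1 posvec_mulDl posvec_mul0.

Definition component (i : 'I_d) v : nnreal R :=
  if v is Some f then (f i)%:num%:nng else 0.

Fact component_nmod_morphism i : nmod_morphism (component i).
Proof.
split=> // -[f|] [g|]; apply/val_inj; rewrite /= ?ffunE /= ?addr0 ?add0r //.
Qed.
Fact component_monoid_morphism i : monoid_morphism (component i).
Proof.
by split=> [|[f|] [g|]]; apply/val_inj; rewrite /= ?ffunE /= ?mulr0 ?mul0r.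
Qed.
HB.instance Definition _ i :=
  GRing.isNmodMorphism.Build (posvec R d) (nnreal R) (component i)
    (component_nmod_morphism i).
HB.instance Definition _ i :=
  GRing.isMonoidMorphism.Build (posvec R d) (nnreal R) (component i)
    (component_monoid_morphism i).
End PosVec.

Section Notions.
Variable S : preorderedSemiRing.
Implicit Types a b u x y : S.

Definition power_universal u : Prop :=
  [/\ u != 0, (1 <= u)%S &
      forall x y, x != 0 -> y != 0 -> (x <= y)%S ->
        exists k : nat, (y <= x * u ^+ k)%S].

Definition order_connected : S -> S -> Prop :=
  clos_refl_sym_trans S (fun a b => (a <= b)%S).

Definition trivial_kernel (K : nmodType) (phi : S -> K) : Prop :=
  forall a, phi a = 0 -> a = 0.

Definition monotone (K : preorderedSemiRing) (phi : S -> K) : Prop :=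
  forall a b, (a <= b)%S -> (phi a <= phi b)%S.

Definition degenerate (K : Type) (phi : S -> K) : Prop :=
  forall a b, (a <= b)%S -> phi a = phi b.

Variable R : realType.

Definition spectral_target (K : preorderedSemiRing) : Prop :=
  [\/ K = Rplus R, K = opposite (Rplus R), K = TRplus R | K = opposite (TRplus R)].

Definition spectral_point (K : preorderedSemiRing)
    (phi : {rmorphism S -> K}) : Prop :=
  [/\ spectral_target K, monotone phi, ~ degenerate phi & trivial_kernel phi].

Definition derivation (phi : {rmorphism S -> nnreal R})
    (D : {additive S -> R}) : Prop :=
  forall a b, D (a * b) = (phi a)%:num * D b + D a * (phi b)%:num.

Section Conditions.
Variables (d : nat) (nrm : {rmorphism S -> posvec R d}) (u : S).
(* The class of derivations to be tested: all of them, or the linear ones. *)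
Variable P : {additive S -> R} -> Prop.

Definition test_derivation (i : 'I_d) (D : {additive S -> R}) : Prop :=
  [/\ P D, derivation (component i \o nrm) D,
      forall a b, (a <= b)%S -> D a <= D b & D u = 1].

Definition spectral_conditions x y : Prop :=
  (forall (K : preorderedSemiRing) (phi : {rmorphism S -> K}),
     spectral_point phi -> (phi x <= phi y)%S) /\
  (forall (i : 'I_d) (D : {additive S -> R}),
     test_derivation i D -> D x <= D y).

Definition strict_spectral_conditions x y : Prop :=
  (forall (K : preorderedSemiRing) (phi : {rmorphism S -> K}),
     spectral_point phi -> (phi x < phi y)%S) /\
  (forall (i : 'I_d) (D : {additive S -> R}),
     test_derivation i D -> D x < D y).

Definition asymptotic_le x y : Prop :=
  forall eps : R, 0 < eps ->
    \forall n \near \oo,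
      (x ^+ n <= u ^+ Num.truncn (eps * n%:R) * y ^+ n)%S.

Definition catalyst (k n : nat) x y : S :=
  u ^+ k * \sum_(j < n.+1) x ^+ j * y ^+ (n - j).

Definition comparison_claims x y : Prop :=
  (spectral_conditions x y <-> asymptotic_le x y) /\
  (strict_spectral_conditions x y ->
   [/\ exists k : nat,
         \forall n \near \oo, (u ^+ k * x ^+ n <= u ^+ k * y ^+ n)%S,
       power_universal y -> \forall n \near \oo, (x ^+ n <= y ^+ n)%S,
       exists2 a : S, a != 0 & (a * x <= a * y)%S &
       exists k : nat, \forall n \near \oo,
         catalyst k n x y != 0 /\
         (catalyst k n x y * x <= catalyst k n x y * y)%S]).
End Conditions.

Record semialgebra (scale : nnreal R -> S -> S) : Prop := {
  scale_0l : forall a, scale 0 a = 0 ;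
  scale_Dl : forall r s a, scale (r + s) a = scale r a + scale s a ;
  scale_0r : forall r, scale r 0 = 0 ;
  scale_Dr : forall r a b, scale r (a + b) = scale r a + scale r b ;
  scale_1 : forall a, scale 1 a = a ;
  scale_M : forall r s a b, scale r a * scale s b = scale (r * s) (a * b)
}.

Definition Rplus_linear (scale : nnreal R -> S -> S) (D : {additive S -> R}) :
    Prop :=
  forall r a, D (scale r a) = r%:num * D a.
End Notions.

(* Main.v *)
From HB Require Import structures.
Require Import Defs.
From mathcomp Require Import generic_quotient ring lra.
From mathcomp Require Import exp normedtype sequences.
Set Implicit Arguments.
Unset Strict Implicit.
Unset Printing Implicit Defensive.
Import Order.TTheory GRing.Theory Num.Theory.
Import numFieldNormedType.Exports.
Local Open Scope classical_set_scope.
Local Open Scope ring_scope.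

(** Write [N] for the map [nrm].  Up to a nonzero common factor, [<=] becomes the
    preorder [frac_le] of the semifield of fractions of [S].  It relates only
    elements of equal norm, so it amounts to a cone in the multiplicative group
    of fractions of norm one, in which [u] is an order unit.

    Separation.  The key point is that a preorder of this kind can be enlarged by
    any relation [x <= y] without making [u <= 1] true, unless [y <= x] holds
    already ([adjoin_proper]).  By Zorn's lemma there are extensions that are
    total on elements of equal norm ([total_extension]).  Since [u] is an order
    unit, such an extension is measured by real numbers: there is a [valuation]
    [lam] with [lam u = lam 1 + 1] whose differences [lam b - lam a], for
    [N a = N b], are multiplicative and compatible with addition.  If no
    [u * x ^+ n <= y ^+ n] holds up to a factor, then some such [lam] has
    [lam y <= lam x] ([separating_valuation]).

    Classification.  Each [lam] comes from a point of the spectrum, and the sign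
    of [lam (u ^+ 2 + 1) - lam (u + u)] tells from which kind.
    If it is positive, the larger summands dominate: the value of
    [b * w ^+ i + q * v ^+ i], where [w] exceeds [v], forgets [q] as [i] grows.
    The reason is that the loss against [(b + q) * w ^+ i] is concave in [i] and
    satisfies a doubling inequality, and these two properties bound it
    ([concave_bounded], [loss_bounded]).  In the limit [lam] extends to a
    logarithm on all nonzero elements that is monotone for the order with
    [0 <= 1] ([ambient_log]), and its exponential, suitably normalised, is a
    homomorphism to the real numbers or to the tropical ones ([ambient_hom]).
    If the sign is negative, the same applies to [- lam] and gives the opposite
    orders.
    If the difference vanishes, [lam] is affine: raising the part [q] of a sum
    [p + q] by one unit raises the value of the sum by a fixed weight.  The
    weights define a character of [R_{>0}^d], which is a coordinate
    ([residue_component]), and [lam] is the logarithmic derivative of a derivation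
    defined so far on differences of elements of equal norm only.  To define it
    everywhere, one splits a square-zero extension of the field of real numbers
    ([coefficient_field], [derivation_extension]); the splitting can be chosen to
    contain the scalars of a semialgebra, and then the derivation is linear.

    Conclusion.  Under the spectral conditions no valuation can separate, so
    inequalities between powers hold up to a nonzero factor.  As [N] is
    surjective, that factor has an inverse up to norm, hence up to a power of [u]
    that does not depend on the exponent ([frac_le_powers]); such a bounded power
    is negligible against powers of [u] that grow with the exponent. *)

(** * Norms and their coordinates *)

Section Norm.
Variables (R : realType) (S : comPzSemiRingType) (d : nat).
Variable nrm : {rmorphism S -> posvec R d}.
Hypothesis nrm_ker : forall a, nrm a = 0 -> a = 0.
Hypothesis nrm_surj : forall v : posvec R d, exists a : S, nrm a = v.
Implicit Types a b c e p q r : S.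

Definition coord (i : 'I_d) a : R := (component i (nrm a))%:num.

Lemma coord0 i : coord i 0 = 0.
Proof. by rewrite /coord !rmorph0. Qed.

Lemma coord1 i : coord i 1 = 1.
Proof. by rewrite /coord !rmorph1. Qed.

Lemma coordD i a b : coord i (a + b) = coord i a + coord i b.
Proof. by rewrite /coord !rmorphD. Qed.

Lemma coordM i a b : coord i (a * b) = coord i a * coord i b.
Proof. by rewrite /coord !rmorphM. Qed.

Lemma coord_nat i n : coord i n%:R = n%:R.
Proof. by elim: n => [|n IH]; rewrite ?coord0 // -!natr1 coordD IH coord1. Qed.

Lemma nrmP a : a != 0 -> exists g, nrm a = Some g.
Proof.
case E : (nrm a) => [g|]; first by exists g.
by move: (nrm_ker E) => ->; rewrite eqxx.
Qed.

Lemma nrm_neq0 a : (nrm a != 0) = (a != 0).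
Proof.
apply/idP/idP; apply: contra_neq; last exact: nrm_ker.
by move=> ->; exact: rmorph0.
Qed.

Lemma coord_gt0 i a : a != 0 -> 0 < coord i a.
Proof. by case/nrmP=> g ga; rewrite /coord ga /=. Qed.

Lemma coord_ge0 i a : 0 <= coord i a.
Proof. by rewrite /coord. Qed.

Lemma nrm_eqP a b : a != 0 -> b != 0 ->
  (forall i, coord i a = coord i b) -> nrm a = nrm b.
Proof.
move=> /nrmP[g ga] /nrmP[h hb] ab; rewrite ga hb; congr Some.
apply/ffunP => i; apply/val_inj.
by have := ab i; rewrite /coord ga hb.
Qed.

Lemma nrm_eq_coord i a b : nrm a = nrm b -> coord i a = coord i b.
Proof. by rewrite /coord => ->. Qed.

Lemma nrm_eq_neq0 a b : nrm a = nrm b -> a != 0 -> b != 0.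
Proof. by rewrite -!nrm_neq0 => ->. Qed.

Lemma semiring_oner_neq0 : (1 : S) != 0.
Proof. by rewrite -nrm_neq0 rmorph1. Qed.

Lemma addr_neq0l a b : a != 0 -> a + b != 0.
Proof.
by rewrite -!nrm_neq0 rmorphD; case: (nrm a) => [g|//]; case: (nrm b).
Qed.

Lemma addr_neq0r a b : b != 0 -> a + b != 0.
Proof. by rewrite addrC; exact: addr_neq0l. Qed.

Lemma mulr_neq0 a b : a != 0 -> b != 0 -> a * b != 0.
Proof.
rewrite -!nrm_neq0 rmorphM; case: (nrm a) => [g|//].
by case: (nrm b).
Qed.

Lemma expr_neq0 a n : a != 0 -> a ^+ n != 0.
Proof.
move=> a0; elim: n => [|n IH]; first exact: semiring_oner_neq0.
by rewrite exprS mulr_neq0.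
Qed.

Lemma natr_neq0 n : (n.+1%:R : S) != 0.
Proof. by rewrite -nat1r addr_neq0l// semiring_oner_neq0. Qed.

(** Both [a] and [b] have to be nonzero: for [d = 0] the norm takes values in the
    Boolean semifield, where [1 + 1 = 1 + 0]. *)
Lemma nrm_addI c a b : a != 0 -> b != 0 ->
  nrm (c + a) = nrm (c + b) -> nrm a = nrm b.
Proof.
move=> a0 b0 e; apply: nrm_eqP => // i.
by have := nrm_eq_coord i e; rewrite !coordD => /addrI.
Qed.

Lemma nrm_mulI c a b : c != 0 -> nrm (c * a) = nrm (c * b) -> nrm a = nrm b.
Proof.
move=> c0 e; have [a0|a0] := eqVneq a 0; have [b0|b0] := eqVneq b 0.
- by rewrite a0 b0.
- by move: e; rewrite a0 mulr0 rmorph0 => /esym/nrm_ker/eqP; rewrite (negPf (mulr_neq0 c0 b0)).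
- by move: e; rewrite b0 mulr0 rmorph0 => /nrm_ker/eqP; rewrite (negPf (mulr_neq0 c0 a0)).
- apply: nrm_eqP => // i.
  have := nrm_eq_coord i e; rewrite !coordM; apply: mulfI.
  by rewrite gt_eqF// coord_gt0.
Qed.

Lemma coord_surj (g : 'I_d -> R) : (forall i, 0 < g i) ->
  exists2 a, a != 0 & forall i, coord i a = g i.
Proof.
move=> g0; have [a ha] := nrm_surj (Some [ffun i => PosNum (g0 i)]).
exists a; first by rewrite -nrm_neq0 ha.
by move=> i; rewrite /coord ha /= ffunE.
Qed.

Lemma nrm_inverse a : a != 0 -> exists2 b, b != 0 & nrm (a * b) = nrm 1.
Proof.
move=> a0; have [|b b0 hb] := @coord_surj (fun i => (coord i a)^-1).
  by move=> i; rewrite invr_gt0 coord_gt0.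
exists b => //; apply: nrm_eqP; rewrite ?mulr_neq0 ?semiring_oner_neq0// => i.
by rewrite coordM hb coord1 mulfV// gt_eqF// coord_gt0.
Qed.

(** There are finitely many coordinates, so a large multiple of [p] exceeds [q]
    in all of them. *)
Lemma nrm_dominate p q : p != 0 -> q != 0 ->
  exists n0, forall n, (n0 <= n)%N ->
    exists2 r, r != 0 & nrm (n.+1%:R * p) = nrm (q + r).
Proof.
move=> p0 q0.
pose F i := (Num.truncn (coord i q / coord i p)).+1.
exists (\max_i F i)%N => n le_n.
have [|r r0 hr] := @coord_surj (fun i => n.+1%:R * coord i p - coord i q).
  move=> i; rewrite subr_gt0 -ltr_pdivrMr ?coord_gt0//.
  apply: lt_le_trans (truncnS_gt _) _; rewrite ler_nat.
  by apply: leqW; apply: leq_trans le_n; exact: (leq_bigmax i).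
exists r => //; apply: nrm_eqP; rewrite ?mulr_neq0 ?natr_neq0 ?addr_neq0l// => i.
by rewrite coordD coordM hr coord_nat; ring.
Qed.

(** Only the differences [lam b - lam a] with [nrm a = nrm b] carry information:
    they form a homomorphism to the real numbers from the group of fractions
    [b / a] of norm one.  Writing it with a potential [lam] makes it additive
    along chains by construction. *)
Record valuation (lam : S -> R) : Prop := Valuation {
  val_mul : forall c a b, c != 0 -> a != 0 -> nrm a = nrm b ->
    lam (c * b) - lam (c * a) = lam b - lam a;
  val_add : forall c a b, a != 0 -> nrm a = nrm b ->
    lam a <= lam b -> lam (c + a) <= lam (c + b)
}.

End Norm.

(** * Archimedean arguments *)

Section RealApproximation.
Variable R : archiRealFieldType.

Lemma archi_le0 (x C : R) : (forall n, n.+1%:R * x <= C) -> x <= 0.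
Proof.
move=> H; rewrite leNgt; apply/negP => x0.
have := lt_le_trans (truncnS_gt (C / x)) (lexx _).
by rewrite ltr_pdivrMr// ltNge H.
Qed.

Lemma archi_eq0 (x C : R) : (forall n : nat, `|n%:R * x| <= C) -> x = 0.
Proof.
move=> H; apply/le_anti/andP; split.
  by apply: (@archi_le0 _ C) => n; apply: le_trans (H _); exact: ler_norm.
rewrite -oppr_le0; apply: (@archi_le0 _ C) => n.
by rewrite mulrN; apply: le_trans (H n.+1); rewrite -normrN; exact: ler_norm.
Qed.

Lemma nat_diff_approx (r : R) :
  exists p q : nat, p%:R - q%:R < r /\ r <= p%:R - q%:R + 2%:R.
Proof.
pose q := (Num.truncn `|r|).+1.
have rq : 0 <= r + q%:R.
  have := truncnS_gt `|r|; rewrite -/q; have := ler_norm (- r).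
  by rewrite normrN; lra.
exists (Num.truncn (r + q%:R)), q.+1.
have := truncnS_gt (r + q%:R); have := truncn_le (r + q%:R); rewrite rq.
by rewrite -!natr1; split; lra.
Qed.

End RealApproximation.


(** * Valuations *)

Ltac nonzero_with ker :=
  first [ assumption
        | exact: (semiring_oner_neq0 ker)
        | exact: (natr_neq0 ker)
        | (apply: (mulr_neq0 ker); nonzero_with ker)
        | (apply: (expr_neq0 ker); nonzero_with ker)
        | (apply: (addr_neq0l ker); nonzero_with ker)
        | (apply: (addr_neq0r ker); nonzero_with ker) ].


Section Valuations.
Variables (R : realType) (S : comPzSemiRingType) (d : nat).
Variable nrm : {rmorphism S -> posvec R d}.
Hypothesis nrm_ker : forall a, nrm a = 0 -> a = 0.
Implicit Types (a b c p q r v w : S).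

Ltac nonzero := nonzero_with nrm_ker.
Let neq0 := nrm_eq_neq0 nrm_ker.

Lemma valuation_opp lam : valuation nrm lam -> valuation nrm (fun a => - lam a).
Proof.
move=> vl; split=> [c a b c0 a0 ab|c a b a0 ab].
  by have := val_mul vl c0 a0 ab; lra.
by rewrite !lerN2 => ba; apply: (val_add vl) => //; exact: neq0 a0.
Qed.

Section Theory.
Variable lam : S -> R.
Hypothesis vl : valuation nrm lam.

Lemma val_prod a b a' b' : a != 0 -> a' != 0 ->
  nrm a = nrm b -> nrm a' = nrm b' ->
  lam (b * b') - lam (a * a') = (lam b - lam a) + (lam b' - lam a').
Proof.
move=> a0 a'0 ab ab'; have b0 := neq0 ab a0.
have := val_mul vl b0 a'0 ab'; have := val_mul vl a'0 a0 ab.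
by rewrite ![a' * _]mulrC; lra.
Qed.

Lemma val_exp n a b : a != 0 -> nrm a = nrm b ->
  lam (b ^+ n) - lam (a ^+ n) = n%:R * (lam b - lam a).
Proof.
move=> a0 ab; elim: n => [|n IH]; first by rewrite !expr0 mul0r subrr.
have an0 : a ^+ n != 0 by nonzero.
rewrite -[n.+1%:R]natr1 mulrDl mul1r -IH !exprS (val_prod a0 an0)//; first by ring.
by rewrite !rmorphXn ab.
Qed.

(** A weighted mean of [1] and [a' / a] is monotone in [a' / a]: after clearing
    denominators this is compatibility with addition. *)
Lemma val_mix p q a a' b b' : q != 0 -> a != 0 -> b != 0 ->
  nrm a = nrm a' -> nrm b = nrm b' -> lam a' - lam a <= lam b' - lam b ->
  lam (p * a + q * a') - lam ((p + q) * a) <=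
  lam (p * b + q * b') - lam ((p + q) * b).
Proof.
move=> q0 a0 b0 aa' bb' H.
have a'0 := neq0 aa' a0; have b'0 := neq0 bb' b0.
have pq0 : p + q != 0 by nonzero.
have X0 : p * a + q * a' != 0 by nonzero.
have ab'0 : b * a' != 0 by nonzero.
have e : nrm (b * a') = nrm (a * b') by rewrite !rmorphM aa' bb' mulrC.
have le : lam (q * (b * a')) <= lam (q * (a * b')).
  rewrite -subr_ge0 (val_mul vl)//.
  have := val_mul vl b0 a0 aa'; have := val_mul vl a0 b0 bb'.
  by rewrite [a * b]mulrC; lra.
have Y0 : q * (b * a') != 0 by nonzero.
have := val_add vl (p * a * b) Y0 _ le.
rewrite !(rmorphM nrm q) e => /(_ erefl).
have -> : p * a * b + q * (b * a') = b * (p * a + q * a') by ring.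
have -> : p * a * b + q * (a * b') = a * (p * b + q * b') by ring.
have Z0 : (p + q) * a != 0 by nonzero.
have Z'0 : (p + q) * b != 0 by nonzero.
have eZ : nrm ((p + q) * a) = nrm (p * a + q * a').
  by rewrite !rmorphD !rmorphM rmorphD aa'; ring.
have eZ' : nrm ((p + q) * b) = nrm (p * b + q * b').
  by rewrite !rmorphD !rmorphM rmorphD bb'; ring.
have := val_mul vl b0 Z0 eZ; have := val_mul vl a0 Z'0 eZ'.
have -> : b * ((p + q) * a) = a * ((p + q) * b) by ring.
by lra.
Qed.

(** If [lam b < lam a], compare [(c + a) * b] with [(c + b) * a]: they share the
    summand [a * b], and [c * b] lies below [c * a]. *)
Lemma val_add_lb t c a b : a != 0 -> nrm a = nrm b -> 0 <= t ->
  lam a <= lam b + t -> lam (c + a) <= lam (c + b) + t.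
Proof.
move=> a0 ab t0 H; have b0 := neq0 ab a0.
have [le|/ltW le] := leP (lam a) (lam b).
  by have := val_add vl c a0 ab le; lra.
have [->|c0] := eqVneq c 0; first by rewrite !add0r.
have cb0 : c * b != 0 by nonzero.
have := val_add vl (a * b) cb0 (_ : nrm (c * b) = nrm (c * a)).
rewrite !rmorphM ab => /(_ erefl).
have := val_mul vl c0 a0 ab => E1 /(_ _) E2.
have {}E2 : lam (a * b + c * b) <= lam (a * b + c * a) by apply: E2; lra.
have ca0 : c + a != 0 by nonzero.
have e : nrm (c + a) = nrm (c + b) by rewrite !rmorphD ab.
have := val_prod b0 ca0 (esym ab) e.
have -> : b * (c + a) = a * b + c * b by ring.
have -> : a * (c + b) = a * b + c * a by ring.
by lra.
Qed.

(** What the sum [p * w ^+ i + q * w ^+ i] loses when [w] is replaced by [v] in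
    its second term. *)
Definition mix_loss p q v w i := lam ((p + q) * w ^+ i) - lam (p * w ^+ i + q * v ^+ i).

Lemma loss0 p q v w : mix_loss p q v w 0 = 0.
Proof. by rewrite /mix_loss !expr0 !mulr1 subrr. Qed.

Section Loss.
Variables (p q v w : S).
Hypotheses (p0 : p != 0) (q0 : q != 0) (v0 : v != 0) (vw : nrm v = nrm w).
Let w0 : w != 0 := neq0 vw v0.

Let nrm_mix i : nrm ((p + q) * w ^+ i) = nrm (p * w ^+ i + q * v ^+ i).
Proof. by rewrite !rmorphD !rmorphM rmorphD !rmorphXn vw; ring. Qed.

(** The square of a term and the product of its two neighbours agree up to the
    mixed part, in which [v * w + v * w] is replaced by [v ^+ 2 + w ^+ 2]. *)
Lemma loss_concave : lam (v * w + v * w) <= lam (v ^+ 2 + w ^+ 2) -> forall i,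
  mix_loss p q v w i + mix_loss p q v w i.+2 <= 2%:R * mix_loss p q v w i.+1.
Proof.
move=> eta i; rewrite /mix_loss.
have Z j : (p + q) * w ^+ j != 0 by nonzero.
have E1 := val_prod (Z i) (Z i.+2) (nrm_mix i) (nrm_mix i.+2).
have E2 := val_prod (Z i.+1) (Z i.+1) (nrm_mix i.+1) (nrm_mix i.+1).
have e : (p + q) * w ^+ i * ((p + q) * w ^+ i.+2) =
  (p + q) * w ^+ i.+1 * ((p + q) * w ^+ i.+1) by rewrite !exprS; ring.
rewrite e in E1.
have vw0 : v * w + v * w != 0 by nonzero.
have k0 : p * q * v ^+ i * w ^+ i != 0 by nonzero.
have en : nrm (v * w + v * w) = nrm (v ^+ 2 + w ^+ 2).
  by rewrite !rmorphD !expr2 !rmorphM vw; ring.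
have := val_mul vl k0 vw0 en.
set L := _ * (v * w + _); set L' := _ * (_ ^+ 2 + _) => EL.
have LL' : lam L <= lam L' by lra.
have L0 : L != 0 by rewrite /L; nonzero.
have nL : nrm L = nrm L' by rewrite /L /L' ![nrm (_ * (_ + _))]rmorphM en.
have := val_add vl (p * p * w ^+ i.+1 * w ^+ i.+1 + q * q * v ^+ i.+1 * v ^+ i.+1) L0 nL LL'.
rewrite /L /L'.
set X := (X in lam X <= _); set Y := (X in _ <= lam X) => XY.
have eX : X = (p * w ^+ i.+1 + q * v ^+ i.+1) * (p * w ^+ i.+1 + q * v ^+ i.+1).
  by rewrite /X !exprS; ring.
have eY : Y = (p * w ^+ i + q * v ^+ i) * (p * w ^+ i.+2 + q * v ^+ i.+2).
  by rewrite /Y !exprS; ring.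
by rewrite eX eY in XY; lra.
Qed.

Lemma loss_nondec : lam v <= lam w -> forall i,
  mix_loss p q v w i <= mix_loss p q v w i.+1.
Proof.
move=> le i; rewrite /mix_loss.
have Z j : (p + q) * w ^+ j != 0 by nonzero.
have := val_mul vl w0 (Z i) (nrm_mix i).
have -> : w * ((p + q) * w ^+ i) = (p + q) * w ^+ i.+1 by rewrite exprS; ring.
have qv0 : q * v ^+ i != 0 by nonzero.
have := val_mul vl qv0 v0 vw => E.
have H : lam (q * v ^+ i * v) <= lam (q * v ^+ i * w) by lra.
have qvv0 : q * v ^+ i * v != 0 by nonzero.
have := val_add vl (p * w ^+ i.+1) qvv0 _ H.
rewrite !(rmorphM nrm (q * _)) vw => /(_ erefl).
have -> : p * w ^+ i.+1 + q * v ^+ i * v = p * w ^+ i.+1 + q * v ^+ i.+1.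
  by rewrite !exprS; ring.
have -> : p * w ^+ i.+1 + q * v ^+ i * w = w * (p * w ^+ i + q * v ^+ i).
  by rewrite !exprS; ring.
by lra.
Qed.

End Loss.
End Theory.
End Valuations.

(** * Total extensions and separating valuations *)

Section FractionPreorders.
Variables (R : realType) (S : preorderedSemiRing) (d : nat).
Variable nrm : {rmorphism S -> posvec R d}.
Hypothesis nrm_ker : forall a, nrm a = 0 -> a = 0.
Implicit Types (a b c e x y : S) (Q : S -> S -> Prop).

Ltac nonzero := nonzero_with nrm_ker.

(** The restrictions to [S] of the preorders on its semifield of fractions that
    relate only fractions of equal norm. *)
Record frac_preorder Q : Prop := FracPreorder {
  fp_refl : forall a, Q a a;
  fp_trans : forall b a c, Q a b -> Q b c -> Q a c;
  fp_add : forall c a b, Q a b -> Q (c + a) (c + b);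
  fp_mul : forall c a b, Q a b -> Q (c * a) (c * b);
  fp_cancel : forall c a b, c != 0 -> Q (c * a) (c * b) -> Q a b;
  fp_nrm : forall a b, Q a b -> nrm a = nrm b
}.

Section Basics.
Variable Q : S -> S -> Prop.
Hypothesis fpQ : frac_preorder Q.

Lemma fp_add2 a b c e : Q a b -> Q c e -> Q (a + c) (b + e).
Proof.
move=> ab ce; apply: (fp_trans fpQ (b := a + e)); first exact: fp_add.
by rewrite ![_ + e]addrC; exact: fp_add.
Qed.

Lemma fp_mul2 a b c e : Q a b -> Q c e -> Q (a * c) (b * e).
Proof.
move=> ab ce; apply: (fp_trans fpQ (b := a * e)); first exact: fp_mul.
by rewrite ![_ * e]mulrC; exact: fp_mul.
Qed.

Lemma fp_exp n a b : Q a b -> Q (a ^+ n) (b ^+ n).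
Proof.
move=> ab; elim: n => [|n IH]; first exact: fp_refl.
by rewrite !exprS; exact: fp_mul2.
Qed.

Lemma fp_mulrn n a b : Q a b -> Q (a *+ n) (b *+ n).
Proof.
move=> ab; elim: n => [|n IH]; first exact: fp_refl.
by rewrite !mulrS; exact: fp_add2.
Qed.

Lemma fp_sum n (F G : 'I_n -> S) :
  (forall i, Q (F i) (G i)) -> Q (\sum_(i < n) F i) (\sum_(i < n) G i).
Proof.
move=> FG; elim: n F G FG => [|n IH] F G FG.
  by rewrite !big_ord0; exact: fp_refl.
by rewrite !big_ord_recl; apply: fp_add2 => //; exact: IH.
Qed.

End Basics.

Definition frac_le a b := exists2 c, c != 0 & (c * a <= c * b)%S.

Hypothesis le_nrm : forall a b : S, (a <= b)%S -> nrm a = nrm b.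

Lemma sle_refl a : (a <= a)%S.
Proof. by have [rf _] := sle_preorder S; exact: rf. Qed.

Lemma sle_trans b a c : (a <= b)%S -> (b <= c)%S -> (a <= c)%S.
Proof. by have [_ tr] := sle_preorder S; exact: tr. Qed.

Lemma sle_frac a b : (a <= b)%S -> frac_le a b.
Proof. by move=> ab; exists 1; rewrite ?mul1r//; nonzero. Qed.

Lemma frac_le_preorder : frac_preorder frac_le.
Proof.
split.
- by move=> a; apply: sle_frac; exact: sle_refl.
- move=> b a c [k k0 kab] [l l0 lbc]; exists (k * l); first by nonzero.
  apply: (@sle_trans (k * l * b)).
    by rewrite ![k * l]mulrC -!mulrA; exact: sle_mul.
  by rewrite -!mulrA; exact: sle_mul.
- by move=> c a b [k k0 kab]; exists k => //; rewrite !mulrDr; exact: sle_add.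
- move=> c a b [k k0 kab]; exists k => //.
  by rewrite !mulrA ![k * c]mulrC -!mulrA; exact: sle_mul.
- move=> c a b c0 [k k0 kab]; exists (k * c); first by nonzero.
  by rewrite -!mulrA.
- by move=> a b [k k0 /le_nrm]; exact: (nrm_mulI nrm_ker).
Qed.

(** The preorder generated by [Q] and [x <= y]: with a common denominator [c], a
    chain of comparisons from [a] to [b] telescopes to a single one.  Equality of
    norms is required because for [d = 0] norms cannot be cancelled in sums. *)
Definition adjoin Q x y a b :=
  nrm a = nrm b /\ exists c e, c != 0 /\ Q (c * a + e * y) (c * b + e * x).

Section Adjoin.
Variables (Q : S -> S -> Prop) (x y : S).
Hypothesis fpQ : frac_preorder Q.

Lemma adjoin_sub a b : Q a b -> adjoin Q x y a b.
Proof.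
move=> Qab; split; first exact: (fp_nrm fpQ).
by exists 1, 0; rewrite !mul1r !mul0r !addr0; split => //; nonzero.
Qed.

Lemma adjoin_self : nrm x = nrm y -> adjoin Q x y x y.
Proof.
move=> xy; split=> //; exists 1, 1; split; first by nonzero.
by rewrite !mul1r addrC; exact: (fp_refl fpQ).
Qed.

Lemma adjoin_preorder : frac_preorder (adjoin Q x y).
Proof.
split.
- by move=> a; apply: adjoin_sub; exact: (fp_refl fpQ).
- move=> b a c [ab [k [e [k0 H]]]] [bc [l [f [l0 G]]]].
  split; first by rewrite ab.
  exists (k * l), (l * e + k * f); split; first by nonzero.
  apply: (fp_trans fpQ (b := k * l * b + l * e * x + k * f * y)).
    have := fp_add fpQ (k * f * y) (fp_mul fpQ l H).
    by congr Q; ring.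
  have := fp_add fpQ (l * e * x) (fp_mul fpQ k G).
  by congr Q; ring.
- move=> c a b [ab [k [e [k0 H]]]]; split; first by rewrite !rmorphD ab.
  exists k, e; split => //.
  by have := fp_add fpQ (k * c) H; congr Q; ring.
- move=> c a b [ab [k [e [k0 H]]]]; split; first by rewrite !rmorphM ab.
  exists k, (c * e); split => //.
  by have := fp_mul fpQ c H; congr Q; ring.
- move=> c a b c0 [ab [k [e [k0 H]]]].
  split; first exact: (nrm_mulI nrm_ker c0).
  by exists (k * c), e; split; [nonzero | rewrite -!mulrA].
- by move=> a b [].
Qed.

End Adjoin.

Variable u : S.
Hypothesis uP : power_universal u.
Hypothesis nrm_connected : forall a b : S, nrm a = nrm b -> order_connected a b.

Lemma u_neq0 : u != 0. Proof. by case: uP. Qed.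
Lemma nrm_u : nrm u = nrm 1. Proof. by case: uP => _ /le_nrm. Qed.

Let u0 := u_neq0.

Lemma nrm_growth a b : a != 0 -> nrm a = nrm b ->
  exists k, (a <= u ^+ k * b)%S.
Proof.
move=> a0 ab; have := nrm_connected ab.
suff H : order_connected a b -> a != 0 ->
  (exists k, (a <= u ^+ k * b)%S) /\ (exists k, (b <= u ^+ k * a)%S).
  by move=> /H[].
elim=> {b ab a0} [{}a b ab a0|{}a _|{}a b ab IH b0|{}a b c ab IH1 bc IH2 a0].
- have b0 : b != 0 := nrm_eq_neq0 nrm_ker (le_nrm ab) a0.
  split; first by exists 0%N; rewrite mul1r.
  by have [_ _ /(_ a b a0 b0 ab)[k]] := uP; exists k; rewrite mulrC.
- by split; exists 0%N; rewrite mul1r; exact: sle_refl.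
- have a0 : a != 0.
    apply: (nrm_eq_neq0 nrm_ker) b0.
    by elim: ab {IH} => // [p q /le_nrm//|p q r _ -> _ ->].
  by have [] := IH a0.
- have [[k hk] [k' hk']] := IH1 a0.
  have b0 : b != 0.
    apply: (nrm_eq_neq0 nrm_ker) a0.
    by rewrite (le_nrm hk) rmorphM rmorphXn nrm_u rmorph1 expr1n mul1r.
  have [[l hl] [l' hl']] := IH2 b0.
  split.
    exists (k + l)%N; apply: (sle_trans hk).
    by rewrite exprD -mulrA; exact: sle_mul.
  exists (l' + k')%N; apply: (sle_trans hl').
  by rewrite exprD -mulrA; exact: sle_mul.
Qed.

Section Proper.
Variable Q : S -> S -> Prop.
Hypothesis fpQ : frac_preorder Q.
Hypothesis leQ : forall a b, (a <= b)%S -> Q a b.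

Lemma fp_exp_u m n : (m <= n)%N -> Q (u ^+ m) (u ^+ n).
Proof.
move=> mn; rewrite -(subnK mn) exprD -[X in Q X _]mul1r.
apply: fp_mul2 => //; last exact: fp_refl.
by rewrite -(expr1n _ (n - m)); apply: fp_exp => //; apply: leQ; case: uP.
Qed.

(** If adjoining [x <= y] makes the order unit [u] collapse, then it makes
    every power of [u] collapse.  Some power [u ^+ k] with [y <= u ^+ k * x]
    may then be traded for [y] in the collapsing inequality, and cancelling
    what remains gives [y <= x].  So one may always adjoin [x <= y] unless
    [y <= x] holds already. *)
Lemma adjoin_proper x y :
  x != 0 -> nrm x = nrm y -> ~ Q y x -> ~ adjoin Q x y u 1.
Proof.
move=> x0 xy nyx Hu; apply: nyx.
have y0 := nrm_eq_neq0 nrm_ker xy x0.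
have [k hk] := nrm_growth y0 (esym xy).
have fpA := adjoin_preorder x y fpQ.
have [_ [c [e [c0 H]]]] : adjoin Q x y (u ^+ k) 1.
  by rewrite -(expr1n _ k); exact: fp_exp.
apply: (fp_cancel fpQ (c := c + e * x)); first by nonzero.
apply: (fp_trans fpQ (b := c * (u ^+ k * x) + e * x * y)).
  rewrite mulrDl; apply: fp_add2 => //; last exact: fp_refl.
  by apply: fp_mul => //; exact: leQ.
by have := fp_mul fpQ x H; congr Q; ring.
Qed.

End Proper.

(** In a maximal proper preorder, [a <= b] or [b <= a] holds since otherwise
    [a <= b] could be adjoined. *)
Lemma total_extension Q : frac_preorder Q ->
  (forall a b, (a <= b)%S -> Q a b) -> ~ Q u 1 ->
  exists T, [/\ frac_preorder T, forall a b, Q a b -> T a b, ~ T u 1 &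
    forall a b, a != 0 -> nrm a = nrm b -> T a b \/ T b a].
Proof.
move=> fpQ leQ Qu1.
pose rel (A : set (S * S)) a b := A (a, b) \/ Q a b.
pose good A := frac_preorder (rel A) /\ ~ rel A u 1.
have [|A [[fpA Au1] maxA]] := @Zorn_bigcup _ (good : set (set (S * S))).
  move=> F Fgood Ftot.
  have two a b c e : rel (\bigcup_(X in F) X) a b ->
      rel (\bigcup_(X in F) X) c e ->
      (exists X, [/\ F X, rel X a b & rel X c e]) \/ (Q a b /\ Q c e).
    case=> [[X FX Xab]|Qab] [[Y FY Yce]|Qce]; last by right.
    - left; have [XY|YX] := Ftot X Y FX FY.
        by exists Y; split => //; left => //; exact: XY.
      by exists X; split => //; left => //; exact: YX.
    - by left; exists X; split => //; [left | right].
    - by left; exists Y; split => //; [right | left].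
  have up X a b : F X -> rel X a b -> rel (\bigcup_(X in F) X) a b.
    by move=> FX [Xab|]; [left; exists X | right].
  have one a b : rel (\bigcup_(X in F) X) a b ->
      (exists2 X, F X & rel X a b) \/ Q a b.
    by case=> [[X FX Xab]|Qab]; [left; exists X => //; left | right].
  split; last first.
    by case/one => [[X FX Xu]|//]; have [_] := Fgood X FX.
  split.
  - by move=> a; right; exact: fp_refl.
  - move=> b a c ab bc; have [[X [FX Xab Xbc]]|[Qab Qbc]] := two _ _ _ _ ab bc.
      by apply: (up X) => //; apply: (fp_trans (Fgood X FX).1) Xbc.
    by right; exact: (fp_trans fpQ) Qbc.
  - move=> c a b /one[[X FX Xab]|Qab]; last by right; exact: fp_add.
    by apply: (up X) => //; apply: fp_add => //; exact: (Fgood X FX).1.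
  - move=> c a b /one[[X FX Xab]|Qab]; last by right; exact: fp_mul.
    by apply: (up X) => //; apply: fp_mul => //; exact: (Fgood X FX).1.
  - move=> c a b c0 /one[[X FX Xab]|Qab]; last by right; exact: fp_cancel Qab.
    by apply: (up X) => //; apply: fp_cancel Xab => //; exact: (Fgood X FX).1.
  - move=> a b /one[[X FX Xab]|Qab]; last exact: (fp_nrm fpQ).
    exact: (fp_nrm (Fgood X FX).1).
exists (rel A); split => //; first by move=> a b; right.
move=> a b a0 ab; have [Aba|nAba] := pselect (rel A b a); first by right.
left; have leA p q : (p <= q)%S -> rel A p q by move=> /leQ; right.
pose B : set (S * S) := [set z | adjoin (rel A) a b z.1 z.2].
have relB p q : rel B p q <-> adjoin (rel A) a b p q.
  split=> [[//|Qpq]|]; last by left.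
  by apply: adjoin_sub => //; right.
have [AB|nAB] := pselect (A `<` B); last first.
  have sAB : A `<=` B by move=> [p q] Apq; apply: adjoin_sub => //; left.
  apply: contrapT => nAab; apply: nAB; split => // /(_ (a, b)) H.
  by apply: nAab; left; apply: H; exact: adjoin_self.
exfalso; apply: (maxA B AB); split.
  have fpB := adjoin_preorder a b fpA.
  split.
  - by move=> p; apply/relB; exact: (fp_refl fpB).
  - by move=> q p r /relB pq /relB qr; apply/relB; exact: (fp_trans fpB) qr.
  - by move=> c p q /relB pq; apply/relB; exact: fp_add.
  - by move=> c p q /relB pq; apply/relB; exact: fp_mul.
  - by move=> c p q c0 /relB pq; apply/relB; exact: (fp_cancel fpB) pq.
  - by move=> p q /relB pq; exact: (fp_nrm fpB).
by move/relB; exact: adjoin_proper.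
Qed.

Section TotalPreorder.
Variable Q : S -> S -> Prop.
Hypothesis fpQ : frac_preorder Q.
Hypothesis leQ : forall a b, (a <= b)%S -> Q a b.
Hypothesis Qu1 : ~ Q u 1.
Hypothesis totQ : forall a b, a != 0 -> nrm a = nrm b -> Q a b \/ Q b a.

Lemma fp_exp_u_le m n c : c != 0 -> Q (u ^+ m * c) (u ^+ n * c) -> (m <= n)%N.
Proof.
move=> c0; rewrite ![_ * c]mulrC => /(fp_cancel fpQ c0) umn.
rewrite leqNgt; apply/negP => nm; apply: Qu1.
apply: (fp_cancel fpQ (c := u ^+ n)); first by nonzero.
rewrite mulr1; apply: (fp_trans fpQ (b := u ^+ m)) => //.
by rewrite -exprSr; exact: fp_exp_u.
Qed.

(** The lower cut of the real number [t] for which [b / a] is as large as the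
    [t]-th power of [u]. *)
Definition slopes a b : set R :=
  [set x : R | exists p q n : nat, x = (p%:R - q%:R) / n.+1%:R /\
                         Q (u ^+ p * a ^+ n.+1) (u ^+ q * b ^+ n.+1)].

Definition log_ratio a b : R := sup (slopes a b).

Lemma slopes_ubound a b : a != 0 -> nrm a = nrm b -> has_ubound (slopes a b).
Proof.
move=> a0 ab; have b0 := nrm_eq_neq0 nrm_ker ab a0.
have [k hk] := nrm_growth b0 (esym ab).
exists k%:R => _ [p [q [n [-> H]]]].
rewrite ler_pdivrMr ?ltr0n// lerBlDr -natrM -natrD ler_nat addnC.
apply: (@fp_exp_u_le _ _ (a ^+ n.+1)); first by nonzero.
apply: (fp_trans fpQ) H _; rewrite exprD -mulrA exprM -exprMn.
by apply: fp_mul => //; apply: fp_exp => //; exact: leQ.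
Qed.

Lemma slopes_neq0 a b : a != 0 -> nrm a = nrm b -> slopes a b !=set0.
Proof.
move=> a0 ab; have [k hk] := nrm_growth a0 ab.
exists ((0%:R - k%:R) / 1%:R); exists 0%N, k, 0%N; split=> //.
by rewrite !expr1 expr0 mul1r; exact: leQ.
Qed.

Lemma le_log_ratio a b p q n : a != 0 -> nrm a = nrm b ->
  Q (u ^+ p * a ^+ n.+1) (u ^+ q * b ^+ n.+1) ->
  p%:R - q%:R <= n.+1%:R * log_ratio a b.
Proof.
move=> a0 ab H; rewrite -ler_pdivrMl ?ltr0n// mulrC.
by apply: ub_le_sup; [exact: slopes_ubound | exists p, q, n].
Qed.

Let totQ_exp p q n a b : a != 0 -> nrm a = nrm b ->
  Q (u ^+ p * a ^+ n) (u ^+ q * b ^+ n) \/ Q (u ^+ q * b ^+ n) (u ^+ p * a ^+ n).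
Proof.
move=> a0 ab; apply: totQ; first by nonzero.
by rewrite !rmorphM !rmorphXn nrm_u rmorph1 !expr1n ab.
Qed.

Lemma lt_log_ratio a b p q n : a != 0 -> nrm a = nrm b ->
  p%:R - q%:R < n.+1%:R * log_ratio a b ->
  Q (u ^+ p * a ^+ n.+1) (u ^+ q * b ^+ n.+1).
Proof.
move=> a0 ab; rewrite -ltr_pdivrMl ?ltr0n// => pqf.
have := sup_gt (slopes_neq0 a0 ab) pqf.
case=> _ [p' [q' [n' [-> H']]]]; rewrite mulrC ltr_pdivlMr ?ltr0n//.
rewrite mulrAC ltr_pdivrMr ?ltr0n// => lt.
have [//|H] := totQ_exp p q n.+1 a0 ab; exfalso; move: lt.
apply/negP; rewrite -leNgt !mulrBl !lerBrDr addrAC.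
rewrite lerBlDr -!natrM -!natrD ler_nat.
have a0' : a ^+ (n.+1 * n'.+1) != 0 by nonzero.
apply: (fp_exp_u_le a0').
have G' := fp_mul fpQ (u ^+ (q * n'.+1)) (fp_exp fpQ n.+1 H').
have G := fp_mul fpQ (u ^+ (q' * n.+1)) (fp_exp fpQ n'.+1 H).
have E : u ^+ (q * n'.+1) * (u ^+ q' * b ^+ n'.+1) ^+ n.+1 =
         u ^+ (q' * n.+1) * (u ^+ q * b ^+ n.+1) ^+ n'.+1.
  by rewrite !exprMn -!exprM [(n'.+1 * n.+1)%N]mulnC; ring.
rewrite E in G'; have := fp_trans fpQ G' G; congr Q.
- by rewrite !exprMn -!exprM exprD [(n'.+1 * n.+1)%N]mulnC; ring.
- by rewrite !exprMn -!exprM exprD; ring.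
Qed.

Lemma log_ratio_superadd a b c : a != 0 -> nrm a = nrm b -> nrm b = nrm c ->
  log_ratio a b + log_ratio b c <= log_ratio a c.
Proof.
move=> a0 ab bc; have b0 := nrm_eq_neq0 nrm_ker ab a0.
(* Each of the two approximations below has a rounding error of at most 2. *)
rewrite -subr_le0; apply: (@archi_le0 _ _ 4%:R) => n.
have [p [q [H1 G1]]] := nat_diff_approx (n.+1%:R * log_ratio a b).
have [p' [q' [H2 G2]]] := nat_diff_approx (n.+1%:R * log_ratio b c).
have K1 := fp_mul fpQ (u ^+ p') (lt_log_ratio a0 ab H1).
have K2 := fp_mul fpQ (u ^+ q) (lt_log_ratio b0 bc H2).
have := @le_log_ratio a c (p' + p) (q + q') n a0 (etrans ab bc) _.
suff /[swap]/[apply] : Q (u ^+ (p' + p) * a ^+ n.+1) (u ^+ (q + q') * c ^+ n.+1).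
  by rewrite !natrD; lra.
rewrite !exprD -!mulrA; apply: (fp_trans fpQ) K1 _.
by rewrite mulrCA.
Qed.

Lemma log_ratio_refl a : a != 0 -> log_ratio a a = 0.
Proof.
move=> a0; apply/le_anti/andP; split; last first.
  have := @le_log_ratio a a 0 0 0 a0 erefl (fp_refl fpQ _).
  by rewrite subrr mul1r.
rewrite leNgt; apply/negP => f0.
pose n := Num.truncn (log_ratio a a)^-1.
have := @lt_log_ratio a a 1 0 n a0 erefl.
rewrite subr0 -ltr_pdivrMr// div1r truncnS_gt => /(_ isT).
have an0 : a ^+ n.+1 != 0 by nonzero.
by move/(fp_exp_u_le an0).
Qed.

Lemma log_ratio_anti a b : a != 0 -> nrm a = nrm b ->
  log_ratio b a = - log_ratio a b.
Proof.
move=> a0 ab; have b0 := nrm_eq_neq0 nrm_ker ab a0.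
apply/le_anti/andP; split.
  by have := log_ratio_superadd a0 ab (esym ab); rewrite log_ratio_refl//; lra.
rewrite -subr_le0; apply: (@archi_le0 _ _ 4%:R) => n.
have [p [q [H1 G1]]] := nat_diff_approx (n.+1%:R * log_ratio b a).
have H : n.+1%:R * log_ratio b a < (p + 3)%:R - q%:R by rewrite natrD; lra.
have nQ : ~ Q (u ^+ (p + 3) * b ^+ n.+1) (u ^+ q * a ^+ n.+1).
  by move=> /(le_log_ratio b0 (esym ab)); lra.
have [//|H'] := totQ_exp (p + 3) q n.+1 b0 (esym ab).
have := le_log_ratio a0 ab H'; rewrite natrD; lra.
Qed.

Lemma log_ratio_trans a b c : a != 0 -> nrm a = nrm b -> nrm b = nrm c ->
  log_ratio a c = log_ratio a b + log_ratio b c.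
Proof.
move=> a0 ab bc; have b0 := nrm_eq_neq0 nrm_ker ab a0.
have := log_ratio_superadd a0 ab bc.
have := log_ratio_superadd a0 (etrans ab bc) (esym bc).
by rewrite (@log_ratio_anti b c)//; lra.
Qed.

Lemma log_ratio_mul c a b : c != 0 -> log_ratio (c * a) (c * b) = log_ratio a b.
Proof.
move=> c0; congr sup; apply/seteqP.
split=> x [p [q [n [-> H]]]]; exists p, q, n; split => //.
  apply: (fp_cancel fpQ (c := c ^+ n.+1)); first by nonzero.
  by move: H; rewrite !exprMn; congr Q; ring.
have := fp_mul fpQ (c ^+ n.+1) H.
by rewrite !exprMn; congr Q; ring.
Qed.

(** If [b / a] has nonnegative logarithm, then [a ^+ j <= u * b ^+ j] for all [j].
    The binomial theorem gives [(c + a) ^+ n <= u * (c + b) ^+ n] for all [n],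
    and the single factor [u] is negligible for large [n]. *)
Lemma log_ratio_add c a b : a != 0 -> nrm a = nrm b ->
  0 <= log_ratio a b -> 0 <= log_ratio (c + a) (c + b).
Proof.
move=> a0 ab f0.
have aub j : Q (a ^+ j) (u * b ^+ j).
  case: j => [|j]; first by rewrite mulr1; apply: leQ; case: uP.
  have := @lt_log_ratio a b 0 1 j a0 ab; rewrite expr0 mul1r expr1; apply.
  rewrite sub0r (lt_le_trans (y := 0)) ?oppr_lt0//.
  by rewrite mulr_ge0.
rewrite -oppr_le0; apply: (@archi_le0 _ _ 1) => n.
rewrite mulrN lerNl; have := @le_log_ratio (c + a) (c + b) 0 1 n.
rewrite sub0r; apply; first by nonzero.
  by rewrite !rmorphD ab.
rewrite expr0 mul1r expr1 !exprDn mulr_sumr; apply: fp_sum => // i.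
rewrite mulrnAr; apply: fp_mulrn => //.
by have := fp_mul fpQ (c ^+ (n.+1 - i)) (aub i); congr Q; ring.
Qed.

Hypothesis nrm_surj : forall v : posvec R d, exists a : S, nrm a = v.

Lemma total_valuation : exists lam : S -> R,
  [/\ valuation nrm lam, lam u = lam 1 + 1,
      forall a b, a != 0 -> Q a b -> lam a <= lam b &
      forall a b, a != 0 -> nrm a = nrm b -> lam a < lam b -> Q a b].
Proof.
pose s v := projT1 (cid (nrm_surj v)).
have sP v : nrm (s v) = v by exact: (projT2 (cid (nrm_surj v))).
pose lam a := log_ratio (s (nrm a)) a.
have lamB a b : a != 0 -> nrm a = nrm b -> lam b = lam a + log_ratio a b.
  move=> a0 ab; rewrite /lam -ab; apply: log_ratio_trans => //.
  by apply: (nrm_eq_neq0 nrm_ker) a0; rewrite sP.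
have lr_ge0 a b : a != 0 -> Q a b -> 0 <= log_ratio a b.
  move=> a0 Qab; have := @le_log_ratio a b 0 0 0 a0 (fp_nrm fpQ Qab).
  by rewrite !expr0 !mul1r !expr1 subrr; apply.
exists lam; split.
- split.
  + move=> c a b c0 a0 ab; rewrite (lamB a b)// (lamB (c * a) (c * b)).
    * by rewrite log_ratio_mul//; ring.
    * by nonzero.
    * by rewrite !rmorphM ab.
  + move=> c a b a0 ab; rewrite (lamB a b)// (lamB (c + a) (c + b)).
    * by rewrite !lerDl; exact: log_ratio_add.
    * by nonzero.
    * by rewrite !rmorphD ab.
- have n1 : (1 : S) != 0 by nonzero.
  rewrite (lamB 1 u) ?nrm_u//; congr (_ + _); apply/le_anti/andP; split.
    rewrite leNgt; apply/negP => f1.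
    pose n := Num.truncn (log_ratio 1 u - 1)^-1.
    have := @lt_log_ratio 1 u n.+2 0 n n1 (esym nrm_u).
    have nf : 1 < n.+1%:R * (log_ratio 1 u - 1).
      by rewrite -ltr_pdivrMr ?subr_gt0// div1r truncnS_gt.
    rewrite subr0 -natr1 => H; have {}H : Q (u ^+ n.+2 * 1 ^+ n.+1) (u ^+ 0 * u ^+ n.+1).
      by apply: H; move: nf; lra.
    suff /(fp_exp_u_le n1) : Q (u ^+ n.+2 * 1) (u ^+ n.+1 * 1) by rewrite ltnn.
    by move: H; rewrite expr1n expr0 mul1r !mulr1.
  have := @le_log_ratio 1 u 1 0 0 n1 (esym nrm_u).
  by rewrite subr0 !mul1r; apply; rewrite !expr1 mulr1; exact: fp_refl.
- by move=> a b a0 Qab; rewrite (lamB a b) ?lerDl ?lr_ge0//; exact: (fp_nrm fpQ).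
- move=> a b a0 ab; rewrite (lamB a b)// ltrDl => f0.
  have := @lt_log_ratio a b 0 0 0 a0 ab.
  by rewrite !expr0 !mul1r !expr1 subrr; apply.
Qed.

End TotalPreorder.

Hypothesis nrm_surj : forall v : posvec R d, exists a : S, nrm a = v.

Lemma shifted_exp lam k x y : valuation nrm lam -> lam u = lam 1 + 1 ->
  x != 0 -> nrm x = nrm y ->
  lam (u * x ^+ k) - lam (y ^+ k) = 1 + k%:R * (lam x - lam y).
Proof.
move=> vl lu x0 xy; have y0 := nrm_eq_neq0 nrm_ker xy x0.
have xk0 : x ^+ k != 0 by nonzero.
have n1 : (1 : S) != 0 by nonzero.
rewrite -(val_exp nrm_ker vl _ y0 (esym xy)).
by have := val_mul vl xk0 n1 (esym nrm_u); rewrite mulr1 mulrC lu; lra.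
Qed.

(** For each [n] there is a total preorder [T n] with [y ^+ n.+1 <= u * x ^+ n.+1],
    and its valuation shows that [y ^+ m <= u * x ^+ m] holds for all [m <= n]
    too.  The relations that hold in almost all [T n] form a proper preorder [Q],
    and the valuation of a total extension of [Q] satisfies
    [m * (lam y - lam x) <= 1] for all [m]. *)
Lemma separating_valuation x y : x != 0 -> nrm x = nrm y ->
  (forall n, ~ frac_le (u * x ^+ n.+1) (y ^+ n.+1)) ->
  exists lam : S -> R,
  [/\ valuation nrm lam, lam u = lam 1 + 1,
      forall a b, a != 0 -> (a <= b)%S -> lam a <= lam b & lam y <= lam x].
Proof.
move=> x0 xy nle; have y0 := nrm_eq_neq0 nrm_ker xy x0.
have xyn n : nrm (u * x ^+ n) = nrm (y ^+ n).
  by rewrite rmorphM !rmorphXn nrm_u rmorph1 mul1r xy.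
have fpP := frac_le_preorder.
have total n : exists T, [/\ frac_preorder T,
    forall a b, frac_le a b -> T a b, ~ T u 1,
    forall a b, a != 0 -> nrm a = nrm b -> T a b \/ T b a &
    T (y ^+ n.+1) (u * x ^+ n.+1)].
  have yn0 : y ^+ n.+1 != 0 by nonzero.
  have [T [fpT subT Tu1 totT]] := total_extension
    (adjoin_preorder (y ^+ n.+1) (u * x ^+ n.+1) fpP)
    (fun a b ab => adjoin_sub _ _ fpP (sle_frac ab))
    (adjoin_proper fpP sle_frac yn0 (esym (xyn n.+1)) (nle n)).
  exists T; split => //; first by move=> a b ab; apply: subT; exact: adjoin_sub.
  by apply: subT; exact: adjoin_self.
pose T n := projT1 (cid (total n)).
have TP n : [/\ frac_preorder (T n),
    forall a b, frac_le a b -> T n a b, ~ T n u 1,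
    forall a b, a != 0 -> nrm a = nrm b -> T n a b \/ T n b a &
    T n (y ^+ n.+1) (u * x ^+ n.+1)] := projT2 (cid (total n)).
have Tm n m : (m <= n)%N -> T n (y ^+ m) (u * x ^+ m).
  move=> mn; have [fpT leT Tu1 totT Ty] := TP n.
  have leT' a b : (a <= b)%S -> T n a b by move=> /sle_frac; exact: leT.
  have [lam [vl lu Tl lT]] := total_valuation fpT leT' Tu1 totT nrm_surj.
  apply: lT; first by nonzero.
    by rewrite xyn.
  have yn0 : y ^+ n.+1 != 0 by nonzero.
  have := Tl _ _ yn0 Ty.
  rewrite -subr_ge0 -subr_gt0 !(shifted_exp _ vl lu x0 xy) => H.
  have [d0|d0] := leP 0 (lam x - lam y).
    by rewrite (lt_le_trans ltr01)// lerDl mulr_ge0.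
  apply: le_lt_trans H _; rewrite ltrD2l ltr_nM2r// ltr_nat.
  by rewrite ltnS.
pose Q a b := exists N, forall n, (N <= n)%N -> T n a b.
have fpQ : frac_preorder Q.
  split.
  - by move=> a; exists 0%N => n _; have [/fp_refl] := TP n.
  - move=> b a c [N1 H1] [N2 H2]; exists (maxn N1 N2) => n.
    rewrite geq_max => /andP[/H1 ab /H2 bc].
    by have [fpT _ _ _ _] := TP n; exact: (fp_trans fpT) bc.
  - move=> c a b [N1 H1]; exists N1 => n /H1 ab.
    by have [fpT _ _ _ _] := TP n; exact: fp_add.
  - move=> c a b [N1 H1]; exists N1 => n /H1 ab.
    by have [fpT _ _ _ _] := TP n; exact: fp_mul.
  - move=> c a b c0 [N1 H1]; exists N1 => n /H1 ab.
    by have [fpT _ _ _ _] := TP n; exact: (fp_cancel fpT) ab.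
  - move=> a b [N1 /(_ _ (leqnn _)) ab].
    by have [fpT _ _ _ _] := TP N1; exact: (fp_nrm fpT).
have leQ a b : (a <= b)%S -> Q a b.
  move=> /sle_frac ab; exists 0%N => n _.
  by have [_ leT _ _ _] := TP n; exact: leT.
have Qu1 : ~ Q u 1.
  by move=> [N /(_ _ (leqnn _)) ab]; have [_ _] := TP N.
have [Z [fpZ QZ Zu1 totZ]] := total_extension fpQ leQ Qu1.
have leZ a b : (a <= b)%S -> Z a b by move=> /leQ; exact: QZ.
have [lam [vl lu Zl _]] := total_valuation fpZ leZ Zu1 totZ nrm_surj.
exists lam; split => //.
  by move=> a b a0 /leZ; exact: Zl.
rewrite -subr_le0; apply: (@archi_le0 _ _ 1) => n.
have yn0 : y ^+ n.+1 != 0 by nonzero.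
have := @Zl (y ^+ n.+1) (u * x ^+ n.+1) yn0 (QZ _ _ _).
rewrite -subr_ge0 (shifted_exp _ vl lu x0 xy) => /(_ _)-H.
have {}H : 0 <= 1 + n.+1%:R * (lam x - lam y).
  by apply: H; exists n.+1 => k nk; exact: Tm.
by lra.
Qed.
End FractionPreorders.

(** * Concave sequences with a doubling inequality *)

Section ConcaveSequences.
Variables (R : realType) (b : nat -> R).
Hypothesis b0 : b 0%N = 0.
Hypothesis b_concave : forall i, b i + b i.+2 <= 2%:R * b i.+1.

Lemma concave_slopeS n k : b (k + n).+1 - b (k + n)%N <= b k.+1 - b k.
Proof.
elim: n => [|n IH]; first by rewrite addn0.
by have := b_concave (k + n)%N; rewrite addnS; lra.
Qed.

Lemma concave_slope_le n k : b (k + n)%N - b k <= n%:R * (b k.+1 - b k).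
Proof.
elim: n => [|n IH]; first by rewrite addn0 subrr mul0r.
by have := concave_slopeS n k; rewrite addnS -[n.+1%:R]natr1; lra.
Qed.

Lemma concave_slope_ge n k :
  n%:R * (b (k + n).+1 - b (k + n)%N) <= b (k + n)%N - b k.
Proof.
elim: n => [|n IH]; first by rewrite addn0 subrr mul0r.
have H := b_concave (k + n)%N; rewrite addnS -[n.+1%:R]natr1.
apply: (@le_trans _ _ ((n%:R + 1) * (b (k + n).+1 - b (k + n)%N))).
  by rewrite ler_wpM2l ?addr_ge0//; lra.
by lra.
Qed.

Lemma concave_ratioS i : i%:R * b i.+1 <= i.+1%:R * b i.
Proof.
elim: i => [|i IH]; first by rewrite mul0r b0 mulr0.
have h : 0 <= i.+1%:R :> R by [].
have := ler_wpM2l h (b_concave i).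
by rewrite -[i.+2%:R]natr1 -[i.+1%:R]natr1 in h IH *; lra.
Qed.

Lemma concave_ratio i j : (0 < i)%N -> (i <= j)%N -> b j / j%:R <= b i / i%:R.
Proof.
move=> i0 ij; rewrite -(subnKC ij); elim: (j - i)%N => [|k IH].
  by rewrite addn0.
apply: le_trans IH; rewrite addnS.
have k0 : (0 < i + k)%N by rewrite ltn_addr.
rewrite ler_pdivrMr ?ltr0n// mulrAC ler_pdivlMr ?ltr0n//.
by rewrite mulrC [leRHS]mulrC; exact: concave_ratioS.
Qed.

Hypothesis b_nondec : forall i, b i <= b i.+1.

Lemma nondec_leq i j : (i <= j)%N -> b i <= b j.
Proof.
move=> ij; rewrite -(subnKC ij); elim: (j - i)%N => [|k IH].
  by rewrite addn0.
by rewrite addnS; apply: le_trans IH _.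
Qed.

Let b_ge0 i : 0 <= b i. Proof. by rewrite -b0; exact: nondec_leq. Qed.

Hypothesis b2 : b 2%N < 1.
Hypothesis b_double : forall i n, (n <= i)%N -> b (2 * i)%N <= n%:R ->
  b (2 * i)%N + b (i - n)%N <= 2%:R * b i.

(** If [b i] grows like [th * i], then [2 * th < 1] by the value at [2], and the
    doubling inequality with [n] about [2 * th * i] becomes
    [2 * th + th * (1 - 2 * th) <= 2 * th] in the limit, so that [th = 0]. *)
Lemma concave_sublinear (e : R) : 0 < e ->
  exists2 m, (0 < m)%N & forall i, (m <= i)%N -> b i <= e * i%:R.
Proof.
move=> e0.
pose A : set R := [set x | exists2 i, (0 < i)%N & x = b i / i%:R].
have A0 : has_inf A.
  split; first by exists (b 1%N / 1%:R), 1%N.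
  by exists 0 => _ [i i0 ->]; rewrite divr_ge0.
pose th := inf A.
have th_le i : (0 < i)%N -> th * i%:R <= b i.
  move=> i0; rewrite -ler_pdivlMr ?ltr0n//.
  by apply: ge_inf; [case: A0 | exists i].
have near_th (x : R) : 0 < x ->
    exists2 m, (0 < m)%N & forall i, (m <= i)%N -> b i <= (th + x) * i%:R.
  move=> x0; have [_ [m m0 ->] mx] := inf_adherent x0 A0.
  exists m => // i mi; have i0 := leq_trans m0 mi.
  rewrite -ler_pdivrMr ?ltr0n//; apply: ltW; apply: le_lt_trans mx.
  exact: concave_ratio.
have th0 : 0 <= th by apply: lb_le_inf => [|_ [i i0 ->]]; [case: A0 | rewrite divr_ge0].
clearbody th.
have th2 : 2%:R * th < 1.
  by apply: le_lt_trans b2; rewrite mulrC; exact: th_le.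
suff : th <= 0.
  move=> th_le0; have th_eq : th = 0 by apply/le_anti; rewrite th_le0.
  by have := near_th e e0; rewrite th_eq add0r.
rewrite leNgt; apply/negP => th_gt0.
pose x : R := th * (1 - 2%:R * th) / 10%:R.
have x0 : 0 < x by rewrite divr_gt0// mulr_gt0// subr_gt0.
have xx : x * 10%:R = th * (1 - 2%:R * th) by rewrite /x; field.
clearbody x.
have [m m0 near] := near_th x x0.
pose i := maxn m (Num.truncn x^-1).+1.
have mi : (m <= i)%N by rewrite leq_maxl.
have i0 : (0 < i)%N by rewrite (leq_trans m0).
have ri : 0 < i%:R :> R by rewrite ltr0n.
have ix : 1 <= x * i%:R.
  rewrite -ler_pdivrMl// mulr1; apply: le_trans (ltW (truncnS_gt _)) _.
  by rewrite ler_nat leq_maxr.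
have H2 := near (2 * i)%N (leq_trans mi (leq_pmull _ (ltn0Sn _))).
rewrite natrM in H2.
pose n := (Num.truncn (b (2 * i)%N)).+1.
have bn : b (2 * i)%N < n%:R by exact: truncnS_gt.
have nb : n%:R <= b (2 * i)%N + 1.
  by rewrite -natr1 lerD2r truncn_le.
have nle : n%:R <= (2%:R * th + 3%:R * x) * i%:R by lra.
have x3 : 2%:R * th + 3%:R * x <= 1.
  have : 0 <= (1 - 2%:R * th) * (10%:R - 3%:R * th) by rewrite mulr_ge0//; lra.
  by lra.
have ni : (n <= i)%N.
  rewrite -(ler_nat R); apply: le_trans nle _.
  by rewrite -[leRHS]mul1r ler_pM2r.
have := b_double ni (ltW bn).
have := near i mi.
have := th_le (2 * i)%N (leq_trans i0 (leq_pmull _ (ltn0Sn _))).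
rewrite natrM => h1 h2 h3.
have h4 : th * (i%:R - n%:R) <= b (i - n)%N.
  rewrite -natrB//; have [->|] := posnP (i - n); first by rewrite mulr0.
  exact: th_le.
have h5 : th * n%:R <= th * ((2%:R * th + 3%:R * x) * i%:R).
  by rewrite ler_wpM2l.
have h6 : i%:R * (8%:R * x - 3%:R * th * x) <= 0.
  have -> : i%:R * (8%:R * x - 3%:R * th * x) =
    i%:R * (x * 10%:R) - i%:R * (2%:R * x + 3%:R * th * x) by ring.
  by rewrite xx; lra.
have h7 : 0 < i%:R * (8%:R * x - 3%:R * th * x).
  rewrite mulr_gt0//.
  have -> : 8%:R * x - 3%:R * th * x = x * (8%:R - 3%:R * th) by ring.
  by rewrite mulr_gt0//; lra.
by lra.
Qed.

(** Sublinear growth allows [n <= k / 4] in the doubling inequality for [i = 2 * k],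
    which then bounds the slope at [4 * k] by an eighth of the slope at [k].  The
    increments of [b] along the points [4 ^ j * m] are thus dominated by a
    geometric series. *)
Lemma concave_bounded : exists C, forall i, b i <= C.
Proof.
have e0 : 0 < 1 / 32%:R :> R by lra.
have [m' m'0 Hm'] := concave_sublinear e0.
pose m := maxn m' 8.
have slope4 k : (m <= k)%N ->
    8%:R * (b (4 * k).+1 - b (4 * k)%N) <= b k.+1 - b k.
  rewrite geq_max => /andP[m'k k8].
  have rk : 8%:R <= k%:R :> R by rewrite ler_nat.
  have := Hm' (4 * k)%N (leq_trans m'k (leq_pmull _ (ltn0Sn _))); rewrite natrM => b4.
  pose n := (Num.truncn (b (4 * k)%N)).+1.
  have bn : b (4 * k)%N < n%:R by exact: truncnS_gt.
  have nb : n%:R <= b (4 * k)%N + 1 by rewrite -natr1 lerD2r truncn_le.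
  have nk : 4%:R * n%:R <= k%:R :> R by lra.
  have nk' : (n <= k)%N by rewrite -(ler_nat R); lra.
  have e4 : (4 * k = 2 * (2 * k))%N by rewrite mulnA.
  have n2k : (n <= 2 * k)%N by rewrite (leq_trans nk')// leq_pmull.
  have := @b_double (2 * k) n n2k; rewrite -e4 => /(_ (ltW bn)) H.
  have := concave_slope_ge (2 * k) (2 * k).
  have -> : (2 * k + 2 * k = 4 * k)%N by rewrite -mulnDl.
  have := concave_slope_le n (2 * k - n).
  rewrite subnK//.
  have := concave_slopeS (k - n) k.
  have -> : (k + (k - n) = 2 * k - n)%N by rewrite addnBA// mul2n addnn.
  have s0 : 0 <= b k.+1 - b k by rewrite subr_ge0.
  have : n%:R * (b (2 * k - n).+1 - b (2 * k - n)%N) <= n%:R * (b k.+1 - b k).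
    rewrite ler_wpM2l//.
    have := concave_slopeS (k - n) k.
    by have -> : (k + (k - n) = 2 * k - n)%N by rewrite addnBA// mul2n addnn.
  have : n%:R * (b k.+1 - b k) <= (k%:R / 4%:R) * (b k.+1 - b k).
    by rewrite ler_wpM2r//; lra.
  rewrite natrM => h1 h2 h3 h4 h5.
  have : k%:R * (8%:R * (b (4 * k).+1 - b (4 * k)%N)) <= k%:R * (b k.+1 - b k).
    by lra.
  by rewrite ler_pM2l//; lra.
have m_gt0 : (0 < m)%N by rewrite leq_max orbT.
pose s := b m.+1 - b m.
have s0 : 0 <= s by rewrite subr_ge0.
have mj j : (m <= 4 ^ j * m)%N by rewrite leq_pmull// expn_gt0.
have slopej j : 8%:R ^+ j * (b (4 ^ j * m).+1 - b (4 ^ j * m)%N) <= s.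
  elim: j => [|j IH]; first by rewrite expr0 mul1r expn0 mul1n.
  apply: le_trans IH; rewrite exprSr -mulrA ler_wpM2l ?exprn_ge0//.
  by have := slope4 _ (mj j); rewrite mulnA -expnS.
have bj j : b (4 ^ j * m)%N <= b m + 6%:R * m%:R * s * (1 - 2%:R ^- j).
  elim: j => [|j IH]; first by rewrite expr0 invr1 subrr mulr0 addr0 mul1n.
  have := concave_slope_le (3 * (4 ^ j * m)) (4 ^ j * m).
  rewrite -mulSn mulnA -expnS => H.
  have H3 : (3 * (4 ^ j * m))%:R * (b (4 ^ j * m).+1 - b (4 ^ j * m)%N) <=
      3%:R * m%:R * (2%:R ^- j * s).
    rewrite !natrM natrX (_ : 4%:R ^+ j = 2%:R ^- j * 8%:R ^+ j).
      have -> : forall z : R, 3%:R * (2%:R ^- j * 8%:R ^+ j * m%:R) * z =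
        (3%:R * m%:R * 2%:R ^- j) * (8%:R ^+ j * z) by move=> z; ring.
      by rewrite [leRHS]mulrA; apply: ler_wpM2l (slopej j).
    rewrite (_ : 8%:R = 2%:R * 4%:R :> R); last by ring.
    by rewrite exprMn mulrA mulVf ?mul1r// expf_neq0// pnatr_eq0.
  have -> : 2%:R ^- j.+1 = 2%:R ^- j / 2%:R :> R by rewrite exprSr invfM mulrC.
  by lra.
exists (b m + 6%:R * m%:R * s) => i.
apply: (@le_trans _ _ (b (4 ^ i * m)%N)).
  apply: nondec_leq; apply: leq_trans (leq_pmulr _ m_gt0).
  exact/ltnW/ltn_expl.
apply: le_trans (bj i) _; rewrite lerD2l -[leRHS]mulr1 ler_wpM2l//.
by rewrite !mulr_ge0.
Qed.

End ConcaveSequences.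

Section Limits.
Variable R : realType.
Implicit Types (f g : nat -> R) (l m : R).

Lemma cvgn_eq_unique f g l m :
  f =1 g -> f @ \oo --> l -> g @ \oo --> m -> l = m.
Proof. by move=> /funext-> fl gm; rewrite -(cvg_lim _ fl)// -(cvg_lim _ gm). Qed.

Lemma cvgn_ge f l m : f @ \oo --> l -> (\forall i \near \oo, m <= f i) -> m <= l.
Proof.
move=> fl mf; rewrite -(cvg_lim _ fl)//; apply: limr_ge => //.
by apply/cvg_ex; exists l.
Qed.

End Limits.

(** * Valuations for which large summands dominate *)

Section MaxType.
Variables (R : realType) (S : comPzSemiRingType) (d : nat).
Variable nrm : {rmorphism S -> posvec R d}.
Hypothesis nrm_ker : forall a, nrm a = 0 -> a = 0.
Hypothesis nrm_surj : forall v : posvec R d, exists a : S, nrm a = v.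
Implicit Types (a b c p q r : S).

Ltac nonzero := nonzero_with nrm_ker.
Let neq0 := nrm_eq_neq0 nrm_ker.

Variables (lam : S -> R) (v w : S).
Hypothesis vl : valuation nrm lam.
Hypothesis v0 : v != 0.
Hypothesis vw : nrm v = nrm w.
Hypothesis lam_w : lam w = lam v + 1.
Hypothesis max_type : lam (v * w + v * w) < lam (v ^+ 2 + w ^+ 2).

Let w0 : w != 0 := neq0 vw v0.
Let one0 : (1 : S) != 0. Proof. by nonzero. Qed.
Let le_vw : lam v <= lam w. Proof. by rewrite lam_w lerDl. Qed.
Local Notation loss := (mix_loss lam).

Let nrm_mix p q i : nrm ((p + q) * w ^+ i) = nrm (p * w ^+ i + q * v ^+ i).
Proof. by rewrite !rmorphD !rmorphM rmorphD !rmorphXn vw; ring. Qed.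

Lemma lam_pow n : lam (w ^+ n) = lam (v ^+ n) + n%:R.
Proof. by have := val_exp nrm_ker vl n v0 vw; rewrite lam_w; lra. Qed.

(** Write [(w ^+ i + v ^+ i) ^+ 2] as the sum of [w ^+ (2 * i) + v ^+ (2 * i)] and
    [v ^+ i * w ^+ i + v ^+ i * w ^+ i].  The ratio of the second to the first is
    at most that of [v ^+ (i - n)] to [w ^+ (i - n)], whose loss is known. *)
Lemma loss_double i n : (n <= i)%N -> loss 1 1 v w (2 * i) <= n%:R ->
  loss 1 1 v w (2 * i) + loss 1 1 v w (i - n) <= 2%:R * loss 1 1 v w i.
Proof.
move=> ni H.
have Z j : (1 + 1) * w ^+ j != 0 by nonzero.
have two0 : (1 + 1 : S) != 0 by nonzero.
have vi0 : v ^+ i != 0 by nonzero.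
have wi0 : w ^+ i != 0 by nonzero.
have wn0 : w ^+ (i - n) != 0 by nonzero.
have E1 := val_prod nrm_ker vl (Z i) (Z i) (nrm_mix 1 1 i) (nrm_mix 1 1 i).
have E3 := val_mul vl two0 (Z (2 * i)%N) (nrm_mix 1 1 (2 * i)).
pose T := 1 * w ^+ (2 * i) + 1 * v ^+ (2 * i).
have T0 : T != 0 by rewrite /T; nonzero.
have ki0 : (1 + 1) * w ^+ i != 0 by nonzero.
have nrmi : nrm (w ^+ i) = nrm (v ^+ i) by rewrite !rmorphXn vw.
have E4 := val_mul vl ki0 wi0 nrmi.
have dbl x : x ^+ (2 * i) = x ^+ i * x ^+ i :> S by rewrite mul2n -addnn exprD.
have nT : nrm T = nrm (v ^+ i * w ^+ i + v ^+ i * w ^+ i).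
  by rewrite /T !mul1r !dbl !rmorphD !rmorphM nrmi.
have nn : nrm (w ^+ (i - n)) = nrm (v ^+ (i - n)) by rewrite !rmorphXn vw.
have := val_mix nrm_ker vl 1 one0 T0 wn0 nT nn.
rewrite (lam_pow (i - n)) natrB//.
have := lam_pow i => Ei.
have -> : 1 * T + 1 * (v ^+ i * w ^+ i + v ^+ i * w ^+ i) =
  (1 * w ^+ i + 1 * v ^+ i) * (1 * w ^+ i + 1 * v ^+ i).
  by rewrite /T !dbl; ring.
have e1 : (1 + 1) * w ^+ i * ((1 + 1) * w ^+ i) =
  (1 + 1) * ((1 + 1) * w ^+ (2 * i)) by rewrite dbl; ring.
have e2 : v ^+ i * w ^+ i + v ^+ i * w ^+ i = (1 + 1) * w ^+ i * v ^+ i by ring.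
have e3 : (1 + 1) * w ^+ i * w ^+ i = (1 + 1) * w ^+ (2 * i) by rewrite dbl; ring.
move: H E1 E3 E4; rewrite /mix_loss -/T e1 e2 e3 => H E1 E3 E4 K.
have {}K := K ltac:(lra).
by lra.
Qed.

Lemma loss11_2 : loss 1 1 v w 2 < 1.
Proof.
have two0 : (1 + 1) * w != 0 by nonzero.
have := val_mul vl two0 v0 vw.
rewrite /mix_loss !mul1r addrC lam_w.
have -> : (1 + 1) * w * v = v * w + v * w by ring.
have -> : (1 + 1) * w * w = (1 + 1) * w ^+ 2 by ring.
by rewrite [w ^+ 2 + _]addrC; move: max_type; lra.
Qed.

Lemma loss11_bounded : exists C, forall i, loss 1 1 v w i <= C.
Proof.
apply: concave_bounded.
- exact: loss0.
- by apply: (loss_concave nrm_ker vl one0 one0 v0 vw); exact: ltW.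
- exact: (loss_nondec nrm_ker vl one0 one0 v0 vw).
- exact: loss11_2.
- exact: loss_double.
Qed.

(** Compare [(w + v) * (w + q * v)] with [w * (w + (q + q + 1) * v)]. *)
Lemma loss_odd q i : q != 0 ->
  loss 1 (q + q + 1) v w i <= loss 1 1 v w i + loss 1 q v w i.
Proof.
move=> q0; rewrite /mix_loss.
set V := v ^+ i; set W := w ^+ i.
have V0 : V != 0 by rewrite /V; nonzero.
have W0 : W != 0 by rewrite /W; nonzero.
have VW : nrm V = nrm W by rewrite /V /W !rmorphXn vw.
have Z p : p != 0 -> (1 + p) * W != 0 by move=> p0; nonzero.
have E1 := val_prod nrm_ker vl (Z 1 one0) (Z q q0) (nrm_mix 1 1 i) (nrm_mix 1 q i).
have q'0 : q + q + 1 != 0 by nonzero.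
have E2 := val_mul vl W0 (Z _ q'0) (nrm_mix 1 (q + q + 1) i).
have qV0 : q * V != 0 by nonzero.
have E3 := val_mul vl qV0 V0 VW.
have := lam_pow i; rewrite -/V -/W => LW.
have n0 : 0 <= i%:R :> R by [].
have H : lam (q * V * V) <= lam (q * V * W) by lra.
have X0 : q * V * V != 0 by nonzero.
have := val_add vl (W * W + (q + 1) * V * W) X0 _ H.
rewrite !(rmorphM nrm (q * V)) VW => /(_ erefl).
have -> : W * W + (q + 1) * V * W + q * V * V = (1 * W + 1 * V) * (1 * W + q * V).
  by ring.
have -> : W * W + (q + 1) * V * W + q * V * W = W * (1 * W + (q + q + 1) * V).
  by ring.
have e : W * ((1 + (q + q + 1)) * W) = (1 + 1) * W * ((1 + q) * W) by ring.
by rewrite -/V -/W e in E1 E2 *; lra.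
Qed.

Lemma loss_nat_bounded k : exists n C, (k <= n)%N /\
  forall i, loss 1 n.+1%:R v w i <= C.
Proof.
elim: k => [|k [n [C [kn HC]]]].
  by have [C HC] := loss11_bounded; exists 0%N, C.
have [C' HC'] := loss11_bounded.
exists (n.+1 + n.+1)%N, (C' + C); split.
  by rewrite addSn ltnS (leq_trans kn)// addnS ltnW// ltnS leq_addr.
move=> i; apply: le_trans (lerD (HC' i) (HC i)).
have -> : (n.+1 + n.+1).+1%:R = n.+1%:R + n.+1%:R + 1 :> S.
  by rewrite -natrD natr1.
by apply: loss_odd; nonzero.
Qed.

(** A large multiple of [p] has the norm of [q + r] for some [r], so that the
    relative weight of the small term is less than in the case of [1] and [n.+1],
    up to a bounded error. *)
Lemma loss_bounded p q : p != 0 -> q != 0 ->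
  exists C, forall i, loss p q v w i <= C.
Proof.
move=> p0 q0.
have [n0 dom] := nrm_dominate nrm_ker nrm_surj p0 q0.
have [n [C [n0n HC]]] := loss_nat_bounded n0.
have [r r0 nr] := dom n n0n; pose M : S := n.+1%:R.
have M0 : M != 0 by rewrite /M; nonzero.
pose t := `|lam (q + r) - lam (M * p)|.
have t0 : 0 <= t by exact: normr_ge0.
have C0 : 0 <= C by rewrite -(loss0 lam 1 M v w); exact: HC.
exists (C + 2%:R * t) => i; have := HC i; rewrite /mix_loss -/M.
set V := v ^+ i; set W := w ^+ i => HCi.
have V0 : V != 0 by rewrite /V; nonzero.
have W0 : W != 0 by rewrite /W; nonzero.
have VW : nrm V = nrm W by rewrite /V /W !rmorphXn vw.
have pqW0 : (p + q) * W != 0 by nonzero.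
have E1 := val_mul vl M0 pqW0 (nrm_mix p q i).
have qr0 : q + r != 0 by nonzero.
have Mp0 : M * p != 0 by nonzero.
have E2 := val_mul vl W0 qr0 (esym nr).
have [tl tr] : lam (q + r) <= lam (M * p) + t /\ lam (M * p) <= lam (q + r) + t.
  by rewrite /t; case: ger0P; lra.
have n1 : nrm (W * (q + r)) = nrm (W * (M * p)) by rewrite !(rmorphM nrm W) -nr.
have X1 : W * (q + r) != 0 by nonzero.
have X2 : W * (M * p) != 0 by nonzero.
have S1 : lam (M * q * V + W * (q + r)) <= lam (M * q * V + W * (M * p)) + t.
  by apply: (val_add_lb nrm_ker vl) => //; lra.
have S2 : lam (M * q * W + W * (M * p)) <= lam (M * q * W + W * (q + r)) + t.
  by apply: (val_add_lb nrm_ker vl) => //; lra.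
have Y1 : (1 + M) * W != 0 by nonzero.
have E3 := val_mul vl q0 Y1 (nrm_mix 1 M i).
have Y2 : q * ((1 + M) * W) != 0 by nonzero.
have S3 : lam (r * W + q * ((1 + M) * W)) <= lam (r * W + q * (1 * W + M * V)) + C.
  apply: (val_add_lb nrm_ker vl) => //; last by rewrite -/V -/W in E3; lra.
  by rewrite !(rmorphM nrm q) -/V -/W (nrm_mix 1 M i).
have e1 : M * ((p + q) * W) = M * q * W + W * (M * p) by ring.
have e2 : M * (p * W + q * V) = M * q * V + W * (M * p) by ring.
have e3 : r * W + q * ((1 + M) * W) = M * q * W + W * (q + r) by ring.
have e4 : r * W + q * (1 * W + M * V) = M * q * V + W * (q + r) by ring.
by rewrite -/V -/W e1 e2 in E1; rewrite e3 e4 in S3; lra.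
Qed.

Lemma loss_cvg p q : p != 0 -> q != 0 -> cvgn (loss p q v w).
Proof.
move=> p0 q0; apply: nondecreasing_is_cvgn.
  by apply/nondecreasing_seqP; exact: (loss_nondec nrm_ker vl p0 q0 v0 vw).
by have [C HC] := loss_bounded p0 q0; exists C => _ [i _ <-].
Qed.

(** The difference of the logarithms of [b] and [a]: as [i] grows, the value of
    [b * w ^+ i + q * v ^+ i] relative to that of [a * w ^+ i + p * v ^+ i] tends
    to it for any [p] and [q] that make the norms equal, see [mix_cvg]. *)
Definition ext_log a b : R :=
  limn (loss a b v w) - limn (loss b a v w).

(** Both products have the leading term [a * b * w ^+ (2 * i)], and their remaining
    coefficients [X] and [Y] have equal norms.  Bounding [X] by [Y] up to the
    fixed power [m], the two sides lie between instances of the loss for [a * b]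
    and [Y] at [i - m] and at [2 * i], and these have the same limit. *)
Lemma mix_swap_small a b p q p' q' e :
  a != 0 -> b != 0 -> p != 0 -> q != 0 -> p' != 0 -> q' != 0 ->
  nrm (a + p) = nrm (b + q) -> nrm (a + p') = nrm (b + q') -> 0 < e ->
  \forall i \near \oo,
    lam ((a * w ^+ i + p' * v ^+ i) * (b * w ^+ i + q * v ^+ i)) <=
    lam ((a * w ^+ i + p * v ^+ i) * (b * w ^+ i + q' * v ^+ i)) + e.
Proof.
move=> a0 b0 p0 q0 p'0 q'0 nab nab' e0.
pose X := p' * b + q * a + p' * q; pose Y := p * b + q' * a + p * q'.
have X0 : X != 0 by rewrite /X; nonzero.
have Y0 : Y != 0 by rewrite /Y; nonzero.
have ab0 : a * b != 0 by nonzero.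
have nXY : nrm X = nrm Y.
  apply: (nrm_addI nrm_ker (c := a * b)) => //.
  have -> : a * b + X = (a + p') * (b + q) by rewrite /X; ring.
  have -> : a * b + Y = (a + p) * (b + q') by rewrite /Y; ring.
  by rewrite !rmorphM nab nab' mulrC.
pose m := (Num.truncn `|lam X - lam Y|).+1.
have mXY : lam X <= lam Y + m%:R.
  by have := truncnS_gt `|lam X - lam Y|; rewrite -/m; have := ler_norm (lam X - lam Y); lra.
have /cvgrPdist_le/(_ e e0)[N _ HN] := loss_cvg ab0 Y0.
have upper i : loss (a * b) Y v w i <= limn (loss (a * b) Y v w).
  apply: nondecreasing_cvgn_le; last exact: loss_cvg.
  by apply/nondecreasing_seqP; exact: (loss_nondec nrm_ker vl ab0 Y0 v0 vw).
exists (N + m)%N => // i /= Ni.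
have mi : (m <= i)%N by rewrite (leq_trans _ Ni)// leq_addl.
have Nim : (N <= i - m)%N by rewrite leq_subRL// addnC.
have := HN (i - m)%N Nim; have := upper (2 * i)%N.
rewrite /mix_loss.
set l := limn _ => up /(le_trans (ler_norm _)) lo.
have dbl x : x ^+ (2 * i) = x ^+ i * x ^+ i :> S by rewrite mul2n -addnn exprD.
have spl x : x ^+ i = x ^+ (i - m) * x ^+ m :> S by rewrite -exprD subnK.
set V := v ^+ i; set W := w ^+ i.
have V0 : V != 0 by rewrite /V; nonzero.
have W0 : W != 0 by rewrite /W; nonzero.
have VW : nrm V = nrm W by rewrite /V /W !rmorphXn vw.
have LW : lam W = lam V + i%:R by exact: lam_pow.
have i0 : 0 <= i%:R :> R by [].
(* lower estimate of the right-hand side *)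
have Z0 : (p * b + q' * a) * V != 0 by nonzero.
have G1 : lam ((p * b + q' * a) * V * V) <= lam ((p * b + q' * a) * V * W).
  by have := val_mul vl Z0 V0 VW; lra.
have Z1 : (p * b + q' * a) * V * V != 0 by nonzero.
have := val_add vl (a * b * W * W + p * q' * V * V) Z1 _ G1.
rewrite !(rmorphM nrm (_ * V)) VW => /(_ erefl).
have -> : a * b * W * W + p * q' * V * V + (p * b + q' * a) * V * V =
  a * b * w ^+ (2 * i) + Y * v ^+ (2 * i) by rewrite !dbl /Y -/V -/W; ring.
have -> : a * b * W * W + p * q' * V * V + (p * b + q' * a) * V * W =
  (a * W + p * V) * (b * W + q' * V) by ring.
move=> low.
(* upper estimate of the left-hand side *)
have Z2 : p' * q * V != 0 by nonzero.
have G2 : lam (p' * q * V * V) <= lam (p' * q * V * W).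
  by have := val_mul vl Z2 V0 VW; lra.
have Z3 : p' * q * V * V != 0 by nonzero.
have := val_add vl (a * b * W * W + (p' * b + q * a) * V * W) Z3 _ G2.
rewrite !(rmorphM nrm (_ * V)) VW => /(_ erefl).
have -> : a * b * W * W + (p' * b + q * a) * V * W + p' * q * V * V =
  (a * W + p' * V) * (b * W + q * V) by ring.
have -> : a * b * W * W + (p' * b + q * a) * V * W + p' * q * V * W =
  a * b * W * W + X * (V * W) by rewrite /X; ring.
move=> upp1.
have VW0 : V * W != 0 by nonzero.
have YU0 : Y * (W * v ^+ (i - m)) != 0 by nonzero.
have vm0 : v ^+ m != 0 by nonzero.
have nm : nrm (v ^+ m) = nrm (w ^+ m) by rewrite !rmorphXn vw.
have E5 := val_mul vl YU0 vm0 nm; have := lam_pow m => Em.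
have E6 := val_mul vl VW0 X0 nXY.
have eVW : Y * (W * v ^+ (i - m)) * v ^+ m = V * W * Y by rewrite /V [v ^+ i]spl; ring.
rewrite eVW in E5.
have G3 : lam (V * W * X) <= lam (Y * (W * v ^+ (i - m)) * w ^+ m) by lra.
have Z4 : V * W * X != 0 by nonzero.
have := val_add vl (a * b * W * W) Z4 _ G3.
have nG3 : nrm (V * W * X) = nrm (Y * (W * v ^+ (i - m)) * w ^+ m).
  by rewrite rmorphM nXY -rmorphM -eVW !(rmorphM nrm (Y * _)) nm.
move=> /(_ nG3).
rewrite [V * W * X]mulrC.
have -> : a * b * W * W + Y * (W * v ^+ (i - m)) * w ^+ m =
   W * w ^+ m * (a * b * w ^+ (i - m) + Y * v ^+ (i - m)).
  by rewrite {2}/W [w ^+ i]spl; ring.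
move=> upp2.
have Wm0 : W * w ^+ m != 0 by nonzero.
have D0 : (a * b + Y) * w ^+ (i - m) != 0 by nonzero.
have := val_mul vl Wm0 D0 (nrm_mix (a * b) Y (i - m)).
have -> : W * w ^+ m * ((a * b + Y) * w ^+ (i - m)) = (a * b + Y) * w ^+ (2 * i).
  by rewrite dbl -/W {2}/W [w ^+ i]spl; ring.
by move: up lo upp1 upp2 low; rewrite /mix_loss; lra.
Qed.

Lemma mix_cvg a b p q : a != 0 -> b != 0 -> p != 0 -> q != 0 ->
  nrm (a + p) = nrm (b + q) ->
  lam (b * w ^+ i + q * v ^+ i) - lam (a * w ^+ i + p * v ^+ i)
    @[i --> \oo] --> ext_log a b.
Proof.
move=> a0 b0 p0 q0 nab.
have nab' : nrm (a + b) = nrm (b + a) by rewrite addrC.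
have base : lam (b * w ^+ i + a * v ^+ i) - lam (a * w ^+ i + b * v ^+ i)
    @[i --> \oo] --> ext_log a b.
  have -> : (fun i => lam (b * w ^+ i + a * v ^+ i) - lam (a * w ^+ i + b * v ^+ i)) =
      (fun i => loss a b v w i - loss b a v w i).
    by apply/funext => i; rewrite /mix_loss [b + a]addrC; ring.
  by apply: cvgB; apply: loss_cvg.
have small : (lam (b * w ^+ i + q * v ^+ i) - lam (a * w ^+ i + p * v ^+ i)) -
    (lam (b * w ^+ i + a * v ^+ i) - lam (a * w ^+ i + b * v ^+ i))
    @[i --> \oo] --> (0 : R).
  apply/cvgrPdist_le => e e0.
  have H1 := mix_swap_small a0 b0 p0 q0 b0 a0 nab nab' e0.
  have H2 := mix_swap_small a0 b0 b0 a0 p0 q0 nab' nab e0.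
  apply: filterS2 H1 H2 => i h1 h2.
  set A := a * w ^+ i + p * v ^+ i; set B := b * w ^+ i + q * v ^+ i.
  set A' := a * w ^+ i + b * v ^+ i; set B' := b * w ^+ i + a * v ^+ i.
  rewrite -/A -/B -/A' -/B' in h1 h2.
  have A0 : A != 0 by rewrite /A; nonzero.
  have A'0 : A' != 0 by rewrite /A'; nonzero.
  have nAB : nrm A = nrm B.
    by rewrite /A /B !rmorphD !rmorphM !rmorphXn vw -!mulrDl -!rmorphD nab.
  have nAB' : nrm A' = nrm B'.
    by rewrite /A' /B' !rmorphD !rmorphM !rmorphXn vw -!mulrDl -!rmorphD nab'.
  have E1 := val_mul vl A'0 A0 nAB; have E2 := val_mul vl A0 A'0 nAB'.
  rewrite [A' * A]mulrC in E1.
  by rewrite sub0r normrN ler_norml; apply/andP; split; lra.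
pose D x y i := lam (b * w ^+ i + x * v ^+ i) - lam (a * w ^+ i + y * v ^+ i).
have H := cvgD small base; rewrite add0r in H.
suff : D q p @ \oo --> ext_log a b by [].
have -> : D q p = (fun i => D q p i - D a b i) + D a b.
  by apply/funext => i; rewrite fctE subrK.
exact: H.
Qed.

Lemma ext_log_trans a b c : a != 0 -> b != 0 -> c != 0 ->
  ext_log a c = ext_log a b + ext_log b c.
Proof.
move=> a0 b0 c0.
have bc0 : b + c != 0 by nonzero.
have ac0 : a + c != 0 by nonzero.
have ab0 : a + b != 0 by nonzero.
have e1 : nrm (a + (b + c)) = nrm (b + (a + c)) by congr (nrm _); ring.
have e2 : nrm (b + (a + c)) = nrm (c + (a + b)) by congr (nrm _); ring.
have H1 := mix_cvg a0 b0 bc0 ac0 e1; have H2 := mix_cvg b0 c0 ac0 ab0 e2.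
apply: cvgn_eq_unique (mix_cvg a0 c0 bc0 ab0 (etrans e1 e2)) (cvgD H1 H2) => i.
by rewrite fctE; ring.
Qed.

Lemma ext_log_mul c a b : c != 0 -> a != 0 -> b != 0 ->
  ext_log (c * a) (c * b) = ext_log a b.
Proof.
move=> c0 a0 b0.
have ca0 : c * a != 0 by nonzero.
have cb0 : c * b != 0 by nonzero.
have e1 : nrm (a + b) = nrm (b + a) by rewrite addrC.
have e2 : nrm (c * a + c * b) = nrm (c * b + c * a) by rewrite addrC.
apply: cvgn_eq_unique (mix_cvg ca0 cb0 cb0 ca0 e2) (mix_cvg a0 b0 b0 a0 e1) => i.
rewrite -!mulrA -!mulrDr; apply: (val_mul vl) => //; first by nonzero.
by rewrite !rmorphD !rmorphM !rmorphXn vw; ring.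
Qed.

Lemma ext_logE a b : a != 0 -> nrm a = nrm b -> ext_log a b = lam b - lam a.
Proof.
move=> a0 ab; have b0 := neq0 ab a0.
have e : nrm (a + a) = nrm (b + b) by rewrite !rmorphD ab.
apply: cvgn_eq_unique (mix_cvg a0 b0 a0 b0 e) (cvg_cst _) => i.
rewrite -!mulrDr ![_ * (_ + _)]mulrC; apply: (val_mul vl) => //.
by nonzero.
Qed.

Lemma ext_log_ge0 a c : a != 0 -> 0 <= ext_log a (a + c).
Proof.
move=> a0; have ac0 : a + c != 0 by nonzero.
have c10 : c + 1 != 0 by nonzero.
have e : nrm (a + (c + 1)) = nrm (a + c + 1) by rewrite addrA.
apply: cvgn_ge (mix_cvg a0 ac0 c10 one0 e) _; apply: nearW => i.
rewrite subr_ge0.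
have -> : a * w ^+ i + (c + 1) * v ^+ i = a * w ^+ i + v ^+ i + c * v ^+ i by ring.
have -> : (a + c) * w ^+ i + 1 * v ^+ i = a * w ^+ i + v ^+ i + c * w ^+ i by ring.
have [->|c0] := eqVneq c 0; first by rewrite !mul0r.
have vi0 : v ^+ i != 0 by nonzero.
have nvw : nrm (v ^+ i) = nrm (w ^+ i) by rewrite !rmorphXn vw.
have := val_mul vl c0 vi0 nvw; rewrite lam_pow.
have i0 : 0 <= i%:R :> R by [].
move=> E; apply: (val_add vl); [by nonzero | by rewrite !rmorphM nvw | by lra].
Qed.

Lemma ext_log_add c a b : a != 0 -> b != 0 -> 0 <= ext_log a b ->
  0 <= ext_log (a + c) (b + c).
Proof.
move=> a0 b0 ab_ge0.
have ac0 : a + c != 0 by nonzero.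
have bc0 : b + c != 0 by nonzero.
have e : nrm (a + b) = nrm (b + a) by rewrite addrC.
have e' : nrm (a + c + b) = nrm (b + c + a) by congr (nrm _); ring.
have H := mix_cvg a0 b0 b0 a0 e.
have H' := mix_cvg ac0 bc0 b0 a0 e'.
apply/ler_addgt0Pr => t t0; rewrite -lerBlDr sub0r.
apply: (cvgn_ge H').
have /cvgrPdist_le/(_ _ t0) := H; apply: filterS => i /=.
rewrite ler_norml => /andP[_ le].
set A := a * w ^+ i + b * v ^+ i in le *; set B := b * w ^+ i + a * v ^+ i in le *.
have -> : (a + c) * w ^+ i + b * v ^+ i = c * w ^+ i + A by rewrite /A; ring.
have -> : (b + c) * w ^+ i + a * v ^+ i = c * w ^+ i + B by rewrite /B; ring.
have A0 : A != 0 by rewrite /A; nonzero.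
have AB : nrm A = nrm B by rewrite /A /B !rmorphD !rmorphM !rmorphXn vw; ring.
have := val_add_lb nrm_ker vl (t := t) (c * w ^+ i) A0 AB (ltW t0).
by lra.
Qed.

(** Over [1], the map [ext_log] is a logarithm that extends [lam]. *)
Lemma ambient_log : exists ell : S -> R,
  [/\ forall a b, a != 0 -> b != 0 -> ell (a * b) = ell a + ell b,
      forall a c, a != 0 -> ell a <= ell (a + c),
      forall c a b, a != 0 -> b != 0 -> ell a <= ell b -> ell (a + c) <= ell (b + c) &
      forall a b, a != 0 -> nrm a = nrm b -> ell b - ell a = lam b - lam a].
Proof.
have sub a b : a != 0 -> b != 0 -> ext_log 1 b - ext_log 1 a = ext_log a b.
  by move=> a0 b0; rewrite (ext_log_trans one0 a0 b0); ring.
exists (ext_log 1); split.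
- move=> a b a0 b0; have ab0 : a * b != 0 by nonzero.
  by rewrite (ext_log_trans one0 a0 ab0) -{2}[a]mulr1 ext_log_mul.
- move=> a c a0; rewrite -subr_ge0 sub//; first exact: ext_log_ge0.
  by nonzero.
- move=> c a b a0 b0; rewrite -subr_ge0 sub// => ab.
  by rewrite -subr_ge0 sub ?ext_log_add//; nonzero.
- move=> a b a0 ab; rewrite sub//; first exact: ext_logE.
  exact: neq0 a0.
Qed.

End MaxType.

(** * From a logarithm to a homomorphism *)

Section Homomorphism.
Variables (R : realType) (S : comPzSemiRingType) (d : nat).
Variable nrm : {rmorphism S -> posvec R d}.
Hypothesis nrm_ker : forall a, nrm a = 0 -> a = 0.
Implicit Types (a b c : S).

Ltac nonzero := nonzero_with nrm_ker.

Variable ell : S -> R.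
Hypothesis ell_mul : forall a b, a != 0 -> b != 0 -> ell (a * b) = ell a + ell b.
Hypothesis ell_ge : forall a c, a != 0 -> ell a <= ell (a + c).
Hypothesis ell_add : forall c a b, a != 0 -> b != 0 ->
  ell a <= ell b -> ell (a + c) <= ell (b + c).

Let one0 : (1 : S) != 0. Proof. by nonzero. Qed.

Lemma ell1 : ell 1 = 0.
Proof. by have := ell_mul one0 one0; rewrite mulr1; lra. Qed.

Section Exponential.
Variable k : R.
Hypothesis k0 : 0 < k.

Definition exp_ell a : R := if a == 0 then 0 else expR (k * ell a).

Lemma exp_ell_ge0 a : 0 <= exp_ell a.
Proof. by rewrite /exp_ell; case: eqP => // _; exact: expR_ge0. Qed.

Lemma exp_ellE a : a != 0 -> exp_ell a = expR (k * ell a).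
Proof. by rewrite /exp_ell => /negPf->. Qed.

Lemma exp_ell0 : exp_ell 0 = 0. Proof. by rewrite /exp_ell eqxx. Qed.

Lemma exp_ell_gt0 a : a != 0 -> 0 < exp_ell a.
Proof. by move=> a0; rewrite exp_ellE// expR_gt0. Qed.

Lemma exp_ell1 : exp_ell 1 = 1.
Proof. by rewrite exp_ellE// ell1 mulr0 expR0. Qed.

Lemma exp_ellM a b : exp_ell (a * b) = exp_ell a * exp_ell b.
Proof.
have [->|a0] := eqVneq a 0; first by rewrite mul0r exp_ell0 mul0r.
have [->|b0] := eqVneq b 0; first by rewrite mulr0 exp_ell0 mulr0.
have ab0 : a * b != 0 by nonzero.
by rewrite !exp_ellE// ell_mul// mulrDr expRD.
Qed.

Lemma exp_ellX a n : exp_ell (a ^+ n) = exp_ell a ^+ n.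
Proof. by elim: n => [|n IH]; rewrite ?exp_ell1// !exprS exp_ellM IH. Qed.

Lemma exp_ell_addl a c : exp_ell a <= exp_ell (a + c).
Proof.
have [->|a0] := eqVneq a 0; first by rewrite exp_ell0 exp_ell_ge0.
have ac0 : a + c != 0 by nonzero.
by rewrite !exp_ellE// ler_expR ler_pM2l// ell_ge.
Qed.

Lemma exp_ell_mono c a b : exp_ell a <= exp_ell b ->
  exp_ell (a + c) <= exp_ell (b + c).
Proof.
have [->|a0] := eqVneq a 0; first by rewrite add0r addrC exp_ell_addl.
have [->|b0] := eqVneq b 0.
  by rewrite exp_ell0 leNgt (exp_ell_gt0 a0).
have ac0 : a + c != 0 by nonzero.
have bc0 : b + c != 0 by nonzero.
by rewrite !exp_ellE// !ler_expR !ler_pM2l//; exact: ell_add.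
Qed.

Lemma exp_ell_mono2 a b a' b' : exp_ell a <= exp_ell b ->
  exp_ell a' <= exp_ell b' -> exp_ell (a + a') <= exp_ell (b + b').
Proof.
move=> ab ab'; apply: le_trans (exp_ell_mono a' ab) _.
by rewrite ![b + _]addrC; exact: exp_ell_mono.
Qed.

(** With [1 + 1] of value [1], the sum [a + b] lies between [b] and [b + b] in
    value, where [b] is the larger summand. *)
Lemma exp_ell_max a b : exp_ell (1 + 1) = 1 ->
  exp_ell (a + b) = Num.max (exp_ell a) (exp_ell b).
Proof.
move=> two.
wlog ab : a b / exp_ell a <= exp_ell b.
  move=> H; have [ab|/ltW ba] := leP (exp_ell a) (exp_ell b).
    by rewrite H// max_r.
  by rewrite addrC H// max_r.
rewrite max_r//; apply/le_anti/andP; split; last by rewrite addrC exp_ell_addl.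
apply: le_trans (exp_ell_mono b ab) _.
by rewrite -mulr2n -mulr_natl exp_ellM -[2%:R]/(1 + 1) two mul1r.
Qed.

Hypothesis two : exp_ell (1 + 1) = 2%:R.

Lemma exp_ell_nat_mono m n : (m <= n)%N -> exp_ell m%:R <= exp_ell n%:R.
Proof. by move=> /subnKC <-; rewrite natrD exp_ell_addl. Qed.

(** The values at powers of [2] are known, and sandwiching [n.+1 ^ m] between
    consecutive ones determines the value at [n.+1] up to the factor
    [2] to the power [1 / m]. *)
Lemma exp_ell_nat n : exp_ell n%:R = n%:R.
Proof.
case: n => [|n]; first exact: exp_ell0.
have N0 : (n.+1%:R : S) != 0 by nonzero.
have p0 := exp_ell_gt0 N0.
have two_pow j : exp_ell (2 ^ j)%:R = (2 ^ j)%:R.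
  by rewrite !natrX exp_ellX -[2%:R in LHS]/(1 + 1) two.
have key m : exp_ell (n.+1 ^ m)%:R <= 2%:R * (n.+1 ^ m)%:R /\
             (n.+1 ^ m)%:R <= 2%:R * exp_ell (n.+1 ^ m)%:R.
  have [lo hi] : (2 ^ trunc_log 2 (n.+1 ^ m) <= n.+1 ^ m)%N /\
                 (n.+1 ^ m < 2 ^ (trunc_log 2 (n.+1 ^ m)).+1)%N.
    by apply/andP; apply: trunc_log_bounds => //; rewrite expn_gt0.
  have := exp_ell_nat_mono lo; have := exp_ell_nat_mono (ltnW hi).
  rewrite !two_pow expnS natrM.
  have : (2 ^ trunc_log 2 (n.+1 ^ m))%:R <= (n.+1 ^ m)%:R :> R by rewrite ler_nat.
  have : (n.+1 ^ m)%:R <= 2%:R * (2 ^ trunc_log 2 (n.+1 ^ m))%:R :> R.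
    by rewrite -natrM ler_nat -expnS ltnW.
  by split; lra.
have n0 : 0 < n.+1%:R :> R by rewrite ltr0n.
have lnkey m : `|m%:R * (ln (exp_ell n.+1%:R) - ln n.+1%:R)| <= ln (2%:R : R).
  have [] := key m; rewrite !natrX exp_ellX.
  have e0 : 0 < exp_ell n.+1%:R ^+ m by rewrite exprn_gt0.
  have n0' : 0 < n.+1%:R ^+ m :> R by rewrite exprn_gt0.
  rewrite -ler_ln ?posrE ?mulr_gt0// lnM ?posrE// !lnXn// => h1.
  rewrite -ler_ln ?posrE ?mulr_gt0// lnM ?posrE// !lnXn// => h2.
  rewrite -!(mulr_natl (ln _)) in h1 h2.
  by rewrite ler_norml; apply/andP; split; lra.
have ln_eq : ln (exp_ell n.+1%:R) = ln (n.+1%:R : R).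
  by apply/eqP; rewrite -subr_eq0; apply/eqP; exact: archi_eq0 lnkey.
by apply: ln_inj; rewrite ?posrE.
Qed.

(** Large integral multiples of [a] and [b] lie between consecutive natural
    numbers, on which the map is the identity. *)
Lemma exp_ell_add a b : exp_ell (a + b) = exp_ell a + exp_ell b.
Proof.
have scale n c : exp_ell (n%:R * c) = n%:R * exp_ell c.
  by rewrite exp_ellM exp_ell_nat.
have approx n c : exp_ell (Num.truncn (n%:R * exp_ell c))%:R <= exp_ell (n%:R * c) /\
    exp_ell (n%:R * c) <= exp_ell (Num.truncn (n%:R * exp_ell c)).+1%:R.
  rewrite !exp_ell_nat scale; split; last exact/ltW/truncnS_gt.
  by rewrite truncn_le mulr_ge0// exp_ell_ge0.
have key n : `|n%:R * (exp_ell (a + b) - (exp_ell a + exp_ell b))| <= 2%:R.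
  have [a1 a2] := approx n a; have [b1 b2] := approx n b.
  have := exp_ell_mono2 a1 b1; have := exp_ell_mono2 a2 b2.
  rewrite -mulrDr -!natrD !scale !exp_ell_nat !natrD.
  move: a1 a2 b1 b2; rewrite !scale !exp_ell_nat -![_.+1%:R]natr1 => *.
  by rewrite ler_norml; apply/andP; split; lra.
by apply/eqP; rewrite -subr_eq0; apply/eqP; exact: archi_eq0 key.
Qed.

End Exponential.

(** The two cases are distinguished by whether [1 + 1] is equivalent to [1]. *)
Lemma ambient_hom : exists2 k : R, 0 < k &
  (exists phi : {rmorphism S -> Rplus R},
     forall a, a != 0 -> (phi a : nnreal R)%:num = expR (k * ell a)) \/
  (exists phi : {rmorphism S -> TRplus R},
     forall a, a != 0 -> (phi a : tropical R)%:num = expR (k * ell a)).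
Proof.
have two0 : (1 + 1 : S) != 0 by nonzero.
have := ell_ge 1 one0; rewrite ell1 le_eqVlt => /orP[/eqP two|two].
  exists 1 => //; right.
  pose f a : tropical R := NngNum (exp_ell_ge0 1 a).
  have two1 : exp_ell 1 (1 + 1) = 1 by rewrite exp_ellE// -two mulr0 expR0.
  have f_nmod : nmod_morphism (f : S -> TRplus R).
    split; first by apply/val_inj; rewrite /= exp_ell0.
    move=> a b; apply/val_inj.
    transitivity ((Order.max (f a) (f b))%:num); last by [].
    by rewrite num_max /= (exp_ell_max ltr01 _ _ two1).
  have f_monoid : monoid_morphism (f : S -> TRplus R).
    split; first by apply/val_inj; rewrite /= exp_ell1.
    by move=> a b; apply/val_inj; rewrite /= exp_ellM.
  pose fm := GRing.isNmodMorphism.Build S (TRplus R) f f_nmod.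
  pose fr := GRing.isMonoidMorphism.Build S (TRplus R) f f_monoid.
  pose phi : {rmorphism S -> TRplus R} := HB.pack (f : S -> TRplus R) fm fr.
  by exists phi => a a0; rewrite /= exp_ellE.
pose k : R := ln 2%:R / ell (1 + 1).
have k0 : 0 < k by rewrite divr_gt0// ln_gt0// ltr1n.
have twok : exp_ell k (1 + 1) = 2%:R.
  by rewrite exp_ellE// divfK ?gt_eqF// lnK// posrE.
exists k => //; left.
pose f a : nnreal R := NngNum (exp_ell_ge0 k a).
have f_nmod : nmod_morphism (f : S -> Rplus R).
  split; first by apply/val_inj; rewrite /= exp_ell0.
  by move=> a b; apply/val_inj; rewrite /= (exp_ell_add k0 twok).
have f_monoid : monoid_morphism (f : S -> Rplus R).
  split; first by apply/val_inj; rewrite /= exp_ell1.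
  by move=> a b; apply/val_inj; rewrite /= exp_ellM.
pose fm := GRing.isNmodMorphism.Build S (Rplus R) f f_nmod.
pose fr := GRing.isMonoidMorphism.Build S (Rplus R) f f_monoid.
pose phi : {rmorphism S -> Rplus R} := HB.pack (f : S -> Rplus R) fm fr.
by exists phi => a a0; rewrite /= exp_ellE.
Qed.

End Homomorphism.

(** * Coefficient fields of square-zero extensions *)

Section CoefficientField.
Variables (F : numFieldType) (E : comNzRingType) (N : {rmorphism E -> F}).
Implicit Types (x y z h : E) (p q : {poly E}) (K : set E).

(** Subrings are plain sets here, so that unions of chains are immediate. *)
Record subring_set K : Prop := SubringSet {
  ss_one : K 1;
  ss_sub : forall x y, K x -> K y -> K (x - y);
  ss_mul : forall x y, K x -> K y -> K (x * y)
}.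

(** For such [K], the map [N] identifies [K] with a subring of [F]. *)
Definition lifts_injectively K := subring_set K /\ forall x, K x -> N x = 0 -> x = 0.

Section SubringTheory.
Variable K : set E.
Hypothesis sK : subring_set K.

Lemma ss_zero : K 0.
Proof. by rewrite -(subrr 1); apply: ss_sub => //; exact: ss_one. Qed.

Lemma ss_add x y : K x -> K y -> K (x + y).
Proof.
move=> Kx Ky; rewrite -[y]opprK; apply: ss_sub => //.
by rewrite -sub0r; apply: ss_sub => //; exact: ss_zero.
Qed.

Lemma ss_mulrn x n : K x -> K (x *+ n).
Proof.
move=> Kx; elim: n => [|n IH]; first exact: ss_zero.
by rewrite mulrS; exact: ss_add.
Qed.

Lemma ss_sum n (G : 'I_n -> E) : (forall i, K (G i)) -> K (\sum_i G i).
Proof. by move=> KG; apply: big_ind => //; [exact: ss_zero | exact: ss_add]. Qed.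

Definition coefs_in p := forall i, K p`_i.

Lemma coefs_inC x : K x -> coefs_in x%:P.
Proof. by move=> Kx i; rewrite coefC; case: ifP => // _; exact: ss_zero. Qed.

Lemma coefs_inX : coefs_in 'X.
Proof. by move=> i; rewrite coefX; case: eqP => _; [exact: ss_one | exact: ss_zero]. Qed.

Lemma coefs_inB p q : coefs_in p -> coefs_in q -> coefs_in (p - q).
Proof. by move=> Kp Kq i; rewrite coefB; exact: ss_sub. Qed.

Lemma coefs_inM p q : coefs_in p -> coefs_in q -> coefs_in (p * q).
Proof. by move=> Kp Kq i; rewrite coefM; apply: ss_sum => j; exact: ss_mul. Qed.

Lemma coefs_in_deriv p : coefs_in p -> coefs_in p^`().
Proof. by move=> Kp i; rewrite coef_deriv; exact: ss_mulrn. Qed.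

Lemma coefs_inMXn p n : coefs_in p -> coefs_in (p * 'X^n).
Proof.
by move=> Kp i; rewrite coefMXn; case: ifP => // _; exact: ss_zero.
Qed.

Definition adjoin_elt x : set E := [set y | exists2 p, coefs_in p & y = p.[x]].

Lemma adjoin_elt_subring x : subring_set (adjoin_elt x).
Proof.
split.
- by exists 1%:P; rewrite ?hornerC//; apply: coefs_inC; exact: ss_one.
- move=> _ _ [p Kp ->] [q Kq ->]; exists (p - q); first exact: coefs_inB.
  by rewrite !hornerE.
- move=> _ _ [p Kp ->] [q Kq ->]; exists (p * q); first exact: coefs_inM.
  by rewrite hornerM.
Qed.

Lemma adjoin_elt_sub x : K `<=` adjoin_elt x.
Proof. by move=> y Ky; exists y%:P; rewrite ?hornerC//; exact: coefs_inC. Qed.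

Lemma adjoin_elt_self x : adjoin_elt x x.
Proof. by exists 'X; rewrite ?hornerX//; exact: coefs_inX. Qed.

End SubringTheory.

(** Taylor's formula stops after the linear term. *)
Lemma horner_square_zero p x h :
  h * h = 0 -> p.[x + h] = p.[x] + p^`().[x] * h.
Proof.
move=> hh; elim/poly_ind: p => [|p c IH]; first by rewrite deriv0 !horner0 mul0r addr0.
rewrite derivMXaddC !hornerE IH.
have -> : (p.[x] + p^`().[x] * h) * (x + h) + c =
  p.[x] * x + c + (p.[x] + p^`().[x] * x) * h + p^`().[x] * (h * h) by ring.
by rewrite hh mulr0 addr0.
Qed.

Hypothesis N_surj : forall r, exists x, N x = r.
Hypothesis N_square_zero : forall x y, N x = 0 -> N y = 0 -> x * y = 0.

Lemma lift_unit x : N x != 0 -> exists y, x * y = 1.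
Proof.
move=> Nx; have [y Ny] := N_surj (N x)^-1.
pose z := x * y - 1.
have Nz : N z = 0 by rewrite rmorphB rmorphM Ny rmorph1 mulfV// subrr.
exists (y * (1 - z)); have -> : x * (y * (1 - z)) = 1 - z * z by rewrite /z; ring.
by rewrite N_square_zero// subr0.
Qed.

Lemma maximal_lift K0 : lifts_injectively K0 ->
  exists K, [/\ K0 `<=` K, lifts_injectively K &
    forall L, lifts_injectively L -> K `<=` L -> L `<=` K].
Proof.
move=> gK0.
have [|A [gA maxA]] := @Zorn_bigcup _ (fun A => lifts_injectively (A `|` K0)).
  move=> G gG tG; set U := \bigcup_(X in G) X.
  have one x : (U `|` K0) x -> (exists2 X, G X & (X `|` K0) x) \/ K0 x.
    by case=> [[X GX Xx]|]; [left; exists X => //; left | right].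
  have two x y : (U `|` K0) x -> (U `|` K0) y ->
      (exists X, [/\ G X, (X `|` K0) x & (X `|` K0) y]) \/ (K0 x /\ K0 y).
    case=> [[X GX Xx]|Kx] [[Y GY Yy]|Ky]; last by right.
    - left; have [XY|YX] := tG X Y GX GY.
        by exists Y; split=> //; left => //; exact: XY.
      by exists X; split=> //; left => //; exact: YX.
    - by left; exists X; split=> //; [left | right].
    - by left; exists Y; split=> //; [right | left].
  have up X x : G X -> (X `|` K0) x -> (U `|` K0) x.
    by move=> GX [Xx|]; [left; exists X | right].
  split; first split.
  - by right; exact: (ss_one gK0.1).
  - move=> x y Ux Uy; have [[X [GX Xx Xy]]|[Kx Ky]] := two x y Ux Uy.
      by apply: (up X) => //; apply: ss_sub => //; exact: (gG X GX).1.
    by right; apply: ss_sub => //; exact: gK0.1.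
  - move=> x y Ux Uy; have [[X [GX Xx Xy]]|[Kx Ky]] := two x y Ux Uy.
      by apply: (up X) => //; apply: ss_mul => //; exact: (gG X GX).1.
    by right; apply: ss_mul => //; exact: gK0.1.
  - move=> x /one[[X GX Xx]|Kx]; first exact: (gG X GX).2.
    exact: gK0.2.
exists (A `|` K0); split => // L gL AL.
have [AltL|nAL] := pselect (A `<` L).
  exfalso; apply: (maxA L AltL); rewrite (_ : L `|` K0 = L)//.
  by apply/seteqP; split=> [x [//|K0x]|x Lx]; [apply: AL; right | left].
have sAL : A `<=` L by move=> x Ax; apply: AL; left.
apply: contrapT => nLA; apply: nAL; split => // LA.
by apply: nLA => x /LA; left.
Qed.

Section Maximal.
Variable K : set E.
Hypothesis gK : lifts_injectively K.
Hypothesis maxK : forall L, lifts_injectively L -> K `<=` L -> L `<=` K.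
Let sK := gK.1.
Let injK := gK.2.

(** Otherwise the localisation of [K] at [x] would be larger. *)
Lemma maximal_lift_inv x y : K x -> N x != 0 -> x * y = 1 -> K y.
Proof.
move=> Kx Nx xy.
pose L : set E := [set z | exists n, K (z * x ^+ n)].
have Kxn n : K (x ^+ n).
  by elim: n => [|n IH]; [exact: ss_one | rewrite exprS; exact: ss_mul].
apply: (maxK (L := L)); last by exists 1%N; rewrite expr1 mulrC xy; exact: ss_one.
  split; first split.
  - by exists 0%N; rewrite mulr1; exact: ss_one.
  - move=> a b [m Ka] [n Kb]; exists (m + n)%N.
    have -> : (a - b) * x ^+ (m + n) =
      a * x ^+ m * x ^+ n - b * x ^+ n * x ^+ m by rewrite exprD; ring.
    by apply: ss_sub => //; exact: ss_mul.
  - move=> a b [m Ka] [n Kb]; exists (m + n)%N.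
    have -> : a * b * x ^+ (m + n) = (a * x ^+ m) * (b * x ^+ n) by rewrite exprD; ring.
    exact: ss_mul.
  - move=> a [n Ka] Na.
    have az : a * x ^+ n = 0 by apply: injK => //; rewrite rmorphM Na mul0r.
    by rewrite -[a]mulr1 -(expr1n _ n) -xy exprMn mulrA az mul0r.
by move=> z Kz; exists 0%N; rewrite mulr1.
Qed.

Lemma adjoin_elt_not_lift x : ~ K x ->
  exists p, [/\ coefs_in K p, p != 0 & N p.[x] = 0].
Proof.
move=> nKx; apply: contrapT => none; apply: nKx.
apply: (maxK (L := adjoin_elt K x)); last exact: adjoin_elt_self.
  split; first exact: adjoin_elt_subring.
  move=> _ [p Kp ->] Np; have [->|p0] := eqVneq p 0; first by rewrite horner0.
  by exfalso; apply: none; exists p.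
exact: adjoin_elt_sub.
Qed.

(** An element of the residue field outside the image of [K] is algebraic over
    that image, since otherwise any preimage could be adjoined to [K].  Newton's
    method moves the preimage to an exact root of the minimal polynomial, and
    this root can be adjoined. *)
Lemma maximal_lift_surj r : exists2 x, K x & N x = r.
Proof.
have [x Nx] := N_surj r.
have [Kx|nKx] := pselect (K x); first by exists x.
pose P n := `[< exists p, [/\ coefs_in K p, p != 0, N p.[x] = 0 & size p = n] >].
have exP : exists n, P n.
  have [p [Kp p0 Np]] := adjoin_elt_not_lift nKx.
  by exists (size p); apply/asboolP; exists p.
case: (ex_minnP exP) => s /asboolP[p [Kp p0 Np sp]] min_s.
have minp q : coefs_in K q -> (size q < size p)%N -> N q.[x] = 0 -> q = 0.
  move=> Kq qp Nq; apply: contraTeq qp => q0; rewrite -leqNgt sp.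
  by apply: min_s; apply/asboolP; exists q.
have Ninj y : K y -> y != 0 -> N y != 0 by move=> Ky; apply: contra_neq => /(injK Ky).
have Nl : N (lead_coef p) != 0 by apply: Ninj; rewrite ?lead_coef_eq0//; exact: Kp.
have sp_gt1 : (1 < size p)%N.
  rewrite ltnNge; apply/negP => /size1_polyC pC.
  move: Np; rewrite pC hornerC => Np0.
  by move: p0; rewrite pC (injK (Kp 0%N) Np0) eqxx.
have Nd : N p^`().[x] != 0.
  apply/negP => /eqP Nd0.
  have d0 : p^`() = 0.
    by apply: minp => //; [exact: coefs_in_deriv | rewrite lt_size_deriv].
  have := coef_deriv p (size p).-2; rewrite d0 coef0.
  have -> : ((size p).-2.+1 = (size p).-1)%N by rewrite -subn2 -subSn// subn2.
  move/(congr1 N)/eqP; rewrite rmorph0 rmorphMn /= eq_sym mulrn_eq0.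
  by rewrite (negPf Nl) orbF -subn1 subn_eq0 leqNgt sp_gt1.
have [y dy] := lift_unit Nd.
pose h := - (p.[x] * y); have Nh : N h = 0 by rewrite rmorphN rmorphM Np mul0r oppr0.
have Nxh : N (x + h) = r by rewrite rmorphD Nh addr0.
have px' : p.[x + h] = 0.
  rewrite (horner_square_zero p x (N_square_zero Nh Nh)).
  by rewrite [h]/(- (p.[x] * y)) mulrN mulrCA dy mulr1 subrr.
exists (x + h) => //.
apply: (maxK (L := adjoin_elt K (x + h))); last exact: adjoin_elt_self.
  split; first exact: adjoin_elt_subring.
  have Neq q : N q.[x + h] = N q.[x].
    by rewrite -!horner_map rmorphD /= Nh addr0.
  move=> _ [q Kq ->]; rewrite Neq.
  have [l ll] := lift_unit Nl.
  have Kl : K l by apply: maximal_lift_inv ll => //; exact: Kp.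
  have [n] := ubnP (size q); elim: n q Kq => // n IH q Kq; rewrite ltnS => qn Nq.
  have [qp|pq] := ltnP (size q) (size p).
    by rewrite (minp q Kq qp Nq) horner0.
  pose c := (lead_coef q * l)%:P * p * 'X^(size q - size p).
  have Kc : coefs_in K c.
    apply: coefs_inMXn => //; apply: coefs_inM => //; apply: coefs_inC => //.
    by apply: ss_mul => //; exact: Kq.
  have c0 : c.[x + h] = 0 by rewrite !hornerE px'; ring.
  have Nc : N c.[x] = 0 by rewrite -Neq c0 rmorph0.
  have q0 : (0 < size q)%N by rewrite (leq_trans _ pq)// ltnW.
  have qc : (size (q - c)%R < size q)%N.
    rewrite -[X in (_ < X)%N](prednK q0) ltnS; apply/leq_sizeP => j jq.
    rewrite coefB coefMXn coefCM.
    have -> : (j < size q - size p)%N = false.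
      apply/negbTE; rewrite -leqNgt; apply: leq_trans jq.
      by rewrite -subn1 leq_sub2l// ltnW.
    move: jq; rewrite leq_eqVlt => /orP[/eqP <-|jq].
      have -> : ((size q).-1 - (size q - size p) = (size p).-1)%N.
        by rewrite -subn1 subnAC subKn// subn1.
      by rewrite -[p`__]/(lead_coef p) -mulrA [l * _]mulrC ll mulr1 subrr.
    rewrite prednK// in jq.
    rewrite [q`_j]nth_default// [p`__]nth_default ?mulr0 ?subrr//.
    by rewrite leq_subRL ?subnK//; exact: leq_trans (leq_subr _ _) jq.
  have := IH (q - c) (coefs_inB sK Kq Kc) (leq_trans qc qn).
  by rewrite !hornerD !hornerN rmorphB Nq Nc subrr c0 subr0; apply.
exact: adjoin_elt_sub.
Qed.

End Maximal.

(** A section of [N], as in Cohen's structure theorem. *)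
Theorem coefficient_field K0 : lifts_injectively K0 ->
  exists K, [/\ K0 `<=` K, lifts_injectively K & forall r, exists2 x, K x & N x = r].
Proof.
move=> /maximal_lift[K [K0K gK maxK]].
by exists K; split => // r; exact: maximal_lift_surj.
Qed.

End CoefficientField.

(** * Extending a derivation *)

Section DerivationExtension.
Local Open Scope quotient_scope.
Variables (R : realType) (S : comPzSemiRingType).
Variable phi : {rmorphism S -> nnreal R}.
Variable delta : S -> S -> R.
Implicit Types (a b c e : S).

Local Notation N a := ((phi a)%:num).

Hypothesis delta_add : forall a b c e, N a = N b -> N c = N e ->
  delta (a + c) (b + e) = delta a b + delta c e.
Hypothesis delta_mul : forall c a b, N a = N b ->
  delta (c * a) (c * b) = N c * delta a b.
Hypothesis delta_refl : forall a, delta a a = 0.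

Let N0 : N 0 = 0. Proof. by rewrite rmorph0. Qed.
Let N1 : N 1 = 1. Proof. by rewrite rmorph1. Qed.
Let ND a b : N (a + b) = N a + N b. Proof. by rewrite rmorphD. Qed.
Let NM a b : N (a * b) = N a * N b. Proof. by rewrite rmorphM. Qed.

Lemma delta_anti a b : N a = N b -> delta b a = - delta a b.
Proof.
move=> ab; have := delta_add ab (esym ab).
by rewrite [b + a]addrC delta_refl; lra.
Qed.

(** The triple [(b, c, t)] stands for [b - c + t * epsilon] with
    [epsilon ^+ 2 = 0]. *)
Definition formal_diff : Type := (S * S * R)%type.
Implicit Types (w x y : formal_diff).

HB.instance Definition _ := Choice.on formal_diff.

Definition fd_value w : R := N w.1.1 - N w.1.2.
(** On triples of value zero, the coefficient of the infinitesimal unit that they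
    represent; [delta] tells how much of it [b - c] contributes. *)
Definition fd_residual w : R := delta w.1.2 w.1.1 + w.2.
Definition fd_add w x : formal_diff := (w.1.1 + x.1.1, w.1.2 + x.1.2, w.2 + x.2).
Definition fd_opp w : formal_diff := (w.1.2, w.1.1, - w.2).
Definition fd_mul w x : formal_diff :=
  (w.1.1 * x.1.1 + w.1.2 * x.1.2, w.1.1 * x.1.2 + w.1.2 * x.1.1,
   fd_value w * x.2 + fd_value x * w.2).

Definition fd_eqv w x : bool :=
  (fd_value w == fd_value x) && (fd_residual (fd_add w (fd_opp x)) == 0).

Lemma fd_eqvP w x : reflect
  (N w.1.1 + N x.1.2 = N w.1.2 + N x.1.1 /\
   delta (w.1.2 + x.1.1) (w.1.1 + x.1.2) + (w.2 - x.2) = 0) (fd_eqv w x).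
Proof.
apply: (iffP andP) => -[H1 H2]; split; [|exact/eqP| |exact/eqP].
  by move/eqP: H1; rewrite /fd_value; lra.
by apply/eqP; rewrite /fd_value; lra.
Qed.

Lemma fd_refl : reflexive fd_eqv.
Proof.
by move=> w; apply/fd_eqvP; split; [lra | rewrite [w.1.2 + _]addrC delta_refl subrr addr0].
Qed.

Lemma fd_sym : symmetric fd_eqv.
Proof.
move=> w x; apply/fd_eqvP/fd_eqvP => -[H1 H2]; split; try lra.
  by rewrite [x.1.2 + _]addrC [x.1.1 + _]addrC delta_anti ?ND; lra.
by rewrite [w.1.2 + _]addrC [w.1.1 + _]addrC delta_anti ?ND; lra.
Qed.

Lemma fd_trans : transitive fd_eqv.
Proof.
move=> x w y /fd_eqvP[H1 H2] /fd_eqvP[G1 G2]; apply/fd_eqvP; split; first by lra.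
have e1 : N (w.1.2 + x.1.1) = N (w.1.1 + x.1.2) by rewrite !ND; lra.
have e2 : N (x.1.2 + y.1.1) = N (x.1.1 + y.1.2) by rewrite !ND; lra.
have e3 : N (w.1.2 + y.1.1) = N (w.1.1 + y.1.2) by rewrite !ND; lra.
have e4 : N (x.1.2 + x.1.1) = N (x.1.1 + x.1.2) by rewrite !ND; lra.
have E1 := delta_add e1 e2; have E2 := delta_add e3 e4.
have c1 : w.1.2 + x.1.1 + (x.1.2 + y.1.1) = w.1.2 + y.1.1 + (x.1.2 + x.1.1) by ring.
have c2 : w.1.1 + x.1.2 + (x.1.1 + y.1.2) = w.1.1 + y.1.2 + (x.1.1 + x.1.2) by ring.
have z : delta (x.1.2 + x.1.1) (x.1.1 + x.1.2) = 0 by rewrite addrC delta_refl.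
by rewrite c1 c2 E2 z in E1; lra.
Qed.

Canonical fd_equiv := EquivRel fd_eqv fd_refl fd_sym fd_trans.

Definition diff_ring := {eq_quot fd_eqv}.
HB.instance Definition _ : EqQuotient _ fd_eqv diff_ring := EqQuotient.on diff_ring.
HB.instance Definition _ := Choice.on diff_ring.

Local Notation pi := (\pi_diff_ring).

Lemma pi_eqP w x : reflect (pi w = pi x) (fd_eqv w x).
Proof. by apply: (iffP idP) => [h|/eqmodP]; [exact/eqmodP|]. Qed.

Let eqv_repr w : fd_eqv (repr (pi w)) w.
Proof. by apply/pi_eqP; rewrite reprK. Qed.

Lemma fd_add_eqv w x w' x' : fd_eqv w w' -> fd_eqv x x' ->
  fd_eqv (fd_add w x) (fd_add w' x').
Proof.
move=> /fd_eqvP[H1 H2] /fd_eqvP[G1 G2]; apply/fd_eqvP; rewrite /= !ND.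
split; first by lra.
have e1 : N (w.1.2 + w'.1.1) = N (w.1.1 + w'.1.2) by rewrite !ND; lra.
have e2 : N (x.1.2 + x'.1.1) = N (x.1.1 + x'.1.2) by rewrite !ND; lra.
have E := delta_add e1 e2.
by rewrite addrACA [X in delta _ X]addrACA E; lra.
Qed.

Lemma fd_opp_eqv w w' : fd_eqv w w' -> fd_eqv (fd_opp w) (fd_opp w').
Proof.
move=> /fd_eqvP[H1 H2]; apply/fd_eqvP; rewrite /=; split; first by lra.
by rewrite delta_anti ?ND; lra.
Qed.

Lemma fd_mulC w x : fd_mul w x = fd_mul x w.
Proof. by rewrite /fd_mul; congr (_, _, _); ring. Qed.

Lemma fd_mul_eqv w x w' x' : fd_eqv w w' -> fd_eqv x x' ->
  fd_eqv (fd_mul w x) (fd_mul w' x').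
Proof.
have half y y' z : fd_eqv y y' -> fd_eqv (fd_mul y z) (fd_mul y' z).
  move=> /fd_eqvP[H1 H2]; apply/fd_eqvP; rewrite /= !ND !NM.
  have v : fd_value y = fd_value y' by rewrite /fd_value; lra.
  split.
    have -> : N y.1.1 = N y.1.2 + N y'.1.1 - N y'.1.2 by lra.
    by ring.
  have e1 : N (y.1.2 + y'.1.1) = N (y.1.1 + y'.1.2) by rewrite !ND; lra.
  have E1 := delta_mul z.1.1 e1; have E2 := delta_mul z.1.2 (esym e1).
  have n1 : N (z.1.1 * (y.1.2 + y'.1.1)) = N (z.1.1 * (y.1.1 + y'.1.2)).
    by rewrite !(NM z.1.1) e1.
  have n2 : N (z.1.2 * (y.1.1 + y'.1.2)) = N (z.1.2 * (y.1.2 + y'.1.1)).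
    by rewrite !(NM z.1.2) e1.
  have E := delta_add n1 n2.
  have -> : y.1.1 * z.1.2 + y.1.2 * z.1.1 + (y'.1.1 * z.1.1 + y'.1.2 * z.1.2) =
    z.1.1 * (y.1.2 + y'.1.1) + z.1.2 * (y.1.1 + y'.1.2) by ring.
  have -> : y.1.1 * z.1.1 + y.1.2 * z.1.2 + (y'.1.1 * z.1.2 + y'.1.2 * z.1.1) =
    z.1.1 * (y.1.1 + y'.1.2) + z.1.2 * (y.1.2 + y'.1.1) by ring.
  rewrite E E1 E2 (delta_anti e1) v.
  have -> : delta (y.1.2 + y'.1.1) (y.1.1 + y'.1.2) = y'.2 - y.2 by lra.
  by rewrite [fd_value z]/fd_value; ring.
move=> ww xx; apply: fd_trans (half w w' x ww) _.
by rewrite ![fd_mul w' _]fd_mulC; exact: half.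
Qed.

Definition dr_zero : diff_ring := pi (0, 0, 0).
Definition dr_one : diff_ring := pi (1, 0, 0).
Definition dr_add (x y : diff_ring) : diff_ring := pi (fd_add (repr x) (repr y)).
Definition dr_opp (x : diff_ring) : diff_ring := pi (fd_opp (repr x)).
Definition dr_mul (x y : diff_ring) : diff_ring := pi (fd_mul (repr x) (repr y)).

Lemma dr_addE w x : dr_add (pi w) (pi x) = pi (fd_add w x).
Proof. by apply/pi_eqP/fd_add_eqv; exact: eqv_repr. Qed.
Lemma dr_oppE w : dr_opp (pi w) = pi (fd_opp w).
Proof. by apply/pi_eqP/fd_opp_eqv; exact: eqv_repr. Qed.
Lemma dr_mulE w x : dr_mul (pi w) (pi x) = pi (fd_mul w x).
Proof. by apply/pi_eqP/fd_mul_eqv; exact: eqv_repr. Qed.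

Lemma dr_addA : associative dr_add.
Proof.
elim/quotW=> x; elim/quotW=> y; elim/quotW=> z.
rewrite (dr_addE y z) (dr_addE x) (dr_addE x y) dr_addE.
by congr (pi _); rewrite /fd_add /=; congr (_, _, _); rewrite addrA.
Qed.
Lemma dr_addC : commutative dr_add.
Proof.
elim/quotW=> x; elim/quotW=> y; rewrite !dr_addE; congr (pi _).
by rewrite /fd_add; congr (_, _, _); rewrite addrC.
Qed.
Lemma dr_add0 : left_id dr_zero dr_add.
Proof.
elim/quotW=> -[[a b] t]; rewrite /dr_zero !dr_addE; congr (pi _).
by rewrite /fd_add /= !add0r.
Qed.
Lemma dr_addN : left_inverse dr_zero dr_opp dr_add.
Proof.
elim/quotW=> x; rewrite dr_oppE dr_addE; apply/pi_eqP/fd_eqvP; rewrite /= !ND N0.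
by split; [lra | rewrite !addr0 [x.1.1 + _]addrC delta_refl; lra].
Qed.
HB.instance Definition _ :=
  GRing.isZmodule.Build diff_ring dr_addA dr_addC dr_add0 dr_addN.

Lemma dr_mulA : associative dr_mul.
Proof.
elim/quotW=> x; elim/quotW=> y; elim/quotW=> z.
rewrite (dr_mulE y z) (dr_mulE x) (dr_mulE x y) dr_mulE.
congr (pi _); rewrite /fd_mul /=; congr (_, _, _); try ring.
by rewrite /fd_value /= !ND !NM; ring.
Qed.
Lemma dr_mulC : commutative dr_mul.
Proof. by elim/quotW=> x; elim/quotW=> y; rewrite !dr_mulE fd_mulC. Qed.
Lemma dr_mul1 : left_id dr_one dr_mul.
Proof.
elim/quotW=> -[[a b] t]; rewrite /dr_one !dr_mulE; congr (pi _).
rewrite /fd_mul /= /fd_value /= N1 N0 !mul0r !mul1r !addr0.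
by congr (_, _, _); ring.
Qed.
Lemma dr_mulD : left_distributive dr_mul dr_add.
Proof.
elim/quotW=> x; elim/quotW=> y; elim/quotW=> z.
rewrite (dr_addE x y) (dr_mulE (fd_add x y)) (dr_mulE x z) (dr_mulE y z) dr_addE.
congr (pi _); rewrite /fd_mul /fd_add /=; congr (_, _, _); try ring.
by rewrite /fd_value /= !ND; ring.
Qed.
Lemma dr_one_neq0 : dr_one != dr_zero.
Proof.
by apply/eqP => /pi_eqP/fd_eqvP[]; rewrite /= N1 N0; lra.
Qed.
HB.instance Definition _ :=
  GRing.Zmodule_isComNzRing.Build diff_ring dr_mulA dr_mulC dr_mul1 dr_mulD dr_one_neq0.

Definition dr_value (x : diff_ring) : R := fd_value (repr x).

Lemma dr_valueE w : dr_value (pi w) = fd_value w.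
Proof. by have /fd_eqvP[H _] := eqv_repr w; rewrite /dr_value /fd_value; lra. Qed.

Lemma dr_value_additive : zmod_morphism dr_value.
Proof.
elim/quotW=> x; elim/quotW=> y.
rewrite -[pi x - pi y]/(dr_add (pi x) (dr_opp (pi y))) dr_oppE dr_addE !dr_valueE.
by rewrite /fd_value /= !ND; ring.
Qed.
Lemma dr_value_monoid : monoid_morphism dr_value.
Proof.
split; first by rewrite [LHS]dr_valueE /fd_value /= N0 N1 subr0.
elim/quotW=> x; elim/quotW=> y.
rewrite -[pi x * pi y]/(dr_mul (pi x) (pi y)) dr_mulE !dr_valueE.
by rewrite /fd_value /= !ND !NM; ring.
Qed.
HB.instance Definition _ :=
  GRing.isZmodMorphism.Build diff_ring R dr_value dr_value_additive.
HB.instance Definition _ :=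
  GRing.isMonoidMorphism.Build diff_ring R dr_value dr_value_monoid.

Definition dr_residual (x : diff_ring) : R := fd_residual (repr x).

Lemma dr_residualE w : fd_value w = 0 -> dr_residual (pi w) = fd_residual w.
Proof.
move=> w0; have /fd_eqvP[H1 H2] := eqv_repr w.
rewrite /dr_residual; move: (repr _) H1 H2 => x H1 H2.
rewrite /fd_value in w0; rewrite /fd_residual.
have e1 : N x.1.2 = N x.1.1 by lra.
have e2 : N w.1.1 = N w.1.2 by lra.
by have := delta_add e1 e2; rewrite (@delta_anti w.1.2 w.1.1) //; lra.
Qed.


Let addE w x : pi w + pi x = pi (fd_add w x). Proof. exact: dr_addE. Qed.
Let oppE w : - pi w = pi (fd_opp w). Proof. exact: dr_oppE. Qed.
Let mulE w x : pi w * pi x = pi (fd_mul w x). Proof. exact: dr_mulE. Qed.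
Let zeroE : 0 = pi (0, 0, 0). Proof. by []. Qed.
Local Notation V := (dr_value : {rmorphism diff_ring -> R}).

Lemma dr_residualD (x y : diff_ring) : dr_value x = 0 -> dr_value y = 0 ->
  dr_residual (x + y) = dr_residual x + dr_residual y.
Proof.
elim/quotW: x => x; elim/quotW: y => y; rewrite !dr_valueE => x0 y0.
rewrite addE !dr_residualE//; last first.
  by move: x0 y0; rewrite /fd_value /= !ND; lra.
rewrite /fd_residual /= delta_add; first by ring.
  by move: x0; rewrite /fd_value; lra.
by move: y0; rewrite /fd_value; lra.
Qed.

Lemma dr_residualM (x y : diff_ring) : dr_value y = 0 ->
  dr_residual (x * y) = dr_value x * dr_residual y.
Proof.
elim/quotW: x => x; elim/quotW: y => y; rewrite !dr_valueE => y0.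
rewrite mulE !dr_residualE//; last first.
  move: y0; rewrite /fd_value /= !ND !NM => y0.
  have -> : N y.1.1 = N y.1.2 by lra.
  by ring.
have e : N y.1.2 = N y.1.1 by move: y0; rewrite /fd_value; lra.
rewrite /fd_residual /= y0 delta_add ?NM ?e// !delta_mul// (delta_anti e).
by rewrite /fd_value; ring.
Qed.

Lemma dr_square_zero (x y : diff_ring) : dr_value x = 0 -> dr_value y = 0 -> x * y = 0.
Proof.
move=> x0 y0; have := dr_residualM x y0; rewrite x0 mul0r.
have : dr_value (x * y) = 0 by rewrite (rmorphM V) /= x0 mul0r.
move: (x * y) => z {x y x0 y0}; elim/quotW: z => z; rewrite dr_valueE => z0.
rewrite dr_residualE// zeroE => r0; apply/pi_eqP/fd_eqvP => /=.
move: z0 r0; rewrite /fd_value /fd_residual N0 !addr0 => z0 r0.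
by split; lra.
Qed.

Hypothesis N_surj : forall r : R, 0 < r -> exists a, N a = r.

Lemma dr_value_surj r : exists x : diff_ring, dr_value x = r.
Proof.
have [r0|r0|->] := ltgtP r 0; last by exists 0; rewrite (rmorph0 V).
- have [a ha] := @N_surj (- r) ltac:(by rewrite oppr_gt0).
  by exists (pi (0, a, 0)); rewrite dr_valueE /fd_value /= N0 ha; lra.
- have [a ha] := N_surj r0.
  by exists (pi (a, 0, 0)); rewrite dr_valueE /fd_value /= N0 ha; lra.
Qed.

(** In the ring of differences, every [a] has the same value as some element
    [s (N a)] of a coefficient field [K], and the residual of their difference is
    a derivation in [a].  It vanishes on [Z] when [K] contains [Z]. *)
Theorem derivation_extension (Z : S -> Prop) :
  Z 0 -> Z 1 -> (forall a b, Z a -> Z b -> Z (a + b)) ->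
  (forall a b, Z a -> Z b -> Z (a * b)) ->
  (forall a b, Z a -> Z b -> N a = N b -> delta a b = 0) ->
  exists D : {additive S -> R},
  [/\ forall a b, D (a * b) = N a * D b + D a * N b,
      forall a b, N a = N b -> D b - D a = delta a b &
      forall a, Z a -> D a = 0].
Proof.
move=> Z0 Z1 ZD ZM Zinj.
pose K0 : set diff_ring := [set x : diff_ring | exists a b, [/\ Z a, Z b & x = pi (a, b, 0)]].
have [|K [K0K [sK injK] K_surj]] :=
  @coefficient_field _ _ V dr_value_surj dr_square_zero K0.
  split; first split.
  - by exists 1, 0; split.
  - move=> _ _ [a [b [Za Zb ->]]] [a' [b' [Za' Zb' ->]]].
    exists (a + b'), (b + a'); split; rewrite ?oppE ?addE; try exact: ZD.
    by rewrite /fd_add /= oppr0 addr0.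
  - move=> _ _ [a [b [Za Zb ->]]] [a' [b' [Za' Zb' ->]]].
    exists (a * a' + b * b'), (a * b' + b * a'); split; try by apply: ZD; exact: ZM.
    by rewrite mulE /fd_mul /= !mulr0 addr0.
  - move=> _ [a [b [Za Zb ->]]]; rewrite /= dr_valueE /fd_value /= => ab.
    rewrite zeroE; apply/pi_eqP/fd_eqvP; rewrite /= N0 !addr0.
    by split; [lra | rewrite Zinj ?subrr ?addr0//; lra].
pose inj a := pi (a, 0, 0).
have injV a : V (inj a) = N a by rewrite /= dr_valueE /fd_value /= N0 subr0.
have injD a b : inj (a + b) = inj a + inj b by rewrite addE /fd_add /= !addr0.
have injM a b : inj (a * b) = inj a * inj b.
  by rewrite mulE /fd_mul /= /fd_value /= !mulr0 !mul0r !addr0.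
have /choice[s sP] r : exists x : diff_ring, K x /\ V x = r.
  by have [x Kx Vx] := K_surj r; exists x.
have sK' r : K (s r) by case: (sP r).
have sV r : V (s r) = r by case: (sP r).
have s_unique r (x : diff_ring) : K x -> V x = r -> x = s r.
  move=> Kx Vx; apply/eqP; rewrite -subr_eq0; apply/eqP/injK.
    by apply: ss_sub.
  by rewrite rmorphB Vx sV subrr.
have sD r r' : s (r + r') = s r + s r'.
  by apply/esym/s_unique; [exact: ss_add | rewrite rmorphD !sV].
have sM r r' : s (r * r') = s r * s r'.
  by apply/esym/s_unique; [exact: ss_mul | rewrite rmorphM !sV].
pose D a : R := dr_residual (inj a - s (N a)).
have D0 a : V (inj a - s (N a)) = 0 by rewrite rmorphB injV sV subrr.
have Dnmod : nmod_morphism D.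
  split.
    rewrite /D N0 (_ : s 0 = 0) ?subr0.
      by rewrite dr_residualE ?/fd_residual/= ?delta_refl ?addr0// /fd_value /= subrr.
    by apply/esym/s_unique; [exact: ss_zero | exact: rmorph0].
  move=> a b; rewrite /D ND injD sD opprD addrACA.
  exact: (dr_residualD (D0 a) (D0 b)).
pose Dm := GRing.isNmodMorphism.Build S R D Dnmod.
exists (HB.pack D Dm : {additive S -> R}) => /=; split.
- move=> a b; rewrite /D NM injM sM.
  have -> : inj a * inj b - s (N a) * s (N b) =
    inj a * (inj b - s (N b)) + s (N b) * (inj a - s (N a)) by ring.
  have z1 : V (inj a * (inj b - s (N b))) = 0 by rewrite rmorphM D0 mulr0.
  have z2 : V (s (N b) * (inj a - s (N a))) = 0 by rewrite rmorphM D0 mulr0.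
  rewrite (dr_residualD z1 z2) (dr_residualM _ (D0 b)) (dr_residualM _ (D0 a)).
  rewrite -[dr_value (inj a)]/(V _) -[dr_value (s _)]/(V _) injV sV.
  by rewrite [X in _ + X]mulrC.
- move=> a b ab; rewrite /D.
  have -> : inj b - s (N b) = (inj b - inj a) + (inj a - s (N a)) by rewrite ab; ring.
  have v0 : V (inj b - inj a) = 0 by rewrite rmorphB !injV ab subrr.
  rewrite (dr_residualD v0 (D0 a)) addrK /inj oppE addE dr_residualE.
    by rewrite /fd_residual /= addr0 add0r subrr addr0.
  by rewrite /fd_value /= !ND !N0 ab; lra.
- move=> a Za; rewrite /D (_ : inj a = s (N a)) ?subrr.
    by rewrite dr_residualE ?/fd_residual/= ?delta_refl ?addr0// /fd_value /= subrr.
  by apply: s_unique => //; apply: K0K; exists a, 0.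
Qed.

End DerivationExtension.

(** * Affine valuations and their derivations *)

Section Arctic.
Variables (R : realType) (S : comPzSemiRingType) (d : nat).
Variable nrm : {rmorphism S -> posvec R d}.
Hypothesis nrm_ker : forall a, nrm a = 0 -> a = 0.
Hypothesis nrm_surj : forall v : posvec R d, exists a : S, nrm a = v.
Implicit Types (a b c p q r : S).

Ltac nonzero := nonzero_with nrm_ker.
Let neq0 := nrm_eq_neq0 nrm_ker.

Variables (lam : S -> R) (u : S).
Hypothesis vl : valuation nrm lam.
Hypothesis nrm_u : nrm u = nrm 1.
Hypothesis lam_u : lam u = lam 1 + 1.
Hypothesis arctic : lam (u * 1 + u * 1) = lam (u ^+ 2 + 1 ^+ 2).

Let vlN := valuation_opp nrm_ker vl.
Let one0 : (1 : S) != 0. Proof. by nonzero. Qed.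
Let u0 : u != 0. Proof. by apply: (neq0 (esym nrm_u)). Qed.
Local Notation loss := (mix_loss lam).

Lemma lossN p q v w i : mix_loss (fun a => - lam a) p q v w i = - loss p q v w i.
Proof. by rewrite /mix_loss opprB opprK addrC. Qed.

(** Applying [loss_concave] to [lam] and to [- lam] turns concavity into equality. *)
Lemma loss_affine p q v w n : p != 0 -> q != 0 -> v != 0 -> nrm v = nrm w ->
  lam (v * w + v * w) = lam (v ^+ 2 + w ^+ 2) ->
  loss p q v w n = n%:R * loss p q v w 1.
Proof.
move=> p0 q0 v0 vw eta.
have second i : loss p q v w i + loss p q v w i.+2 = 2%:R * loss p q v w i.+1.
  apply/le_anti/andP; split.
    by apply: (loss_concave nrm_ker vl); rewrite ?eta.
  have := @loss_concave _ _ _ _ nrm_ker _ vlN p q v w p0 q0 v0 vw _ i.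
  by rewrite eta lexx !lossN => /(_ isT); lra.
suff : loss p q v w n = n%:R * loss p q v w 1 /\
       loss p q v w n.+1 = n.+1%:R * loss p q v w 1 by case.
elim: n => [|n [IH1 IH2]]; first by rewrite loss0 mul0r mul1r.
split=> //; have := second n; rewrite IH1 IH2 -[n.+2%:R]natr1 -[n.+1%:R]natr1.
by lra.
Qed.

(** [weight p q] is the weight [q / (p + q)] with which [q] enters the sum
    [p + q], as seen by the valuation. *)
Definition weight p q := lam (p + q * u) - lam (p + q).

Lemma weight_pow p q n : p != 0 -> q != 0 ->
  lam (p + q * u ^+ n) - lam (p + q) = n%:R * weight p q.
Proof.
move=> p0 q0; have := @loss_affine p q u 1 n p0 q0 u0 nrm_u arctic.
by rewrite /mix_loss !expr1n !mulr1 expr1 /weight; lra.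
Qed.

Lemma weight_ge0 p q : q != 0 -> 0 <= weight p q.
Proof.
move=> q0; rewrite subr_ge0.
have := val_mul vl q0 one0 (esym nrm_u); rewrite mulr1 lam_u => E.
by apply: (val_add vl) => //; [rewrite rmorphM nrm_u rmorph1 mulr1 | lra].
Qed.

(** Since [u ^+ 2 + 1] is equivalent to [u + u], the product
    [(p + q * u) * (q + p * u)] is equivalent to [(p + q) ^+ 2 * u]. *)
Lemma weight_sum p q : p != 0 -> q != 0 -> weight p q + weight q p = 1.
Proof.
move=> p0 q0; rewrite /weight.
have pq0 : p + q != 0 by nonzero.
have e1 : nrm (p + q) = nrm (p + q * u) by rewrite !rmorphD rmorphM nrm_u rmorph1 mulr1.
have e2 : nrm (p + q) = nrm (q + p * u).
  by rewrite !rmorphD rmorphM nrm_u rmorph1 mulr1 addrC.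
have E := val_prod nrm_ker vl pq0 pq0 e1 e2.
have pqpq0 : (p + q) * (p + q) != 0 by nonzero.
have E' := val_mul vl pqpq0 one0 (esym nrm_u).
have X0 : u * 1 + u * 1 != 0 by nonzero.
have nX : nrm (u * 1 + u * 1) = nrm (u ^+ 2 + 1 ^+ 2).
  by rewrite !expr2 !rmorphD !rmorphM nrm_u.
have pq'0 : p * q != 0 by nonzero.
have E3 := val_mul vl pq'0 X0 nX.
have nX' : nrm (p * q * (u * 1 + u * 1)) = nrm (p * q * (u ^+ 2 + 1 ^+ 2)).
  by rewrite !(rmorphM nrm (p * q)) nX.
have L0 : p * q * (u * 1 + u * 1) != 0 by nonzero.
have L'0 : p * q * (u ^+ 2 + 1 ^+ 2) != 0 := neq0 nX' L0.
have le1 : lam (p * q * (u * 1 + u * 1)) <= lam (p * q * (u ^+ 2 + 1 ^+ 2)).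
  by move: E3; rewrite arctic; lra.
have le2 : lam (p * q * (u ^+ 2 + 1 ^+ 2)) <= lam (p * q * (u * 1 + u * 1)).
  by move: E3; rewrite arctic; lra.
have := val_add vl ((p * p + q * q) * u) L0 nX' le1.
have := val_add vl ((p * p + q * q) * u) L'0 (esym nX') le2.
have -> : (p * p + q * q) * u + p * q * (u * 1 + u * 1) = (p + q) * (p + q) * u by ring.
have -> : (p * p + q * q) * u + p * q * (u ^+ 2 + 1 ^+ 2) =
  (p + q * u) * (q + p * u) by ring.
by rewrite mulr1 lam_u [q + p]addrC in E E' *; lra.
Qed.

Let sandwich p q a b n : p != 0 -> q != 0 -> a != 0 -> nrm a = nrm b ->
  lam b <= lam a ->
  `|loss p q a b n + n%:R * (lam a - lam b) * weight p q| <= weight p q.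
Proof.
move=> p0 q0 a0 ab ba; have b0 := neq0 ab a0.
pose t := n%:R * (lam a - lam b).
have t0 : 0 <= t by rewrite mulr_ge0// subr_ge0.
pose m := Num.truncn t.
have mt : m%:R <= t by rewrite truncn_le.
have tm : t < m.+1%:R by exact: truncnS_gt.
have En := val_exp nrm_ker vl n b0 (esym ab); rewrite -/t in En.
have Eu k := val_exp nrm_ker vl k one0 (esym nrm_u).
have bn0 : b ^+ n != 0 by nonzero.
have nab : nrm (b ^+ n) = nrm (a ^+ n) by rewrite !rmorphXn ab.
have nu k : nrm 1 = nrm (u ^+ k) by rewrite rmorphXn nrm_u rmorph1 expr1n.
have H1 := @val_mix _ _ _ _ nrm_ker _ vl p q 1 (u ^+ m) (b ^+ n) (a ^+ n)
  q0 one0 bn0 (nu m) nab.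
have H2 := @val_mix _ _ _ _ nrm_ker _ vl p q (b ^+ n) (a ^+ n) 1 (u ^+ m.+1)
  q0 bn0 one0 nab (nu m.+1).
have Wm := weight_pow m p0 q0; have Wm1 := weight_pow m.+1 p0 q0.
have := Eu m; have := Eu m.+1; rewrite !expr1n lam_u => Em1 Em.
rewrite !mulr1 in H1 H2.
have {}H1 := H1 ltac:(lra); have {}H2 := H2 ltac:(lra).
have w0 := weight_ge0 p q0.
have T1 : m%:R * weight p q <= t * weight p q by rewrite ler_wpM2r.
have T2 : t * weight p q <= m.+1%:R * weight p q by rewrite ler_wpM2r// ltW.
rewrite -[m.+1%:R]natr1 in Wm1 T2.
by rewrite /mix_loss -/t ler_norml; apply/andP; split; lra.
Qed.

Lemma weight11 : weight 1 1 = 1 / 2%:R.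
Proof. by have := weight_sum one0 one0; lra. Qed.

(** If the two sides differed, the loss for [a] and [b] would be strictly concave
    or convex somewhere, whereas comparison with the powers of [u] shows that
    it is linear up to a bounded error. *)
Lemma arctic_all a b : a != 0 -> nrm a = nrm b ->
  lam (a * b + a * b) = lam (a ^+ 2 + b ^+ 2).
Proof.
move=> a0 ab; have b0 := neq0 ab a0.
wlog ba : a b a0 b0 ab / lam b <= lam a.
  move=> H; have [/H->//|/ltW ba] := leP (lam b) (lam a).
  by have := H b a b0 a0 (esym ab) ba; rewrite [b * a]mulrC [b ^+ 2 + _]addrC.
have sw n := @sandwich 1 1 a b n one0 one0 a0 ab ba; rewrite weight11 in sw.
have two0 : (1 + 1) * b != 0 by nonzero.
have E := val_mul vl two0 b0 (esym ab).
have e1 : (1 + 1) * b * a = a * b + a * b by ring.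
have e2 : (1 + 1) * b * b = (1 + 1) * b ^+ 2 by ring.
have L2 : loss 1 1 a b 2 = lam (a * b + a * b) - lam (a ^+ 2 + b ^+ 2)
    - (lam a - lam b).
  by rewrite /mix_loss !mul1r [b ^+ 2 + _]addrC -e1 -e2; lra.
apply/eqP; rewrite -subr_eq0; apply/eqP.
set eta := lam (a * b + a * b) - lam (a ^+ 2 + b ^+ 2) in L2 *.
have [eta_le|/ltW eta_ge] := leP eta 0.
- apply/le_anti/andP; split=> //; rewrite -oppr_le0.
  apply: (@archi_le0 _ _ 1) => n.
  have := sw (2 * n.+1)%N; rewrite ler_norml => /andP[lo _].
  have := concave_ratio (loss0 lam 1 1 a b)
    (loss_concave nrm_ker vl one0 one0 a0 ab _) (ltn0Sn 1)
    (leq_pmulr 2 (ltn0Sn n)).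
  rewrite -subr_le0 -/eta eta_le => /(_ isT).
  rewrite L2 natrM in lo *.
  have n0 : 0 < 2%:R * n.+1%:R :> R by rewrite mulr_gt0.
  by rewrite ler_pdivrMr//; lra.
- apply/le_anti/andP; split=> //.
  apply: (@archi_le0 _ _ 1) => n.
  have := sw (2 * n.+1)%N; rewrite ler_norml => /andP[_ hi].
  have H := @loss_concave _ _ _ _ nrm_ker _ vlN 1 1 a b one0 one0 a0 ab _.
  have := concave_ratio (loss0 _ 1 1 a b) (H _) (ltn0Sn 1)
    (leq_pmulr 2 (ltn0Sn n)).
  rewrite lerN2 -subr_ge0 -/eta eta_ge !lossN => /(_ isT).
  rewrite L2 natrM in hi *.
  have n0 : 0 < 2%:R * n.+1%:R :> R by rewrite mulr_gt0.
  by rewrite ler_pdivrMr//; lra.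
Qed.

(** Affinity at the powers of [b / a] and approximation of these by powers of [u]. *)
Lemma val_weight p q a b : p != 0 -> q != 0 -> b != 0 -> nrm b = nrm a ->
  lam (p * b + q * a) - lam ((p + q) * b) = weight p q * (lam a - lam b).
Proof.
move=> p0 q0 b0 ba; have a0 := neq0 ba b0.
have main p' q' a' b' : p' != 0 -> q' != 0 -> b' != 0 -> nrm b' = nrm a' ->
    lam b' <= lam a' ->
    lam (p' * b' + q' * a') - lam ((p' + q') * b') = weight p' q' * (lam a' - lam b').
  move=> {p q a b p0 q0 b0 ba a0} p0 q0 b0 ba le; have a0 := neq0 ba b0.
  have sw n := sandwich n p0 q0 a0 (esym ba) le.
  have af n := loss_affine n p0 q0 a0 (esym ba) (arctic_all a0 (esym ba)).
  pose x := loss p' q' a' b' 1 + (lam a' - lam b') * weight p' q'.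
  have x0 n : `|n%:R * x| <= weight p' q'.
    by have := sw n; rewrite af -mulrA -mulrDr.
  suff : x = 0 by rewrite /x /mix_loss !expr1; lra.
  exact: archi_eq0 x0.
have [le|/ltW le] := leP (lam b) (lam a); first exact: main.
have := main q p b a q0 p0 a0 (esym ba) le.
have pq0 : p + q != 0 by nonzero.
have := val_mul vl pq0 b0 ba.
have := weight_sum p0 q0 => ws.
have -> : weight q p = 1 - weight p q by lra.
by rewrite [q + p]addrC [q * a + _]addrC; lra.
Qed.


Lemma weight_scale c p q : c != 0 -> p != 0 -> weight (c * p) (c * q) = weight p q.
Proof.
move=> c0 p0; rewrite /weight -mulrA -!mulrDr; apply: (val_mul vl) => //.
  by nonzero.
by rewrite !rmorphD rmorphM nrm_u rmorph1 mulr1.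
Qed.

(** Changing [p] and [q] within their norm classes changes the value of
    [p + q * u ^+ n] by an amount that is bounded independently of [n]. *)
Lemma weight_nrm p q p' q' : p != 0 -> q != 0 ->
  nrm p = nrm p' -> nrm q = nrm q' -> weight p q = weight p' q'.
Proof.
suff le p1 q1 p2 q2 : p1 != 0 -> q1 != 0 -> nrm p1 = nrm p2 -> nrm q1 = nrm q2 ->
    weight p1 q1 <= weight p2 q2.
  move=> p0 q0 pp qq; have p'0 := neq0 pp p0; have q'0 := neq0 qq q0.
  by apply/le_anti; rewrite !le.
move=> {p q p' q'} p0 q0 pp qq; have p'0 := neq0 pp p0; have q'0 := neq0 qq q0.
pose s := `|lam p1 - lam p2|; pose t := `|lam q1 - lam q2|.
have [s0 t0] : 0 <= s /\ 0 <= t by split; exact: normr_ge0.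
have sE : lam p1 <= lam p2 + s by rewrite /s; case: ger0P; lra.
have tE : lam q1 <= lam q2 + t by rewrite /t; case: ger0P; lra.
rewrite -subr_le0.
apply: (@archi_le0 _ _ (s + t - (lam (p1 + q1) - lam (p2 + q2)))) => n.
rewrite mulrBr -(weight_pow n.+1 p0 q0) -(weight_pow n.+1 p'0 q'0).
have un0 : u ^+ n.+1 != 0 by nonzero.
have E := val_mul vl un0 q0 qq; rewrite ![u ^+ _ * _]mulrC in E.
have X0 : q1 * u ^+ n.+1 != 0 by nonzero.
have nX : nrm (q1 * u ^+ n.+1) = nrm (q2 * u ^+ n.+1) by rewrite !rmorphM qq.
have := val_add_lb nrm_ker vl (t := t) p1 X0 nX t0.
have := val_add_lb nrm_ker vl (t := s) (q2 * u ^+ n.+1) p0 pp s0 sE.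
by rewrite ![q2 * _ + _]addrC => H1 /(_ _) H2; have {}H2 := H2 ltac:(lra); lra.
Qed.

(** Raising [q2] raises [q1 + q2] by [weight q1 q2], and [p + (q1 + q2)] by the
    product of the weights. *)
Lemma weight_chain p q1 q2 : p != 0 -> q1 != 0 -> q2 != 0 ->
  weight (p + q1) q2 = weight p (q1 + q2) * weight q1 q2.
Proof.
move=> p0 q10 q20.
have q0 : q1 + q2 != 0 by nonzero.
have nq : nrm (q1 + q2) = nrm (q1 + q2 * u).
  by rewrite !rmorphD rmorphM nrm_u rmorph1 mulr1.
rewrite {3}/weight -(val_weight p0 q0 q0 nq) /weight.
have e1 : p * (q1 + q2) + (q1 + q2) * (q1 + q2 * u) = (q1 + q2) * (p + q1 + q2 * u).
  by ring.
have e2 : (p + (q1 + q2)) * (q1 + q2) = (q1 + q2) * (p + q1 + q2) by ring.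
rewrite e1 e2; apply/esym/(val_mul vl) => //; first by nonzero.
by rewrite -!addrA !(rmorphD nrm p) nq.
Qed.

Lemma weight_add p q r : p != 0 -> q != 0 -> r != 0 ->
  weight p (q + r) = weight (p + r) q + weight (p + q) r.
Proof.
move=> p0 q0 r0.
have pq0 : p + q != 0 by nonzero.
have npq : nrm (p + q) = nrm (p + q * u).
  by rewrite !rmorphD rmorphM nrm_u rmorph1 mulr1.
rewrite (weight_nrm pq0 r0 npq erefl) /weight.
have -> : p + (q + r) * u = p + q * u + r * u by ring.
have -> : p + r + q * u = p + q * u + r by ring.
have -> : p + r + q = p + (q + r) by ring.
by ring.
Qed.

(** If [weight p q = 0], then the same holds for all multiples of [q], among them
    one with the norm of [p + r]; but [p + r] has at least half of the weight in
    [p + (p + r)]. *)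
Lemma weight_gt0 p q : p != 0 -> q != 0 -> 0 < weight p q.
Proof.
move=> p0 q0; rewrite lt_neqAle weight_ge0// andbT eq_sym; apply/eqP => w0.
have mult n : weight p (n.+1%:R * q) = 0.
  elim: n => [|n IH]; first by rewrite mul1r.
  have nq0 : n.+1%:R * q != 0 by nonzero.
  rewrite -[n.+2%:R]natr1 mulrDl mul1r weight_add//.
  have -> : weight (p + n.+1%:R * q) q = 0.
    by rewrite [p + _]addrC weight_chain// w0 mulr0.
  have -> : weight (p + q) (n.+1%:R * q) = 0.
    by rewrite [p + q]addrC weight_chain// IH mulr0.
  by rewrite addr0.
have [n0 dom] := nrm_dominate nrm_ker nrm_surj q0 p0.
have [r r0 nr] := dom n0 (leqnn _).
have nq0 : n0.+1%:R * q != 0 by nonzero.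
have := mult n0; rewrite (weight_nrm p0 nq0 erefl nr) weight_add//.
have pp0 : p + p != 0 by nonzero.
rewrite [p + r]addrC (weight_chain r0 p0 p0).
have wpp : weight p p = 1 / 2%:R by have := weight_sum p0 p0; lra.
have := weight_sum r0 pp0; have := weight_ge0 r pp0; have := weight_ge0 (p + p) r0.
by rewrite wpp; lra.
Qed.

(** The ratio in which [q] and [1] share the weight in the sum [1 + q]; more
    generally [weight p q] is to [weight q p] as [residue q] is to [residue p],
    which makes [residue] a homomorphism. *)
Definition residue q : R := if q == 0 then 0 else weight 1 q / weight q 1.

Lemma residue0 : residue 0 = 0. Proof. by rewrite /residue eqxx. Qed.

Lemma residueE q : q != 0 -> residue q = weight 1 q / weight q 1.
Proof. by rewrite /residue => /negPf->. Qed.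

Lemma residue_gt0 q : q != 0 -> 0 < residue q.
Proof. by move=> q0; rewrite residueE// divr_gt0// weight_gt0. Qed.

Lemma residue1 : residue 1 = 1.
Proof. by rewrite residueE// divff// gt_eqF// weight_gt0. Qed.

Lemma residue_nrm p q : nrm p = nrm q -> residue p = residue q.
Proof.
move=> pq; have [p0|p0] := eqVneq p 0.
  by move: pq; rewrite p0 rmorph0 => /esym/nrm_ker->.
have q0 := neq0 pq p0; rewrite !residueE//.
by congr (_ / _); apply: weight_nrm.
Qed.

Lemma residue_total p q : p != 0 -> q != 0 ->
  residue q = weight (p + 1) q / weight (p + q) 1.
Proof.
move=> p0 q0.
have q10 : 1 + q != 0 by nonzero.
rewrite residueE// (weight_chain p0 one0 q0) (weight_chain p0 q0 one0).
rewrite [q + 1]addrC -mulf_div divff ?mul1r// gt_eqF// weight_gt0//.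
Qed.

Lemma weight_ratio p q : p != 0 -> q != 0 ->
  weight p q / weight q p = residue q / residue p.
Proof.
move=> p0 q0.
have pq0 : p + q != 0 by nonzero.
have a0 : weight (p + q) 1 != 0 by rewrite gt_eqF// weight_gt0.
rewrite (residue_total p0 q0) (residue_total q0 p0) [q + p]addrC.
rewrite -[RHS]mulf_div mulrC.
have -> : weight (p + 1) q = weight 1 (p + q) * weight p q.
  by rewrite [p + 1]addrC weight_chain.
have -> : weight (q + 1) p = weight 1 (p + q) * weight q p.
  by rewrite [q + 1]addrC weight_chain// [q + p]addrC.
have b0 : weight 1 (p + q) != 0 by rewrite gt_eqF// weight_gt0.
have c0 : weight q p != 0 by rewrite gt_eqF// weight_gt0.
by field; rewrite a0 b0 c0.
Qed.

Lemma residueD p q : residue (p + q) = residue p + residue q.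
Proof.
have [->|p0] := eqVneq p 0; first by rewrite residue0 !add0r.
have [->|q0] := eqVneq q 0; first by rewrite residue0 !addr0.
have pq0 : p + q != 0 by nonzero.
rewrite (residue_total q0 p0) (residue_total p0 q0) residueE// weight_add//.
by rewrite [q + p]addrC -mulrDl ![1 + _]addrC.
Qed.

Lemma residueM p q : residue (p * q) = residue p * residue q.
Proof.
have [->|p0] := eqVneq p 0; first by rewrite mul0r residue0 mul0r.
have [->|q0] := eqVneq q 0; first by rewrite mulr0 residue0 mulr0.
have pq0 : p * q != 0 by nonzero.
have rq : residue q != 0 by rewrite gt_eqF// residue_gt0.
apply: (mulIf (invr_neq0 rq)); rewrite mulfK// -weight_ratio//.
have e1 : weight q (p * q) = weight 1 p.
  by rewrite -(weight_scale p q0 one0) mulr1 mulrC.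
have e2 : weight (p * q) q = weight p 1.
  by rewrite -(weight_scale 1 q0 p0) mulr1 mulrC.
by rewrite e1 e2 residueE.
Qed.

Lemma weightE p q : p != 0 -> q != 0 ->
  weight p q = residue q / residue (p + q).
Proof.
move=> p0 q0; rewrite residueD.
have rp := residue_gt0 p0; have rq := residue_gt0 q0.
have wp := weight_gt0 q0 p0.
have : weight p q = residue q / residue p * weight q p.
  by rewrite -weight_ratio// divfK// gt_eqF.
have := weight_sum p0 q0 => ws; have -> : weight q p = 1 - weight p q by lra.
move=> e; have {}e : weight p q * residue p = residue q * (1 - weight p q).
  by rewrite {1}e; field; rewrite gt_eqF.
apply: (mulIf (lt0r_neq0 (addr_gt0 rp rq))).
by rewrite divfK ?lt0r_neq0 ?addr_gt0//; lra.
Qed.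

Lemma residue_nat n : residue n%:R = n%:R.
Proof. by elim: n => [|n IH]; rewrite ?residue0// -!natr1 residueD IH residue1. Qed.

(** Vectors with all coordinates equal lie between consecutive fractions with
    denominator [n]. *)
Lemma residue_const (c : R) p : 0 < c -> p != 0 -> (forall i, coord nrm i p = c) ->
  residue p = c.
Proof.
move=> c0 p0 pc.
have close n : `|n%:R * (residue p - c)| <= 2%:R.
  pose m := Num.truncn (n%:R * c).
  have nc0 : 0 <= n%:R * c by rewrite mulr_ge0// ltW.
  have lo : m%:R <= n%:R * c by rewrite truncn_le.
  have hi : n%:R * c < m%:R + 1 by rewrite natr1; exact: truncnS_gt.
  have [|r r0 hr] := @coord_surj _ _ _ _ nrm_ker nrm_surj (fun=> n%:R * c + 1 - m%:R).
    by move=> i; lra.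
  have e1 : nrm (n%:R * p + 1) = nrm (m%:R + r).
    apply: (nrm_eqP nrm_ker) => [||i]; [by nonzero|by nonzero|].
    by rewrite !coordD coordM coord1 !coord_nat pc hr; ring.
  have [|r' r'0 hr'] := @coord_surj _ _ _ _ nrm_ker nrm_surj (fun=> m%:R + 1 - n%:R * c).
    by move=> i; lra.
  have e2 : nrm (n%:R * p + r') = nrm (m%:R + 1).
    apply: (nrm_eqP nrm_ker) => [||i]; [by nonzero|by nonzero|].
    by rewrite !coordD coordM coord1 !coord_nat pc hr'; ring.
  have := residue_nrm e1; have := residue_nrm e2.
  rewrite !residueD !residueM residue1 !residue_nat.
  have := residue_gt0 r0; have := residue_gt0 r'0.
  by rewrite ler_norml => *; apply/andP; split; lra.
by apply/eqP; rewrite -subr_eq0; apply/eqP; exact: archi_eq0 close.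
Qed.

Lemma residue_sum (I : finType) (F : I -> S) :
  residue (\sum_i F i) = \sum_i residue (F i).
Proof. exact: (big_morph residue residueD residue0). Qed.

Lemma coord_sum j (I : finType) (F : I -> S) :
  coord nrm j (\sum_i F i) = \sum_i coord nrm j (F i).
Proof. exact: (big_morph (coord nrm j) (coordD nrm j) (coord0 nrm j)). Qed.

(** A character of [R_{>0}^d] is a coordinate: if it differed from the [i]-th
    coordinate at [r i] for each [i], it would vanish on the positive vector
    [\sum_i (r i - residue (r i)) ^+ 2]. *)
Lemma residue_component : exists i, forall p, residue p = coord nrm i p.
Proof.
apply: contrapT => /forallNP none.
have /choice[r hr] i : exists p, residue p <> coord nrm i p.
  by apply/existsNP; exact: none.
have r0 i : r i != 0.
  by apply/eqP => ri; apply: (hr i); rewrite ri residue0 coord0.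
pose c i := residue (r i); have c0 i : 0 < c i by exact: residue_gt0.
have /choice[C hC] i : exists p, p != 0 /\ forall j, coord nrm j p = c i.
  by have [p p0 hp] := coord_surj nrm_ker nrm_surj (fun=> c0 i); exists p.
have [|t t0 ht] := @coord_surj _ _ _ _ nrm_ker nrm_surj
    (fun j => \sum_i (coord nrm j (r i) - c i) ^+ 2).
  move=> j; rewrite (bigD1 j)//= ltr_wpDr ?sumr_ge0// => [i _|]; first exact: sqr_ge0.
  by rewrite lt_neqAle sqr_ge0 andbT eq_sym sqrf_eq0 subr_eq0; apply/eqP => /esym/hr.
have e : nrm (t + 1 + \sum_i (1 + 1) * (C i * r i)) =
         nrm (1 + \sum_i (r i * r i + C i * C i)).
  apply: (nrm_eqP nrm_ker) => [||j]; [by nonzero|by nonzero|].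
  rewrite !coordD !coord_sum coord1 ht addrAC -big_split /= addrC.
  congr (_ + _); apply: eq_bigr => i _; have [_ hCi] := hC i.
  by rewrite !(coordM, coordD, coord1) hCi; ring.
have := residue_nrm e; rewrite !residueD !residue_sum residue1.
have RC i : residue (C i) = c i by have [p0 hp] := hC i; exact: residue_const.
rewrite (eq_bigr (fun i => 2%:R * (c i * c i))); last first.
  by move=> i _; rewrite !(residueM, residueD) residue1 RC -/(c i); ring.
rewrite (eq_bigr (fun i => 2%:R * (c i * c i))
  (F1 := fun i => residue (r i * r i + C i * C i))); last first.
  by move=> i _; rewrite !(residueM, residueD) RC -/(c i); ring.
by have := residue_gt0 t0; lra.
Qed.


(** The value on [b - a] of the derivation with logarithmic derivative [lam], for
    [a] and [b] of equal norm. *)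
Definition variation a b : R := residue a * (lam b - lam a).

Lemma variation_self a : variation a a = 0.
Proof. by rewrite /variation subrr mulr0. Qed.

Lemma variation_anti a b : nrm a = nrm b -> variation b a = - variation a b.
Proof. by move=> ab; rewrite /variation (residue_nrm ab); ring. Qed.

Lemma variation_add a b c e : nrm a = nrm b -> nrm c = nrm e ->
  variation (a + c) (b + e) = variation a b + variation c e.
Proof.
have half a' b' c' : nrm a' = nrm b' -> a' != 0 ->
    residue (c' + a') * (lam (c' + b') - lam (c' + a')) = variation a' b'.
  move=> ab a0; have [->|c0] := eqVneq c' 0; first by rewrite !add0r.
  have ca0 : c' + a' != 0 by nonzero.
  have rca : residue (c' + a') != 0 by rewrite gt_eqF// residue_gt0.
  have := val_weight c0 a0 a0 ab; rewrite weightE//.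
  have -> : c' * a' + a' * b' = a' * (c' + b') by ring.
  have -> : (c' + a') * a' = a' * (c' + a') by ring.
  rewrite (val_mul vl a0 ca0) ?rmorphD ?ab// => ->.
  by rewrite /variation; field.
move=> ab ce.
have [a0|a0] := eqVneq a 0.
  have b0 : b = 0 by apply: nrm_ker; rewrite -ab a0 rmorph0.
  by rewrite a0 b0 !add0r variation_self add0r.
have [c0|c0] := eqVneq c 0.
  have e0 : e = 0 by apply: nrm_ker; rewrite -ce c0 rmorph0.
  by rewrite c0 e0 !addr0 variation_self addr0.
have H1 := half a b c ab a0; have H2 := half c e b ce c0.
have r1 : residue (a + c) = residue (b + c) by apply: residue_nrm; rewrite !rmorphD ab.
by rewrite -H1 -H2 /variation [c + a]addrC [c + b]addrC -r1; ring.
Qed.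

Lemma variation_mul c a b : nrm a = nrm b ->
  variation (c * a) (c * b) = residue c * variation a b.
Proof.
move=> ab; have [->|c0] := eqVneq c 0.
  by rewrite !mul0r variation_self residue0 mul0r.
have [a0|a0] := eqVneq a 0.
  have b0 : b = 0 by apply: nrm_ker; rewrite -ab a0 rmorph0.
  by rewrite a0 b0 mulr0 variation_self mulr0.
by rewrite /variation residueM (val_mul vl)//; ring.
Qed.

(** For [a] and [b] that agree in the [i]-th coordinate only, the product of
    [b - a] with [beta - 1], whose norm is the [i]-th idempotent, is a difference
    of elements of equal norm, and a derivation over the [i]-th coordinate takes
    the same value on it as on [b - a].  This defines [delta]. *)
Theorem arctic_derivation : exists i : 'I_d, forall Z : S -> Prop,
  Z 0 -> Z 1 -> (forall a b, Z a -> Z b -> Z (a + b)) ->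
  (forall a b, Z a -> Z b -> Z (a * b)) ->
  (forall a b, Z a -> Z b -> coord nrm i a = coord nrm i b -> a = b) ->
  exists D : {additive S -> R},
  [/\ forall a b, D (a * b) = coord nrm i a * D b + D a * coord nrm i b,
      forall a b, nrm a = nrm b -> D b - D a = coord nrm i a * (lam b - lam a) &
      forall a, Z a -> D a = 0].
Proof.
have [i resE] := residue_component; exists i => Z Z0 Z1 ZD ZM Zinj.
have [|beta beta0 hbeta] := @coord_surj _ _ _ _ nrm_ker nrm_surj
    (fun j => 1 + (j == i)%:R).
  by move=> j; rewrite ltr_wpDr.
have betai : coord nrm i beta = 2%:R by rewrite hbeta eqxx.
pose delta a b := variation (a * beta + b) (b * beta + a).
have nrm_delta a b : coord nrm i a = coord nrm i b ->
    nrm (a * beta + b) = nrm (b * beta + a).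
  move=> ab; have [a0|a0] := eqVneq a 0.
    have [->|b0] := eqVneq b 0; first by rewrite a0.
    by have := coord_gt0 nrm_ker i b0; rewrite -ab a0 coord0 ltxx.
  have [b0|b0] := eqVneq b 0.
    by have := coord_gt0 nrm_ker i a0; rewrite ab b0 coord0 ltxx.
  apply: (nrm_eqP nrm_ker) => [||j]; [by nonzero|by nonzero|].
  rewrite !coordD !coordM hbeta; have [->|] := eqVneq j i; first by rewrite ab.
  by move=> _; rewrite mulr0n addr0 !mulr1 addrC.
pose phi : {rmorphism S -> nnreal R} := (component i \o nrm : S -> nnreal R).
have phiE a : (phi a)%:num = coord nrm i a by [].
have delta_add a b c e : coord nrm i a = coord nrm i b -> coord nrm i c = coord nrm i e ->
    delta (a + c) (b + e) = delta a b + delta c e.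
  move=> ab ce; rewrite -variation_add; try exact: nrm_delta.
  by rewrite /delta; congr variation; ring.
have delta_mul c a b : coord nrm i a = coord nrm i b ->
    delta (c * a) (c * b) = coord nrm i c * delta a b.
  move=> ab; rewrite -resE -variation_mul; last exact: nrm_delta.
  by rewrite /delta; congr variation; ring.
have delta_self a : delta a a = 0 by exact: variation_self.
have phi_surj (r : R) : 0 < r -> exists a, coord nrm i a = r.
  by move=> r0; have [a _ ha] := coord_surj nrm_ker nrm_surj (fun=> r0); exists a.
have Zdelta a b : Z a -> Z b -> coord nrm i a = coord nrm i b -> delta a b = 0.
  by move=> Za Zb /(Zinj _ _ Za Zb) ->.
have [D [DM DB DZ]] := @derivation_extension R S phi delta
  delta_add delta_mul delta_self phi_surj Z Z0 Z1 ZD ZM Zdelta.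
exists D; split => // a b ab.
have abi := nrm_eq_coord i ab.
rewrite DB// /delta variation_add ?rmorphM ?ab//.
rewrite ![_ * beta]mulrC variation_mul// (variation_anti ab) resE betai.
by rewrite /variation resE; ring.
Qed.

End Arctic.

(** * The comparison theorem *)

Section Comparison.
Variables (R : realType) (S : preorderedSemiRing) (u : S) (d : nat).
Variable nrm : {rmorphism S -> posvec R d}.
Hypothesis uP : power_universal u.
Hypothesis nrm_surj : forall v : posvec R d, exists a : S, nrm a = v.
Hypothesis nrm_ker : forall a, nrm a = 0 -> a = 0.
Hypothesis le_nrm : forall a b : S, (a <= b)%S -> nrm a = nrm b.
Hypothesis nrm_connected : forall a b : S, nrm a = nrm b -> order_connected a b.
Implicit Types a b c x y z : S.

Ltac nonzero := nonzero_with nrm_ker.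
Let neq0 := nrm_eq_neq0 nrm_ker.
Let u0 : u != 0 := u_neq0 uP.
Let one0 : (1 : S) != 0. Proof. by nonzero. Qed.
Let nrmu : nrm u = nrm 1 := nrm_u le_nrm uP.
Let one_le_u : (1 <= u)%S. Proof. by case: uP. Qed.

Section ValuationSpectrum.
Variable lam : S -> R.
Hypothesis vl : valuation nrm lam.
Hypothesis lam_u : lam u = lam 1 + 1.
Hypothesis lam_mono : forall a b, a != 0 -> (a <= b)%S -> lam a <= lam b.

(** The pair of [v] and [w] is that of [1] and [u] for [mu = lam], and that of [u]
    and [1] for [mu = - lam]. *)
Lemma max_hom mu v w : valuation nrm mu -> v != 0 -> nrm v = nrm w ->
  mu w = mu v + 1 -> mu (v * w + v * w) < mu (v ^+ 2 + w ^+ 2) ->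
  exists K : preorderedSemiRing, (K = Rplus R \/ K = TRplus R) /\
    exists phi : {rmorphism S -> K}, (forall a, phi a = 0 -> a = 0) /\
    forall a b, a != 0 -> nrm a = nrm b -> (phi a <= phi b)%S <-> mu a <= mu b.
Proof.
move=> vmu v0 vw muw max.
have [ell [ell_mul ell_ge ell_add ellE]] :=
  ambient_log nrm_ker nrm_surj vmu v0 vw muw max.
have [k k0] := ambient_hom nrm_ker ell_mul ell_ge ell_add.
have cmp a b : a != 0 -> nrm a = nrm b ->
    (expR (k * ell a) <= expR (k * ell b)) = (mu a <= mu b).
  by move=> a0 ab; rewrite ler_expR ler_pM2l// -subr_ge0 ellE// subr_ge0.
case=> -[phi phiE]; [exists (Rplus R) | exists (TRplus R)]; split.
- by left.
- exists phi; split=> [a pa|a b a0 ab].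
    apply/eqP; apply: contraT => a0; have := phiE a a0.
    by rewrite pa => /eqP; rewrite lt_eqF// expR_gt0.
  by rewrite -cmp// -!phiE//; exact: neq0 a0.
- by right.
- exists phi; split=> [a pa|a b a0 ab].
    apply/eqP; apply: contraT => a0; have := phiE a a0.
    by rewrite pa => /eqP; rewrite lt_eqF// expR_gt0.
  by rewrite -cmp// -!phiE//; exact: neq0 a0.
Qed.


Lemma le_zero_eq0 a b : (a <= b)%S -> a = 0 -> b = 0.
Proof. by move=> /le_nrm + a0; rewrite a0 rmorph0 => /esym/nrm_ker. Qed.

(** As [lam] separates [1] from [u], the homomorphism is nondegenerate. *)
Lemma spectral_point_of_hom (K : preorderedSemiRing) (phi : {rmorphism S -> K}) :
  spectral_target R K -> (forall a, phi a = 0 -> a = 0) ->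
  (forall a b, a != 0 -> nrm a = nrm b -> (phi a <= phi b)%S <-> lam a <= lam b) ->
  spectral_point R phi.
Proof.
move=> tK ker cmp; split => //.
- move=> a b ab; have [a0|a0] := eqVneq a 0.
    by rewrite (le_zero_eq0 ab a0) a0; exact: sle_refl.
  by apply/cmp => //; [exact: le_nrm | exact: lam_mono].
- move=> deg; have := deg 1 u one_le_u => e.
  have : (phi u <= phi 1)%S by rewrite e; exact: sle_refl.
  by move/(cmp u 1 u0 nrmu); rewrite lam_u; lra.
Qed.

(** A negative sign is treated by exchanging the roles of [1] and [u] and passing to
    [- lam]; the homomorphism then reverses the order. *)
Lemma spectral_or_arctic :
  (exists (K : preorderedSemiRing) (phi : {rmorphism S -> K}),
    spectral_point R phi /\
    forall a b, a != 0 -> nrm a = nrm b -> (phi a <= phi b)%S <-> lam a <= lam b)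
  \/ lam (u * 1 + u * 1) = lam (u ^+ 2 + 1 ^+ 2).
Proof.
have [lt|gt|] := ltgtP (lam (u * 1 + u * 1)) (lam (u ^+ 2 + 1 ^+ 2)); last by right.
- left; have lt' : lam (1 * u + 1 * u) < lam (1 ^+ 2 + u ^+ 2).
    by rewrite [1 * u]mulrC [1 ^+ 2 + _]addrC.
  have [K [HK [phi [ker cmp]]]] := max_hom vl one0 (esym nrmu) lam_u lt'.
  exists K, phi; split => //; apply: spectral_point_of_hom => //.
  by case: HK => ->; [exact: Or41 | exact: Or43].
- left; have lam_u' : - lam 1 = - lam u + 1 by rewrite lam_u; lra.
  have gt' : - lam (u * 1 + u * 1) < - lam (u ^+ 2 + 1 ^+ 2) by rewrite ltrN2.
  have [K [HK [phi [ker cmp]]]] :=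
    max_hom (valuation_opp nrm_ker vl) u0 nrmu lam_u' gt'.
  have cmp' a b : a != 0 -> nrm a = nrm b ->
      (phi b <= phi a)%S <-> lam a <= lam b.
    by move=> a0 ab; rewrite cmp ?lerN2//; exact: neq0 a0.
  exists (opposite K), phi; split => //; apply: spectral_point_of_hom => //.
  by case: HK => ->; [exact: Or42 | exact: Or44].
Qed.

(* Test derivations will be chosen to vanish on the subsemiring [Z]; if it
   consists of the scalars, this makes them linear. *)
Variables (P : {additive S -> R} -> Prop) (Z : S -> Prop).
Hypotheses (Z0 : Z 0) (Z1 : Z 1).
Hypothesis ZD : forall a b, Z a -> Z b -> Z (a + b).
Hypothesis ZM : forall a b, Z a -> Z b -> Z (a * b).
Hypothesis Z_inj : forall i a b, Z a -> Z b -> coord nrm i a = coord nrm i b -> a = b.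
Hypothesis ZP : forall (i : 'I_d) (D : {additive S -> R}),
  derivation (component i \o nrm) D -> (forall a, Z a -> D a = 0) -> P D.

Lemma arctic_test_derivation :
  lam (u * 1 + u * 1) = lam (u ^+ 2 + 1 ^+ 2) ->
  exists (i : 'I_d) (D : {additive S -> R}), test_derivation nrm u P i D /\
    forall a b, nrm a = nrm b -> D b - D a = coord nrm i a * (lam b - lam a).
Proof.
move=> arctic.
have [i /(_ Z Z0 Z1 ZD ZM (@Z_inj i))[D [DM DB DZ]]] :=
  arctic_derivation nrm_ker nrm_surj vl nrmu lam_u arctic.
have D1 := DZ 1 Z1.
exists i, D; split=> //; split.
- by apply: (ZP (i := i)) => // a b; exact: DM.
- by move=> a b; exact: DM.
- move=> a b ab; have [a0|a0] := eqVneq a 0.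
    by rewrite (le_zero_eq0 ab a0) a0.
  rewrite -subr_ge0 DB; last exact: le_nrm.
  by rewrite mulr_ge0 ?coord_ge0// subr_ge0 lam_mono.
- by have := DB _ _ (esym nrmu); rewrite D1 coord1 lam_u; lra.
Qed.

Variables x y : S.
Hypothesis x0 : x != 0.
Hypothesis xy : nrm x = nrm y.

Lemma spectral_conditions_valuation :
  spectral_conditions nrm u P x y -> lam x <= lam y.
Proof.
move=> [Hphi HD].
have [[K [phi [sp cmp]]]|arctic] := spectral_or_arctic.
  by apply/cmp => //; exact: Hphi.
have [i [D [tD DB]]] := arctic_test_derivation arctic.
have := HD i D tD; rewrite -subr_ge0 DB// pmulr_rge0 ?subr_ge0//.
exact: coord_gt0.
Qed.

Lemma strict_spectral_conditions_valuation :
  strict_spectral_conditions nrm u P x y -> lam x < lam y.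
Proof.
move=> [Hphi HD].
have y0 := neq0 xy x0.
have [[K [phi [sp cmp]]]|arctic] := spectral_or_arctic.
  rewrite ltNge; apply/negP => /(cmp y x y0 (esym xy)).
  by have [_] := Hphi K phi sp.
have [i [D [tD DB]]] := arctic_test_derivation arctic.
have := HD i D tD; rewrite -subr_gt0 DB// pmulr_rgt0 ?subr_gt0//.
exact: coord_gt0.
Qed.

End ValuationSpectrum.

Section Order.

Lemma sle_mul2 a b c e : (a <= b)%S -> (c <= e)%S -> (a * c <= b * e)%S.
Proof.
move=> ab ce; apply: (@sle_trans _ (a * e)); first exact: sle_mul.
by rewrite ![_ * e]mulrC; exact: sle_mul.
Qed.

Lemma sle_exp n a b : (a <= b)%S -> (a ^+ n <= b ^+ n)%S.
Proof.
move=> ab; elim: n => [|n IH]; first exact: sle_refl.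
by rewrite !exprS; exact: sle_mul2.
Qed.

Lemma sle_exp_nat (v : S) m n : (1 <= v)%S -> (m <= n)%N -> (v ^+ m <= v ^+ n)%S.
Proof.
move=> v1 mn; rewrite -(subnK mn) exprD -[X in (X <= _)%S]mul1r.
apply: sle_mul2; last exact: sle_refl.
by rewrite -(expr1n _ (n - m)); exact: sle_exp.
Qed.

(** The factor [c] can be carried along unchanged through all powers; in the end it
    is removed by an inverse up to norm, at the cost of a fixed power of [u]. *)
Lemma frac_le_powers a b : frac_le a b ->
  exists K, forall j, (a ^+ j <= u ^+ K * b ^+ j)%S.
Proof.
case=> c c0 cab.
have [c' c'0 cc'] := nrm_inverse nrm_ker nrm_surj c0.
have [k hk] := nrm_growth nrm_ker le_nrm uP nrm_connected one0 (esym cc').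
have cc'0 : c * c' != 0 by nonzero.
have [k' hk'] := nrm_growth nrm_ker le_nrm uP nrm_connected cc'0 cc'.
have cj j : (c * a ^+ j <= c * b ^+ j)%S.
  elim: j => [|j IH]; first exact: sle_refl.
  rewrite !exprS; apply: (@sle_trans _ (a * (c * b ^+ j))).
    by rewrite mulrCA; exact: sle_mul.
  have -> : a * (c * b ^+ j) = c * a * b ^+ j by ring.
  by rewrite mulrA; apply: sle_mul2 => //; exact: sle_refl.
exists (k + k')%N => j.
apply: (@sle_trans _ (u ^+ k * (c * c') * a ^+ j)).
  by rewrite -[X in (X <= _)%S]mul1r; apply: sle_mul2 => //; exact: sle_refl.
apply: (@sle_trans _ (u ^+ k * (c * c') * b ^+ j)).
  have E z : u ^+ k * (c * c') * z = u ^+ k * c' * (c * z) by ring.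
  by rewrite !E; exact: sle_mul.
apply: sle_mul2; last exact: sle_refl.
by rewrite exprD; apply: sle_mul; rewrite mulr1 in hk'.
Qed.

End Order.

Section AsymptoticToSpectral.

(** Take logarithms, divide by [n], and let [eps] tend to [0]. *)
Lemma asymptotic_log_le (L : S -> R) x y :
  (forall a b, a != 0 -> b != 0 -> L (a * b) = L a + L b) ->
  (forall a b, a != 0 -> (a <= b)%S -> L a <= L b) ->
  x != 0 -> y != 0 -> asymptotic_le R u x y -> L x <= L y.
Proof.
move=> LM Lmono x0 y0 asym.
have L1 : L 1 = 0 by have := LM 1 1 one0 one0; rewrite mulr1; lra.
have LX a n : a != 0 -> L (a ^+ n) = n%:R * L a.
  move=> a0; elim: n => [|n IH]; first by rewrite expr0 L1 mul0r.
  have an0 : a ^+ n != 0 by nonzero.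
  by rewrite exprS LM// IH -[n.+1%:R]natr1; lra.
have Lu : 0 <= L u by rewrite -L1; exact: Lmono.
apply/ler_addgt0Pr => e e0.
have eps0 : 0 < e / (L u + 1) by rewrite divr_gt0// ltr_wpDl.
have [m _ Hm] := asym _ eps0.
have := Hm m.+1 (leqnSn m); set t := Num.truncn _ => H.
have xm0 : x ^+ m.+1 != 0 by nonzero.
have ut0 : u ^+ t != 0 by nonzero.
have ym0 : y ^+ m.+1 != 0 by nonzero.
have := Lmono _ _ xm0 H; rewrite LM// !LX//.
have m0 : 0 < m.+1%:R :> R by rewrite ltr0n.
have tle : t%:R <= e / (L u + 1) * m.+1%:R.
  by rewrite truncn_le mulr_ge0// ltW.
have : t%:R * L u <= e * m.+1%:R.
  have le1 : t%:R * L u <= t%:R * (L u + 1) by rewrite ler_wpM2l// lerDl.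
  apply: le_trans le1 _.
  have -> : e * m.+1%:R = e / (L u + 1) * m.+1%:R * (L u + 1).
    by field; rewrite gt_eqF// ltr_wpDl.
  by rewrite ler_wpM2r// addr_ge0.
move=> h1 h2; have : m.+1%:R * L x <= m.+1%:R * (L y + e) by lra.
by rewrite ler_pM2l.
Qed.

(** For a derivation over the [i]-th coordinate, the logarithmic derivative plays
    the role of the logarithm. *)
Lemma asymptotic_spectral P x y : x != 0 -> nrm x = nrm y ->
  asymptotic_le R u x y -> spectral_conditions nrm u P x y.
Proof.
move=> x0 xy asym; have y0 := neq0 xy x0; split.
- have logs (phi : S -> {nonneg R}) :
      (forall a, a != 0 -> 0 < (phi a)%:num) ->
      (forall a b, (phi (a * b))%:num = (phi a)%:num * (phi b)%:num) ->
      ((forall a b, (a <= b)%S -> (phi a)%:num <= (phi b)%:num) ->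
         (phi x)%:num <= (phi y)%:num) /\
      ((forall a b, (a <= b)%S -> (phi b)%:num <= (phi a)%:num) ->
         (phi y)%:num <= (phi x)%:num).
    move=> pos mulE; split=> mono.
      rewrite -ler_ln ?posrE ?pos//.
      apply: (@asymptotic_log_le (fun a => ln (phi a)%:num)) => // a b a0 b0.
        by rewrite mulE lnM// posrE pos.
      rewrite ler_ln ?posrE ?pos ?mono//; exact: neq0 (le_nrm b0) a0.
    rewrite -ler_ln ?posrE ?pos// -lerN2.
    apply: (@asymptotic_log_le (fun a => - ln (phi a)%:num)) => // a b a0 b0.
      by rewrite mulE lnM ?posrE ?pos// opprD.
    rewrite lerN2 ler_ln ?posrE ?pos ?mono//; exact: neq0 (le_nrm b0) a0.
  have pos_of (phi : S -> {nonneg R}) : (forall a, (phi a)%:num = 0 -> a = 0) ->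
      forall a, a != 0 -> 0 < (phi a)%:num.
    move=> ker a a0; rewrite lt_neqAle (ge0 (phi a)) andbT eq_sym.
    by apply/eqP => /ker/eqP; exact/negP.
  move=> K phi [tK mono _ ker].
  have kerE (psi : S -> {nonneg R}) : (forall a, psi a = 0%:nng -> a = 0) ->
      forall a, (psi a)%:num = 0 -> a = 0.
    by move=> kp a pa; apply: kp; apply/val_inj.
  case: tK phi mono ker => -> phi mono ker.
  + have [H _] := logs phi (pos_of phi (kerE phi ker)) (fun a b => congr1 _ (rmorphM phi a b)).
    by apply: H.
  + have [_ H] := logs phi (pos_of phi (kerE phi ker)) (fun a b => congr1 _ (rmorphM phi a b)).
    by apply: H.
  + have [H _] := logs phi (pos_of phi (kerE phi ker)) (fun a b => congr1 _ (rmorphM phi a b)).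
    by apply: H.
  + have [_ H] := logs phi (pos_of phi (kerE phi ker)) (fun a b => congr1 _ (rmorphM phi a b)).
    by apply: H.
- move=> i D [_ DM Dmono Du].
  have cpos a : a != 0 -> 0 < coord nrm i a by exact: coord_gt0.
  have cE : coord nrm i x = coord nrm i y := nrm_eq_coord i xy.
  suff : D x / coord nrm i x <= D y / coord nrm i y.
    by rewrite cE ler_pM2r// invr_gt0 cpos.
  apply: (@asymptotic_log_le (fun a => D a / coord nrm i a)) => // a b a0 b0.
    rewrite DM coordM -!/(coord nrm i _).
    by field; rewrite !gt_eqF// cpos.
  have e : coord nrm i a = coord nrm i b := nrm_eq_coord i (le_nrm b0).
  by rewrite e ler_pM2r ?invr_gt0 ?Dmono// -e cpos.
Qed.

End AsymptoticToSpectral.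

Section SpectralToAsymptotic.

Lemma growth_all x y : x != 0 -> nrm x = nrm y ->
  exists k, forall n, (x ^+ n <= u ^+ (k * n) * y ^+ n)%S.
Proof.
move=> x0 xy.
have [k hk] := nrm_growth nrm_ker le_nrm uP nrm_connected x0 xy.
by exists k => n; rewrite exprM -exprMn; exact: sle_exp.
Qed.

(** Powers of [x] and [y] of exponent divisible by [p] determine all powers up
    to a bounded power of [u]. *)
Lemma powers_from_multiples x y (f : nat -> nat) (p c e : nat) : x != 0 -> nrm x = nrm y ->
  (0 < p)%N ->
  (forall j, (u ^+ f j * x ^+ (p * j) <= u ^+ (c + e * j) * y ^+ (p * j))%S) ->
  exists C, forall n,
    (u ^+ f (n %/ p)%N * x ^+ n <= u ^+ (C + e * (n %/ p)) * y ^+ n)%S.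
Proof.
move=> x0 xy p0 H; have [k hk] := growth_all x0 xy.
exists (c + k * p)%N => n.
have en z : z ^+ n = z ^+ (p * (n %/ p)) * z ^+ (n %% p) :> S.
  by rewrite -exprD {1}(divn_eq n p) mulnC.
rewrite !en mulrA.
have := sle_mul2 (H (n %/ p)%N) (hk (n %% p)%N).
move/sle_trans; apply.
have -> : u ^+ (c + e * (n %/ p)) * y ^+ (p * (n %/ p)) *
    (u ^+ (k * (n %% p)) * y ^+ (n %% p)) =
    u ^+ (c + e * (n %/ p) + k * (n %% p)) *
    (y ^+ (p * (n %/ p)) * y ^+ (n %% p)) by rewrite [in RHS]exprD; ring.
apply: sle_mul2; last exact: sle_refl.
apply: sle_exp_nat => //.
by rewrite addnAC leq_add2r leq_add2l leq_mul2l ltnW ?orbT// ltn_mod.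
Qed.

Variables (P : {additive S -> R} -> Prop) (Z : S -> Prop).
Hypotheses (Z0 : Z 0) (Z1 : Z 1).
Hypothesis ZD : forall a b, Z a -> Z b -> Z (a + b).
Hypothesis ZM : forall a b, Z a -> Z b -> Z (a * b).
Hypothesis Z_inj : forall i a b, Z a -> Z b -> coord nrm i a = coord nrm i b -> a = b.
Hypothesis ZP : forall (i : 'I_d) (D : {additive S -> R}),
  derivation (component i \o nrm) D -> (forall a, Z a -> D a = 0) -> P D.

Variables x y : S.
Hypothesis x0 : x != 0.
Hypothesis xy : nrm x = nrm y.
Let y0 : y != 0 := neq0 xy x0.

(** A valuation that separates [x ^+ m] and [u * y ^+ m] would satisfy
    [1 + m * (lam y - lam x) <= 0], hence [lam y < lam x]. *)
Lemma spectral_frac_le m : spectral_conditions nrm u P x y ->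
  exists n, frac_le (u * (x ^+ m) ^+ n.+1) ((u * y ^+ m) ^+ n.+1).
Proof.
move=> cond; apply: contrapT => /forallNP none.
have xm0 : x ^+ m != 0 by nonzero.
have nm : nrm (x ^+ m) = nrm (u * y ^+ m).
  by rewrite rmorphM !rmorphXn nrmu rmorph1 mul1r xy.
have [lam [vl lam_u lam_mono le]] := separating_valuation
  nrm_ker le_nrm uP nrm_connected nrm_surj xm0 nm none.
have := spectral_conditions_valuation vl lam_u lam_mono
  Z0 Z1 ZD ZM Z_inj ZP x0 xy cond.
have := shifted_exp nrm_ker le_nrm uP m vl lam_u y0 (esym xy).
rewrite -subr_le0 in le => E h; rewrite E in le.
have : 0 <= m%:R * (lam y - lam x) by rewrite mulr_ge0// subr_ge0.
by lra.
Qed.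

Lemma strict_spectral_frac_le : strict_spectral_conditions nrm u P x y ->
  exists n, frac_le (u * x ^+ n.+1) (y ^+ n.+1).
Proof.
move=> cond; apply: contrapT => /forallNP none.
have [lam [vl lam_u lam_mono le]] := separating_valuation
  nrm_ker le_nrm uP nrm_connected nrm_surj x0 xy none.
have := strict_spectral_conditions_valuation vl lam_u lam_mono
  Z0 Z1 ZD ZM Z_inj ZP x0 xy cond.
by rewrite ltNge le.
Qed.

Lemma spectral_asymptotic : spectral_conditions nrm u P x y ->
  asymptotic_le R u x y.
Proof.
move=> cond eps eps0.
pose m := (Num.truncn (2%:R / eps)).+1.
have m_eps : 2%:R < eps * m%:R.
  by rewrite mulrC -ltr_pdivrMr//; exact: truncnS_gt.
have [n /(frac_le_powers)[c hc]] := spectral_frac_le m cond.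
pose p := (m * n.+1)%N; have p0 : (0 < p)%N by rewrite muln_gt0.
have H j : (u ^+ 0 * x ^+ (p * j) <= u ^+ (c + n.+1 * j) * y ^+ (p * j))%S.
  have E1 : (u * (x ^+ m) ^+ n.+1) ^+ j = u ^+ j * x ^+ (p * j).
    by rewrite /p exprMn !exprM.
  have E2 : ((u * y ^+ m) ^+ n.+1) ^+ j = u ^+ (n.+1 * j) * y ^+ (p * j).
    by rewrite /p !exprM !exprMn.
  have h := hc j; rewrite E1 E2 mulrA -exprD in h; apply: sle_trans h.
  by apply: sle_mul2; [exact: sle_exp_nat | exact: sle_refl].
have [C HC] := powers_from_multiples x0 xy p0 H.
pose N := (Num.truncn (2%:R * C%:R / eps)).+1.
exists N => // k /= Nk.
have := HC k; rewrite mul1r => /sle_trans; apply.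
apply: sle_mul2; last exact: sle_refl.
apply: sle_exp_nat => //.
have k0 : 0 <= eps * k%:R by rewrite mulr_ge0// ltW.
rewrite truncn_ge_nat// natrD.
have hC : 2%:R * C%:R <= eps * k%:R.
  rewrite [leRHS]mulrC -ler_pdivrMr//.
  by apply: le_trans (ltW (truncnS_gt _)) _; rewrite ler_nat.
have hq : m%:R * (n.+1 * (k %/ p))%N%:R <= k%:R :> R.
  by rewrite -natrM mulnA -/p mulnC ler_nat leq_divM.
have hq0 : 0 <= (n.+1 * (k %/ p))%N%:R :> R by [].
have : 2%:R * (n.+1 * (k %/ p))%N%:R <= eps * k%:R.
  apply: le_trans (_ : eps * m%:R * (n.+1 * (k %/ p))%N%:R <= _).
    by rewrite ler_wpM2r// ltW.
  by rewrite -mulrA ler_pM2l.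
by lra.
Qed.

Section Strict.
Hypothesis strict : strict_spectral_conditions nrm u P x y.

Lemma strict_eventually_le : exists k : nat,
  \forall n \near \oo, (u ^+ k * x ^+ n <= u ^+ k * y ^+ n)%S.
Proof.
have [n /(frac_le_powers)[c hc]] := strict_spectral_frac_le strict.
have H j : (u ^+ j * x ^+ (n.+1 * j) <= u ^+ (c + 0 * j) * y ^+ (n.+1 * j))%S.
  by rewrite mul0n addn0 !exprM -exprMn.
have [C HC] := powers_from_multiples x0 xy (ltn0Sn n) H.
exists C; exists (C * n.+1)%N => // k /= Ck.
have := HC k; rewrite mul0n addn0; apply: sle_trans.
apply: sle_mul2; last exact: sle_refl.
by apply: sle_exp_nat => //; rewrite leq_divRL.
Qed.

(** The gain of [u] per power of [x ^+ n.+1] is converted into a gain of one power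
    of [y], which eventually compensates the bounded power of [u] because [u] is
    at most a power of [y]. *)
Lemma strict_eventually_le_universal : power_universal y ->
  \forall n \near \oo, (x ^+ n <= y ^+ n)%S.
Proof.
move=> [_ one_le_y y_univ].
have [q hq] := y_univ 1 u one0 u0 one_le_u; rewrite mul1r in hq.
have ny : nrm y = nrm 1 by rewrite -(le_nrm one_le_y).
have [c0 hc0] := nrm_growth nrm_ker le_nrm uP nrm_connected y0 ny.
rewrite mulr1 in hc0.
have hc : (y <= u ^+ c0.+1)%S by apply: (sle_trans hc0); exact: sle_exp_nat.
have [n lt] := strict_spectral_frac_le strict.
have fp := frac_le_preorder nrm_ker le_nrm.
pose p := (n.+1 * c0.+1)%N.
have p_gt0 : (0 < p)%N by rewrite muln_gt0.
have le1 : frac_le (y * x ^+ p) (y * y ^+ p.-1).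
  rewrite -exprS prednK//.
  apply: (fp_trans fp (b := u ^+ c0.+1 * x ^+ p)).
    apply: (sle_frac nrm_ker); apply: sle_mul2 => //; exact: sle_refl.
  by have := fp_exp fp c0.+1 lt; rewrite exprMn -!exprM.
have [K hK] := frac_le_powers (fp_cancel fp y0 le1).
have [k hk] := growth_all x0 xy.
have uy m : (u ^+ m <= y ^+ (q * m))%S by rewrite exprM; exact: sle_exp.
exists ((q * K + q * (k * p)) * p)%N => // N /= hN.
have jN : (q * K + q * (k * p) <= N %/ p)%N by rewrite leq_divRL.
set j := (N %/ p)%N in jN; set r := (N %% p)%N.
have rp : (r <= p)%N by rewrite ltnW// ltn_mod.
have eN : N = (p * j + r)%N by rewrite /j /r mulnC -divn_eq.
rewrite eN exprD exprM.
apply: (@sle_trans _ (u ^+ K * (y ^+ p.-1) ^+ j * (u ^+ (k * r) * y ^+ r))).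
  by apply: sle_mul2; [exact: hK | exact: hk].
apply: (@sle_trans _ (y ^+ (q * K) * (y ^+ p.-1) ^+ j * (y ^+ (q * (k * r)) * y ^+ r))).
  apply: sle_mul2; apply: sle_mul2; by [exact: uy | exact: sle_refl].
rewrite -exprM -!exprD; apply: sle_exp_nat => //.
rewrite addnA leq_add2r -{2}(prednK p_gt0) mulSn.
rewrite addnAC leq_add2r; apply: leq_trans jN.
by rewrite leq_add2l leq_mul2l leq_mul2l rp !orbT.
Qed.

Lemma catalyst_neq0 k n : catalyst u k n x y != 0.
Proof.
by rewrite /catalyst big_ord_recl expr0 mul1r subn0; nonzero.
Qed.

(** Multiplied by [x] or by [y], the sum has all terms in common but one. *)
Lemma catalyst_le k n : (u ^+ k * x ^+ n.+1 <= u ^+ k * y ^+ n.+1)%S ->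
  (catalyst u k n x y * x <= catalyst u k n x y * y)%S.
Proof.
move=> H; pose T := \sum_(j < n) x ^+ j.+1 * y ^+ (n - j).
have -> : catalyst u k n x y * x = u ^+ k * T + u ^+ k * x ^+ n.+1.
  rewrite /catalyst -mulrA mulr_suml big_ord_recr /= subnn mulr1 -exprSr mulrDr.
  congr (_ * _ + _); apply: eq_bigr => j _.
  by rewrite exprSr mulrAC.
have -> : catalyst u k n x y * y = u ^+ k * T + u ^+ k * y ^+ n.+1.
  rewrite /catalyst -mulrA mulr_suml big_ord_recl /= subn0 mul1r -exprSr.
  rewrite mulrDr addrC; congr (_ * _ + _); apply: eq_bigr => j _.
  by rewrite /bump leq0n add1n -mulrA -exprSr subnSK.
exact: sle_add.
Qed.

Lemma strict_catalyst : exists k : nat, \forall n \near \oo,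
  catalyst u k n x y != 0 /\
  (catalyst u k n x y * x <= catalyst u k n x y * y)%S.
Proof.
have [k [N _ HN]] := strict_eventually_le; exists k; exists N => // n /= Nn.
split; first exact: catalyst_neq0.
by apply: catalyst_le; apply: HN; exact: leqW.
Qed.

End Strict.

Theorem comparison : comparison_claims nrm u P x y.
Proof.
split; first split.
- exact: spectral_asymptotic.
- exact: asymptotic_spectral.
- move=> strict; have [k hk] := strict_catalyst strict.
  split; [exact: strict_eventually_le | exact: strict_eventually_le_universal | |
          by exists k].
  have [N _ /(_ N (leqnn N))[c0 hc]] := hk.
  by exists (catalyst u k N x y).
Qed.

End SpectralToAsymptotic.

Section Semialgebra.
Variable scale : nnreal R -> S -> S.
Hypothesis sc : semialgebra scale.

Lemma scale_mulE r a : scale r a = scale r 1 * a.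
Proof.
by rewrite -{2}(scale_1 sc a) (scale_M sc) !mulr1 mul1r.
Qed.

(** The scalars give an endomorphism of the ordered semiring of nonnegative real
    numbers, and the identity is the only one. *)
Lemma coord_scale i r : coord nrm i (scale r 1) = r%:num.
Proof.
pose g s := coord nrm i (scale s 1).
have gD s t : g (s + t) = g s + g t by rewrite /g (scale_Dl sc) coordD.
have gM s t : g (s * t) = g s * g t.
  by rewrite /g -{1}[1]mulr1 -(scale_M sc) coordM.
have natE n : (n%:R : nnreal R)%:num = n%:R :> R.
  by elim: n => [|n IH] //; rewrite -!natr1 -IH.
have g_nat n : g n%:R = n%:R.
  elim: n => [|n IH]; first by rewrite /g (scale_0l sc) coord0.
  by rewrite -!natr1 gD IH /g (scale_1 sc) coord1.
have gmono (s t : nnreal R) : s%:num <= t%:num -> g s <= g t.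
  move=> st; have d0 : 0 <= t%:num - s%:num by rewrite subr_ge0.
  have -> : t = s + (NngNum d0 : nnreal R) by apply/val_inj; rewrite /= addrC subrK.
  by rewrite gD lerDl; exact: coord_ge0.
have close n : `|n%:R * (g r - r%:num)| <= 1.
  have nr0 : 0 <= n%:R * r%:num :> R by rewrite mulr_ge0.
  pose m := Num.truncn (n%:R * r%:num).
  have lo : m%:R <= n%:R * r%:num by rewrite truncn_le.
  have hi : n%:R * r%:num <= m.+1%:R by exact/ltW/truncnS_gt.
  have numE : (n%:R * r : nnreal R)%:num = n%:R * r%:num by rewrite /= natE.
  have h1 : g m%:R <= g (n%:R * r) by apply: gmono; rewrite numE natE.
  have h2 : g (n%:R * r) <= g m.+1%:R by apply: gmono; rewrite numE natE.
  rewrite gM !g_nat in h1 h2; rewrite -[m.+1%:R]natr1 in h2 hi.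
  by rewrite ler_norml; apply/andP; split; lra.
by apply/eqP; rewrite -subr_eq0; apply/eqP; exact: archi_eq0 close.
Qed.

End Semialgebra.
End Comparison.

Theorem theorem1p2 (R : realType) (S : preorderedSemiRing) (u : S) (d : nat)
    (nrm : {rmorphism S -> posvec R d}) :
  power_universal u ->
  (forall v : posvec R d, exists a : S, nrm a = v) ->
  trivial_kernel nrm ->
  (forall a b : S, (a <= b)%S -> nrm a = nrm b) ->
  (forall a b : S, nrm a = nrm b -> order_connected a b) ->
  forall x y : S, x != 0 -> y != 0 -> nrm x = nrm y ->
    comparison_claims nrm u (fun=> True) x y /\
    (forall scale : nnreal R -> S -> S, semialgebra scale ->
       comparison_claims nrm u (Rplus_linear scale) x y).
Proof.
move=> uP nrm_surj nrm_ker le_nrm nrm_conn x y x0 _ xy; split.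
- apply: (@comparison _ _ _ _ nrm uP nrm_surj nrm_ker le_nrm nrm_conn _
    (fun a => exists n, a = n%:R)) => //.
  + by exists 0%N.
  + by exists 1%N.
  + by move=> _ _ [m ->] [n ->]; exists (m + n)%N; rewrite natrD.
  + by move=> _ _ [m ->] [n ->]; exists (m * n)%N; rewrite natrM.
  + by move=> i _ _ [m ->] [n ->]; rewrite !coord_nat => /eqP; rewrite eqr_nat => /eqP->.
- move=> scale sc.
  apply: (@comparison _ _ _ _ nrm uP nrm_surj nrm_ker le_nrm nrm_conn _
    (fun a => exists r, a = scale r 1)) => //.
  + by exists 0; rewrite (scale_0l sc).
  + by exists 1; rewrite (scale_1 sc).
  + by move=> _ _ [r ->] [s ->]; exists (r + s); rewrite (scale_Dl sc).
  + by move=> _ _ [r ->] [s ->]; exists (r * s); rewrite (scale_M sc) mulr1.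
  + move=> i _ _ [r ->] [s ->]; rewrite !(coord_scale nrm sc) => rs.
    by congr scale; apply/val_inj.
  + move=> i D DM D0 r a; rewrite (scale_mulE sc) DM (D0 (scale r 1)); last by exists r.
    by rewrite mul0r addr0; congr (_ * _); exact: (coord_scale nrm sc).
Qed.
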